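(* Let $\mathbb{X}$ be a Banach space, $\mathcal{C}:=C([-1,0],\mathbb{X})$, and let $M,\omega$ be constants. Let $A_0$ generate a $C_0$-semigroup $(T_0(t))_{t\ge0}$ on $\mathbb{X}$ with $\|T_0(t)\|\le Me^{\omega t}$ for $t\ge0$, and let $B_0\in\mathcal{L}(\mathcal{C},\mathbb{X})$. Assume that the partial functional differential equation $$u'(t)=A_0u(t)+B_0u_t,\quad t\ge0,$$ has an exponential dichotomy. Then there exists $\eta>0$ such that, whenever $A_1$ generates a $C_0$-semigroup $(T_1(t))_{t\ge0}$ on $\mathbb{X}$ with $\|T_1(t)\|\le Me^{\omega t}$ for $t\ge0$, $B_1\in\mathcal{L}(\mathcal{C},\mathbb{X})$, $d_Y(A_0,A_1)<\eta$ and $d_Y(B_0,B_1)<\eta$, the partial functional differential equation $$u'(t)=A_1u(t)+B_1u_t,\quad t\ge0,$$ also has an exponential dichotomy.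
   Context: For a function $u$ with values in $\mathbb{X}$, $u_t\in\mathcal{C}$ is defined by $u_t(\theta)=u(t+\theta)$, $\theta\in[-1,0]$. $\mathcal{C}$ carries the sup norm. For linear operators $A,A'$ on a Banach space whose resolvent sets contain $[\omega_0,\infty)$ for some $\omega_0$, the Yosida distance is $d_Y(A,A'):=\limsup_{\mu\to+\infty}\|A_\mu-A'_\mu\|$, where $A_\mu:=\mu^2(\mu I-A)^{-1}-\mu I$ is the Yosida approximation. For bounded operators $B_0,B_1\in\mathcal{L}(\mathcal{C},\mathbb{X})$, $d_Y(B_0,B_1)$ means the operator norm $\|B_0-B_1\|$. Solution semigroup: if $A$ generates a $C_0$-semigroup on $\mathbb{X}$ and $B\in\mathcal{L}(\mathcal{C},\mathbb{X})$, the equation $u'(t)=Au(t)+Bu_t$ generates a $C_0$-semigroup on $\mathcal{C}$, the solution semigroup, whose generator $\mathcal{G}$ is $\mathcal{G}\phi=\phi'$ with domain $D(\mathcal{G})=\{\phi\in\mathcal{C}:\phi'\in\mathcal{C},\ \phi(0)\in D(A),\ \phi'^-(0)=A\phi(0)+B\phi\}$, where $\phi'^-(0)$ is the left derivative at $0$. The equation is said to have an exponential dichotomy if its solution semigroup in $\mathcal{C}$ does. A $C_0$-semigroup $(T(t))_{t\ge0}$ on a Banach space $\mathbb{Y}$ admits an exponential dichotomy if there exist a bounded projection $P$ on $\mathbb{Y}$ and constants $N\ge1$, $\beta>0$ such that: (1) $T(t)P=PT(t)$ for $t\ge0$; (2) for each $t\ge0$ the restriction $T(t)|_{\ker P}$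 is an isomorphism of $\ker P$ onto itself, and $T(-t):=(T(t)|_{\ker P})^{-1}$; (3) $\|T(t)x\|\le Ne^{-\beta t}\|x\|$ for all $t\ge0$, $x\in\mathrm{Im}(P)$, and $\|T(-t)x\|\le Ne^{-\beta t}\|x\|$ for all $t\ge0$, $x\in\ker P$. *)

(* Defs.v *)
From Stdlib Require Import Reals Lra.
From Stdlib Require Import ClassicalEpsilon FunctionalExtensionality.
From Stdlib Require Import PropExtensionality ProofIrrelevance.
From Coquelicot Require Import Coquelicot.

Open Scope R_scope.

Definition clamp (t : R) : R := Rmax (-1) (Rmin t 0).

Lemma clamp_in (t : R) : -1 <= clamp t <= 0.
Proof.
  unfold clamp, Rmax, Rmin.
  destruct (Rle_dec t 0); destruct (Rle_dec (-1) _); lra.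
Qed.

Lemma clamp_id (t : R) : -1 <= t <= 0 -> clamp t = t.
Proof.
  intros H; unfold clamp, Rmax, Rmin.
  destruct (Rle_dec t 0); destruct (Rle_dec (-1) _); lra.
Qed.

Lemma clamp_lipschitz (s t : R) : Rabs (clamp t - clamp s) <= Rabs (t - s).
Proof.
  unfold clamp, Rmax, Rmin.
  destruct (Rle_dec t 0); destruct (Rle_dec s 0);
    repeat (destruct (Rle_dec (-1) _)); unfold Rabs;
    repeat (destruct (Rcase_abs _)); lra.
Qed.

(** A continuous function on [-1,0] is represented by its unique extension to R
    which is constant on ]-oo,-1] and on [0,+oo[ (see [CI_extension]). Only the
    values on [-1,0] enter the definitions below. *)
Record CI {K : AbsRing} (X : CompleteNormedModule K) : Type := mkCI {
  CI_fun :> R -> X;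
  CI_cont : forall t : R, continuous CI_fun t;
  CI_clamp : forall t : R, CI_fun (clamp t) = CI_fun t
}.

Arguments mkCI {K X} _ _ _.
Arguments CI_fun {K X} _ _.
Arguments CI_cont {K X} _ _.
Arguments CI_clamp {K X} _ _.

Section CI_Banach.

Context {K : AbsRing} {X : CompleteNormedModule K}.
Implicit Types f g h : CI X.

Lemma CI_ext f g : (forall t, -1 <= t <= 0 -> f t = g t) -> f = g.
Proof.
  intros H.
  assert (E : CI_fun f = CI_fun g).
  { apply functional_extensionality; intros t.
    rewrite <- (CI_clamp f), <- (CI_clamp g); apply H, clamp_in. }
  destruct f as [f f1 f2], g as [g g1 g2]; simpl in E; subst g.
  f_equal; apply proof_irrelevance.
Qed.

Lemma CI_extension (u : R -> X) :
  (forall t, -1 <= t <= 0 ->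
     filterlim u (within (fun s => -1 <= s <= 0) (locally t)) (locally (u t))) ->
  exists! f : CI X, forall t, -1 <= t <= 0 -> f t = u t.
Proof.
  intros Hu.
  assert (C : forall t, continuous (fun s => u (clamp s)) t).
  { intros t.
    apply (filterlim_comp _ _ _ clamp u _
             (within (fun s => -1 <= s <= 0) (locally (clamp t)))).
    - intros P [e HP]; exists e; intros s Hs; apply HP; [| apply clamp_in].
      apply Rle_lt_trans with (2 := Hs); apply clamp_lipschitz.
    - apply Hu, clamp_in. }
  assert (E : forall t, u (clamp (clamp t)) = u (clamp t)).
  { intros t; now rewrite (clamp_id (clamp t)) by apply clamp_in. }
  exists (mkCI (fun s => u (clamp s)) C E); split.
  - intros t Ht; simpl; now rewrite clamp_id.
  - intros g Hg; apply CI_ext; intros t Ht; simpl.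
    rewrite clamp_id by exact Ht; symmetry; now apply Hg.
Qed.

Definition CI_zero : CI X :=
  mkCI (fun _ => (zero : X)) (fun _ => filterlim_const (zero : X)) (fun _ => eq_refl).

Definition CI_plus f g : CI X.
Proof.
  refine (mkCI (fun t => plus (f t) (g t)) _ _).
  - intros t; apply (continuous_plus f g); apply CI_cont.
  - intros t; now rewrite !CI_clamp.
Defined.

Definition CI_opp f : CI X.
Proof.
  refine (mkCI (fun t => opp (f t)) _ _).
  - intros t; apply (continuous_opp f); apply CI_cont.
  - intros t; now rewrite CI_clamp.
Defined.

Definition CI_scal (k : K) f : CI X.
Proof.
  refine (mkCI (fun t => scal k (f t)) _ _).
  - intros t; apply (continuous_scal_r k f); apply CI_cont.
  - intros t; now rewrite CI_clamp.
Defined.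

Definition CI_AbelianMonoid_mixin : AbelianMonoid.mixin_of (CI X).
Proof.
  apply (AbelianMonoid.Mixin _ CI_plus CI_zero).
  - intros f g; apply CI_ext; intros t _; apply plus_comm.
  - intros f g h; apply CI_ext; intros t _; apply plus_assoc.
  - intros f; apply CI_ext; intros t _; apply plus_zero_r.
Defined.

Canonical CI_AbelianMonoid :=
  AbelianMonoid.Pack (CI X) CI_AbelianMonoid_mixin (CI X).

Definition CI_AbelianGroup_mixin : AbelianGroup.mixin_of CI_AbelianMonoid.
Proof.
  apply (AbelianGroup.Mixin CI_AbelianMonoid CI_opp).
  intros f; apply CI_ext; intros t _; apply (plus_opp_r (f t)).
Defined.

Canonical CI_AbelianGroup :=
  AbelianGroup.Pack (CI X)
    (AbelianGroup.Class _ CI_AbelianMonoid_mixin CI_AbelianGroup_mixin) (CI X).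

Definition CI_ModuleSpace_mixin : ModuleSpace.mixin_of K CI_AbelianGroup.
Proof.
  apply (ModuleSpace.Mixin K CI_AbelianGroup CI_scal).
  - intros x y f; apply CI_ext; intros t _; apply scal_assoc.
  - intros f; apply CI_ext; intros t _; apply (scal_one (f t)).
  - intros x f g; apply CI_ext; intros t _; apply (scal_distr_l x (f t) (g t)).
  - intros x y f; apply CI_ext; intros t _; apply (scal_distr_r x y (f t)).
Defined.

Canonical CI_ModuleSpace :=
  ModuleSpace.Pack K (CI X)
    (ModuleSpace.Class K _ (AbelianGroup.class CI_AbelianGroup)
       CI_ModuleSpace_mixin) (CI X).

Definition CI_norm f : R :=
  real (Lub_Rbar (fun r => exists t, -1 <= t <= 0 /\ r = norm (f t))).

Lemma CI_norm_is_lub f :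
  is_lub (fun r => exists t, -1 <= t <= 0 /\ r = norm (f t)) (CI_norm f).
Proof.
  unfold CI_norm.
  set (E := fun r => exists t, -1 <= t <= 0 /\ r = norm (f t)).
  destruct (bounded_continuity f (-1) 0) as [M HM].
  { intros x _; apply CI_cont. }
  assert (ne : E (norm (f 0))) by (exists 0; split; [lra | reflexivity]).
  destruct (completeness E) as [l Hl].
  { exists M; intros r [t [Ht ->]]; now apply Rlt_le, HM. }
  { now exists (norm (f 0)). }
  rewrite (is_lub_Rbar_unique E l); [exact Hl |].
  destruct Hl as [H1 H2]; split.
  - intros r Hr; apply H1, Hr.
  - intros [b | |] Hb; simpl; [| exact I |].
    + apply H2; intros r Hr; apply (Hb r Hr).
    + exact (Hb _ ne).
Qed.

Lemma CI_norm_ub f t : norm (f t) <= CI_norm f.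
Proof.
  apply CI_norm_is_lub; exists (clamp t); split; [apply clamp_in |].
  now rewrite CI_clamp.
Qed.

Lemma CI_norm_le f M :
  (forall t, -1 <= t <= 0 -> norm (f t) <= M) -> CI_norm f <= M.
Proof. intros H; apply CI_norm_is_lub; intros r [t [Ht ->]]; now apply H. Qed.

Lemma norm_minus_triangle (y x z : X) :
  norm (minus x z) <= norm (minus x y) + norm (minus y z).
Proof.
  rewrite (minus_trans y x z).
  exact (@norm_triangle K X (minus x y) (minus y z)).
Qed.

Lemma norm_minus_sym (x y : X) : norm (minus x y) = norm (minus y x).
Proof. rewrite <- (opp_minus y x); exact (@norm_opp K X (minus y x)). Qed.

Definition CI_ball f (e : R) g : Prop := CI_norm (minus g f) < e.

Lemma CI_norm_triangle f g : CI_norm (plus f g) <= CI_norm f + CI_norm g.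
Proof.
  apply CI_norm_le; intros t _.
  apply Rle_trans with (1 := norm_triangle (f t) (g t)).
  apply Rplus_le_compat; apply CI_norm_ub.
Qed.

Definition CI_UniformSpace_mixin : UniformSpace.mixin_of (CI X).
Proof.
  apply (UniformSpace.Mixin _ CI_zero CI_ball).
  - intros f e; unfold CI_ball; apply Rle_lt_trans with 0; [| apply cond_pos].
    apply CI_norm_le; intros t _; right.
    rewrite minus_eq_zero; apply (@norm_zero K X).
  - intros f g e; apply Rle_lt_trans.
    apply CI_norm_le; intros t _.
    change (norm (minus (f t) (g t)) <= CI_norm (minus g f)).
    rewrite norm_minus_sym; apply (CI_norm_ub (minus g f)).
  - intros f g h e1 e2 H1 H2; unfold CI_ball in *.
    rewrite (minus_trans g).
    apply Rle_lt_trans with (1 := CI_norm_triangle _ _); lra.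
Defined.

Canonical CI_UniformSpace :=
  UniformSpace.Pack (CI X) CI_UniformSpace_mixin (CI X).

Canonical CI_NormedModuleAux :=
  NormedModuleAux.Pack K (CI X)
    (NormedModuleAux.Class K (CI X) (ModuleSpace.class K CI_ModuleSpace)
       CI_UniformSpace_mixin) (CI X).

Definition CI_NormedModule_mixin : NormedModule.mixin_of K CI_NormedModuleAux.
Proof.
  apply (NormedModule.Mixin K CI_NormedModuleAux CI_norm 1).
  - exact CI_norm_triangle.
  - intros k f; apply CI_norm_le; intros t _.
    apply Rle_trans with (1 := norm_scal k (f t)).
    apply Rmult_le_compat_l; [apply abs_ge_0 | apply CI_norm_ub].
  - intros f g e H; exact H.
  - intros f g e H; rewrite Rmult_1_l; exact H.
  - intros f H; apply CI_ext; intros t _.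
    apply (norm_eq_zero (CI_fun f t)).
    apply Rle_antisym; [rewrite <- H; apply CI_norm_ub | apply norm_ge_0].
Defined.

Canonical CI_NormedModule :=
  NormedModule.Pack K (CI X)
    (NormedModule.Class K (CI X)
       (NormedModuleAux.class K CI_NormedModuleAux) CI_NormedModule_mixin)
    (CI X).

Lemma CI_complete (F : (CI X -> Prop) -> Prop) :
  ProperFilter F -> cauchy F ->
  exists f, forall e : posreal, F (ball f e).
Proof.
  intros PF CF.
  pose (Ft := fun (t : R) (P : X -> Prop) => F (fun f => P (f t))).
  assert (PFt : forall t, ProperFilter (Ft t)).
  { intros t; split.
    - intros P HP; destruct (filter_ex (F := F) _ HP) as [f Hf]; now exists (f t).
    - split; unfold Ft.
      + apply (filter_true (F := F)).
      + intros P Q HP HQ; exact (filter_and (F := F) _ _ HP HQ).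
      + intros P Q H; apply (filter_imp (F := F)); intros f; apply H. }
  assert (CFt : forall t, cauchy (Ft t)).
  { intros t e; destruct (CF e) as [f Hf]; exists (f t).
    unfold Ft; revert Hf; apply (filter_imp (F := F)); intros g Hg.
    apply (@norm_compat1 K X).
    apply Rle_lt_trans with (2 := Hg); apply (CI_norm_ub (minus g f) t). }
  pose (u := fun t => lim (Ft t)).
  assert (nf : 0 < @norm_factor K X) by apply norm_factor_gt_0.
  assert (A : forall (e : posreal) f, F (ball f e) ->
              forall t, norm (minus (f t) (u t)) <= e).
  { intros e f Hf t; apply le_epsilon; intros d Hd.
    assert (Hd' : 0 < d / @norm_factor K X) by now apply Rdiv_lt_0_compat.
    pose proof (complete_cauchy (Ft t) (PFt t) (CFt t) (mkposreal _ Hd')) as H.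
    destruct (filter_ex (F := F) _ (filter_and (F := F) _ _ Hf H)) as [g [H1 H2]].
    apply (@norm_compat2 K X) in H2; simpl in H2.
    replace (@norm_factor K X * (d / @norm_factor K X)) with d in H2
      by (field; lra).
    apply Rle_trans with (1 := norm_minus_triangle (g t) _ _).
    apply Rplus_le_compat; [| now left].
    rewrite norm_minus_sym.
    left; apply Rle_lt_trans with (2 := H1); apply (CI_norm_ub (minus g f) t). }
  assert (Cu : forall t, continuous u t).
  { intros t; apply filterlim_locally; intros e.
    assert (He : 0 < e / 4) by (generalize (cond_pos e); lra).
    destruct (CF (mkposreal _ He)) as [f Hf].
    pose proof (A _ f Hf) as Af; simpl in Af.
    assert (He' : 0 < e / 4 / @norm_factor K X) by now apply Rdiv_lt_0_compat.
    pose proof (proj1 (filterlim_locally f (f t)) (CI_cont f t)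
      (mkposreal _ He')) as L.
    revert L; apply filter_imp; intros s Hs.
    apply (@norm_compat2 K X) in Hs; simpl in Hs.
    replace (@norm_factor K X * (e / 4 / @norm_factor K X)) with (e / 4) in Hs
      by (field; lra).
    apply (@norm_compat1 K X).
    pose proof (norm_minus_triangle (f s) (u s) (u t)) as T1.
    pose proof (norm_minus_triangle (f t) (f s) (u t)) as T2.
    pose proof (Af s) as Hs1; pose proof (Af t) as Ht1.
    rewrite norm_minus_sym in Hs1.
    assert (Hs2 : norm (minus (f s) (f t)) < e / 4) by exact Hs.
    apply Rle_lt_trans with (1 := T1); generalize (cond_pos e); lra. }
  assert (Eu : forall t, u (clamp t) = u t).
  { intros t; unfold u; f_equal; unfold Ft.
    apply functional_extensionality; intros P; f_equal.
    apply functional_extensionality; intros f; now rewrite CI_clamp. }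
  exists (mkCI u Cu Eu); intros e.
  assert (He : 0 < e / 4) by (generalize (cond_pos e); lra).
  destruct (CF (mkposreal _ He)) as [f Hf].
  pose proof (A _ f Hf) as Af; simpl in Af.
  generalize Hf; apply filter_imp; intros g Hg; unfold ball; simpl; unfold CI_ball.
  rewrite (minus_trans f).
  apply Rle_lt_trans with (1 := CI_norm_triangle _ _).
  change (CI_norm (minus g f) < e / 4) in Hg.
  assert (CI_norm (minus f (mkCI u Cu Eu)) <= e / 4)
    by (apply CI_norm_le; intros t _; apply Af).
  generalize (cond_pos e); lra.
Qed.

Definition CI_lim (F : (CI X -> Prop) -> Prop) : CI X :=
  epsilon (inhabits CI_zero) (fun f => forall e : posreal, F (ball f e)).

Definition CI_CompleteSpace_mixin : CompleteSpace.mixin_of CI_UniformSpace.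
Proof.
  apply (CompleteSpace.Mixin CI_UniformSpace CI_lim).
  - intros F PF CF; unfold CI_lim.
    apply (epsilon_spec (inhabits CI_zero)
             (fun f => forall e : posreal, F (ball f e))).
    now apply CI_complete.
  - intros F G H1 H2; replace G with F; [intros e; apply ball_center |].
    apply functional_extensionality; intros P.
    apply propositional_extensionality; split; [apply H2 | apply H1].
Defined.

Canonical CI_CompleteNormedModule :=
  CompleteNormedModule.Pack K (CI X)
    (CompleteNormedModule.Class K (CI X)
       (NormedModule.class K CI_NormedModule) CI_CompleteSpace_mixin) (CI X).

End CI_Banach.

(** Banach spaces over R and over C are treated uniformly; time increments and
    the resolvent parameter are real in both cases and act through [rscal]. *)
Inductive scalar_field : Set := Real_scalars | Complex_scalars.

Definition scalars (k : scalar_field) : AbsRing :=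
  match k with Real_scalars => R_AbsRing | Complex_scalars => C_AbsRing end.

Definition of_real (k : scalar_field) : R -> scalars k :=
  match k with Real_scalars => fun r => r | Complex_scalars => RtoC end.

Definition rscal {k : scalar_field} {Y : NormedModule (scalars k)}
  (r : R) (y : Y) : Y := scal (of_real k r) y.

(** Boundedness of linear operators is Coquelicot's [is_linear]. *)
Definition opnorm {K : AbsRing} {U V : NormedModule K} (f : U -> V) : Rbar :=
  Lub_Rbar (fun r => exists x, norm x <= 1 /\ r = norm (f x)).

(** A possibly unbounded operator [A] is represented by its graph: [A x y] means
    that [x] belongs to the domain and is sent to [y]. *)
Definition operator (Y : Type) : Type := Y -> Y -> Prop.

Section Operators.

Context {k : scalar_field} {Y : NormedModule (scalars k)}.

Record C0_semigroup (T : R -> Y -> Y) : Prop := {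
  C0_bounded : forall t, 0 <= t -> is_linear (T t);
  C0_zero : forall x, T 0 x = x;
  C0_plus : forall s t x, 0 <= s -> 0 <= t -> T (s + t) x = T s (T t x);
  C0_cont : forall x, filterlim (fun t => T t x) (at_right 0) (locally x)
}.

Definition is_generator (A : operator Y) (T : R -> Y -> Y) : Prop :=
  forall x y, A x y <->
    filterlim (fun h => rscal (/ h) (minus (T h x) x)) (at_right 0) (locally y).

Definition generates (A : operator Y) (T : R -> Y -> Y) : Prop :=
  C0_semigroup T /\ is_generator A T.

(** [S t] plays the role of T(-t), and is only relevant on ker P; its
    boundedness there is part of the last estimate. *)
Definition dichotomy (T : R -> Y -> Y) : Prop :=
  exists (P : Y -> Y) (S : R -> Y -> Y) (N beta : R),
    is_linear P /\ (forall x, P (P x) = P x) /\ 1 <= N /\ 0 < beta /\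
    (forall t x, 0 <= t -> T t (P x) = P (T t x)) /\
    (forall t x, 0 <= t -> P x = zero ->
       P (T t x) = zero /\ P (S t x) = zero /\
       S t (T t x) = x /\ T t (S t x) = x) /\
    (forall t x, 0 <= t -> (exists y, x = P y) ->
       norm (T t x) <= N * exp (- beta * t) * norm x) /\
    (forall t x, 0 <= t -> P x = zero ->
       norm (S t x) <= N * exp (- beta * t) * norm x).

(** [Rm] is the bounded inverse of [mu I - A]. *)
Definition is_resolvent (A : operator Y) (mu : R) (Rm : Y -> Y) : Prop :=
  is_linear Rm /\
  (forall y, exists z, A (Rm y) z /\ minus (rscal mu (Rm y)) z = y) /\
  (forall x z, A x z -> Rm (minus (rscal mu x) z) = x).

(** Meaningful when [mu] lies in the resolvent set of [A], as it does for all
    large [mu] when [A] generates a C0-semigroup. *)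
Definition resolvent (A : operator Y) (mu : R) : Y -> Y :=
  epsilon (inhabits (fun _ => zero)) (is_resolvent A mu).

Definition yosida (A : operator Y) (mu : R) (x : Y) : Y :=
  minus (rscal (mu ^ 2) (resolvent A mu x)) (rscal mu x).

Definition limsup_p_infty (f : R -> Rbar) : Rbar :=
  Rbar_glb (fun b => exists a : R,
    b = Rbar_lub (fun r => exists mu, a <= mu /\ r = f mu)).

Definition yosida_dist (A A' : operator Y) : Rbar :=
  limsup_p_infty (fun mu =>
    opnorm (fun x => minus (yosida A mu x) (yosida A' mu x))).

End Operators.

Section Delay.

Context {k : scalar_field} {X : CompleteNormedModule (scalars k)}.

Definition diff_quot (f : R -> X) (t s : R) : X :=
  rscal (/ (s - t)) (minus (f s) (f t)).

Definition is_CI_derive (f g : CI X) : Prop :=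
  forall t, -1 <= t <= 0 ->
    filterlim (diff_quot f t) (within (fun s => -1 <= s <= 0) (locally' t))
      (locally (g t)).

Definition delay_generator (A : operator X) (B : CI X -> X) : operator (CI X) :=
  fun f g =>
    is_CI_derive f g /\
    exists y, A (f 0) y /\
      filterlim (diff_quot f 0) (at_left 0) (locally (plus y (B f))).

Definition solution_semigroup (A : operator X) (B : CI X -> X)
  (T : R -> CI X -> CI X) : Prop := generates (delay_generator A B) T.

Definition delay_dichotomy (A : operator X) (B : CI X -> X) : Prop :=
  exists T, solution_semigroup A B T /\ dichotomy T.

End Delay.

(* Main.v *)
Require Import Defs.
From Stdlib Require Import Reals Lra Lia List ZArith.
From Stdlib Require Import ClassicalEpsilon FunctionalExtensionality.
From Coquelicot Require Import Coquelicot.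

(** A finite Yosida distance bounds the difference of the resolvents at [mu] by
    [eta / mu ^ 2]. Telescoping the powers of the backward Euler steps in the
    exponential formula [T t x = lim (mu R(mu)) ^ n x], [mu = n / t], then bounds
    [T0 t - T1 t] by [C t eta]. The variation of constants formula carries this over
    to the solution semigroups on the space of histories, so that their time-[tau]
    maps are close in norm for every fixed [tau].

    A dichotomy survives a small perturbation of one time-[tau] map, [tau] large:
    it amounts to the unique bounded solvability over the integers of
    [u (n + 1) = V (u n) + f (n + 1)], and this is a contraction argument. The
    projection sends [x] to the value at time 0 of the response to an impulse [x]
    at time 0; by uniqueness it commutes with whatever commutes with [V], hence
    with the whole semigroup. *)

Open Scope R_scope.

(** * Real scalars acting on a normed module over R or C *)

(** The domains of [A0] and [A1] are unrelated, so [A1 - A0] cannot be treated as a perturbing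
    operator; only bounded functions of the two generators can be compared. With [mu = n / t] the
    backward Euler steps differ by [eta / mu], and [n] such errors add up to [t * eta], provided
    that the powers of the steps stay bounded independently of [n]. A constant [M > 1] per step
    would be raised to the power [n]; hence resolvents are estimated in an equivalent norm attached
    to the semigroup, and [M] is paid only when norms are changed. Using one large [tau] makes both
    the stable part and the inverse of the unstable part small, so the map for bounded sequences is
    a contraction with ratio [/ 2] at once. Solving it with the weight [2 ^ - |n|] yields responses
    that decay in both directions, which supplies both dichotomy estimates. Since [tau] and the
    tolerance come from the given dichotomy alone, [eta] can be fixed before [A1] and [B1] are
    known. *)

Lemma of_real_plus (k : scalar_field) (r s : R) :
  of_real k (r + s) = plus (of_real k r) (of_real k s).
Proof.
  destruct k; simpl; [reflexivity |].
  unfold RtoC, plus; simpl; unfold Cplus; simpl; f_equal; ring.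
Qed.

Lemma of_real_mult (k : scalar_field) (r s : R) :
  of_real k (r * s) = mult (of_real k r) (of_real k s).
Proof.
  destruct k; simpl; [reflexivity |].
  unfold RtoC, mult; simpl; unfold Cmult; simpl; f_equal; ring.
Qed.

Lemma of_real_1 (k : scalar_field) : of_real k 1 = one.
Proof. destruct k; reflexivity. Qed.

Lemma of_real_opp_1 (k : scalar_field) : of_real k (-1) = opp one.
Proof.
  destruct k; simpl; [reflexivity |].
  unfold RtoC, opp, one; simpl; unfold Copp; simpl; f_equal; ring.
Qed.

Lemma of_real_abs (k : scalar_field) (r : R) : abs (of_real k r) = Rabs r.
Proof. destruct k; simpl; [reflexivity | apply Cmod_R]. Qed.

Lemma scalars_mult_comm (k : scalar_field) (a b : scalars k) :
  mult a b = mult b a.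
Proof. destruct k; [apply Rmult_comm | apply Cmult_comm]. Qed.

Section RealScalars.

Context {k : scalar_field} {Y : NormedModule (scalars k)}.
Implicit Types x y : Y.

Lemma rscal_distr_l (r : R) x y : rscal r (plus x y) = plus (rscal r x) (rscal r y).
Proof. exact (scal_distr_l (of_real k r) x y). Qed.

Lemma rscal_distr_r (r s : R) x : rscal (r + s) x = plus (rscal r x) (rscal s x).
Proof. unfold rscal; rewrite of_real_plus; exact (scal_distr_r _ _ x). Qed.

Lemma rscal_assoc (r s : R) x : rscal r (rscal s x) = rscal (r * s) x.
Proof. unfold rscal; rewrite of_real_mult; exact (scal_assoc _ _ x). Qed.

Lemma rscal_one x : rscal 1 x = x.
Proof. unfold rscal; rewrite of_real_1; exact (scal_one x). Qed.

Lemma rscal_opp_1 x : rscal (-1) x = opp x.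
Proof. unfold rscal; rewrite of_real_opp_1; exact (scal_opp_one x). Qed.

Lemma rscal_zero_r (r : R) : rscal r (zero : Y) = zero.
Proof. exact (scal_zero_r (of_real k r)). Qed.

Lemma rscal_zero_l x : rscal 0 x = zero.
Proof.
  replace 0 with (1 + -1) by ring.
  rewrite rscal_distr_r, rscal_one, rscal_opp_1; exact (plus_opp_r x).
Qed.

Lemma scal_rscal (c : scalars k) (r : R) x : scal c (rscal r x) = rscal r (scal c x).
Proof.
  unfold rscal; rewrite (scal_assoc c (of_real k r) x), (scal_assoc (of_real k r) c x).
  now rewrite scalars_mult_comm.
Qed.

(** The norm axiom for scalar multiplication is only an inequality; applying it to [/ r] as well
    gives the reverse one. *)
Lemma norm_rscal (r : R) x : norm (rscal r x) = Rabs r * norm x.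
Proof.
  assert (H : forall s y, norm (rscal s y) <= Rabs s * norm y).
  { intros s y; rewrite <- (of_real_abs k); exact (norm_scal (of_real k s) y). }
  destruct (Req_dec r 0) as [-> | Hr].
  - rewrite rscal_zero_l, Rabs_R0, Rmult_0_l; exact (norm_zero (V := Y)).
  - apply Rle_antisym; [apply H |].
    pose proof (H (/ r) (rscal r x)) as H1.
    rewrite rscal_assoc, Rinv_l, rscal_one, Rabs_inv in H1 by exact Hr.
    assert (H2 := Rabs_pos_lt r Hr).
    apply (Rmult_le_compat_l (Rabs r)) in H1; [| lra].
    rewrite <- Rmult_assoc, Rinv_r, Rmult_1_l in H1 by lra; exact H1.
Qed.

End RealScalars.

(** Linear identities between vectors are decided by comparing coefficients. *)
Inductive mexp : Type :=
  MVar (n : nat) | MZero | MPlus (a b : mexp) | MOpp (a : mexp) | MScal (r : R) (a : mexp).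

Fixpoint mcoef (e : mexp) (n : nat) : R :=
  match e with
  | MVar m => if Nat.eqb m n then 1 else 0
  | MZero => 0
  | MPlus a b => mcoef a n + mcoef b n
  | MOpp a => - mcoef a n
  | MScal r a => r * mcoef a n
  end.

(** A recursive conjunction instead of a bounded quantifier, so that [cbv] turns it into finitely
    many equations between reals, left to [ring] or [field]. *)
Fixpoint mcoefs_eq (l : nat) (e f : mexp) : Prop :=
  match l with
  | O => True
  | S l => mcoef e l = mcoef f l /\ mcoefs_eq l e f
  end.

Section ModuleReflection.

Context {k : scalar_field} (Y : NormedModule (scalars k)).

Fixpoint mdenote (env : list Y) (e : mexp) : Y :=
  match e with
  | MVar n => nth n env zero
  | MZero => zero
  | MPlus a b => plus (mdenote env a) (mdenote env b)
  | MOpp a => opp (mdenote env a)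
  | MScal r a => rscal r (mdenote env a)
  end.

(** The normal form of a reified expression: the variables weighted by their coefficients. *)
Fixpoint mcombine (l : nat) (env : list Y) (c : nat -> R) : Y :=
  match l with
  | O => zero
  | S l => plus (rscal (c l) (nth l env zero)) (mcombine l env c)
  end.

Lemma mcombine_plus l env c d :
  mcombine l env (fun i => c i + d i) = plus (mcombine l env c) (mcombine l env d).
Proof.
  induction l as [| l IH]; simpl; [symmetry; exact (plus_zero_l zero) |].
  rewrite IH, rscal_distr_r.
  rewrite <- !plus_assoc; f_equal.
  rewrite !plus_assoc; f_equal; apply plus_comm.
Qed.

Lemma mcombine_scal l env r c :
  mcombine l env (fun i => r * c i) = rscal r (mcombine l env c).
Proof.
  induction l as [| l IH]; simpl; [symmetry; apply rscal_zero_r |].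
  now rewrite IH, rscal_distr_l, rscal_assoc.
Qed.

Lemma mcombine_zero l env : mcombine l env (fun _ => 0) = zero.
Proof.
  induction l as [| l IH]; simpl; [reflexivity |].
  rewrite IH, rscal_zero_l; exact (plus_zero_l zero).
Qed.

Lemma mcombine_ext l env c d :
  (forall i, (i < l)%nat -> c i = d i) -> mcombine l env c = mcombine l env d.
Proof.
  induction l as [| l IH]; simpl; intros H; [reflexivity |].
  rewrite IH, (H l) by (intros; try apply H; lia); reflexivity.
Qed.

Lemma mcombine_var l env n :
  mcombine l env (fun i => if Nat.eqb n i then 1 else 0) =
  if Nat.ltb n l then nth n env zero else zero.
Proof.
  induction l as [| l IH]; [reflexivity |]; cbn [mcombine]; rewrite IH.
  destruct (Nat.eqb_spec n l) as [-> | Hn].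
  - rewrite rscal_one, Nat.ltb_irrefl, (proj2 (Nat.ltb_lt l (S l))) by lia.
    exact (plus_zero_r _).
  - rewrite rscal_zero_l.
    destruct (Nat.ltb_spec n l); destruct (Nat.ltb_spec n (S l)); try lia;
      exact (plus_zero_l _).
Qed.

Lemma mdenote_combine env e : mdenote env e = mcombine (length env) env (mcoef e).
Proof.
  induction e as [n | | a Ha b Hb | a Ha | r a Ha]; simpl.
  - rewrite (mcombine_var (length env) env n).
    destruct (Nat.ltb_spec n (length env)) as [H | H]; [reflexivity |].
    now apply nth_overflow.
  - symmetry; apply mcombine_zero.
  - now rewrite mcombine_plus, Ha, Hb.
  - rewrite Ha, <- rscal_opp_1, <- mcombine_scal.
    apply mcombine_ext; intros; ring.
  - now rewrite mcombine_scal, Ha.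
Qed.

Lemma mdenote_eq env e f : mcoefs_eq (length env) e f -> mdenote env e = mdenote env f.
Proof.
  intros H; rewrite !mdenote_combine; apply mcombine_ext.
  revert H; generalize (length env) as l; induction l as [| l IH]; simpl; [lia |].
  intros [H1 H2] i Hi; destruct (Nat.eq_dec i l) as [-> | Hn]; [exact H1 |].
  apply IH; [exact H2 | lia].
Qed.

End ModuleReflection.

(** The matches on [Set] serve to run [constr_eq] while a term is being built and to backtrack when
    it fails. *)
Ltac mlookup x env :=
  lazymatch env with
  | cons ?y ?t =>
    match constr:(Set) with
    | _ => let _ := match constr:(Set) with _ => constr_eq x y end in constr:(O)
    | _ => let n := mlookup x t in constr:(S n)
    end
  end.

Ltac madd x env :=
  match constr:(Set) with
  | _ => let _ := mlookup x env in env
  | _ => constr:(cons x env)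
  end.

Ltac mvars e env :=
  lazymatch e with
  | plus ?a ?b => let env := mvars a env in mvars b env
  | minus ?a ?b => let env := mvars a env in mvars b env
  | opp ?a => mvars a env
  | zero => env
  | rscal ?r ?a => mvars a env
  | _ => madd e env
  end.

Ltac mreify e env :=
  lazymatch e with
  | plus ?a ?b =>
    let a := mreify a env in let b := mreify b env in constr:(MPlus a b)
  | minus ?a ?b =>
    let a := mreify a env in let b := mreify b env in constr:(MPlus a (MOpp b))
  | opp ?a => let a := mreify a env in constr:(MOpp a)
  | zero => constr:(MZero)
  | rscal ?r ?a => let a := mreify a env in constr:(MScal r a)
  | _ => let n := mlookup e env in constr:(MVar n)
  end.

Ltac modcoef Y :=
  lazymatch goal with
  | |- ?a = ?b =>
    let env := mvars a (@nil Y) in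
    let env := mvars b env in
    let e := mreify a env in
    let f := mreify b env in
    change (mdenote Y env e = mdenote Y env f);
    apply mdenote_eq; cbv [mcoefs_eq mcoef length Nat.eqb];
    repeat match goal with |- _ /\ _ => split end; try exact I
  end.

Ltac modeq Y := modcoef Y; ring.
Ltac modfield Y := modcoef Y; field; first [assumption | lra].

(** Rewrites the vector whose norm is bounded in the goal into a given form. *)
Ltac vset b :=
  lazymatch goal with
  | |- ?R (@norm ?K ?V ?a) _ => replace a with b by first [modeq V | modfield V]
  end.

(** * Norm estimates, continuity and geometric limits *)

Section NormCalculus.

Context {k : scalar_field} {Y : CompleteNormedModule (scalars k)}.
Implicit Types x y z : Y.

Lemma vnorm_ge0 x : 0 <= norm x.
Proof. exact (norm_ge_0 x). Qed.

Lemma vnorm0 : norm (zero : Y) = 0.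
Proof. exact (norm_zero (V := Y)). Qed.

Lemma vnorm_plus x y : norm (plus x y) <= norm x + norm y.
Proof. exact (norm_triangle x y). Qed.

Lemma vnorm_opp x : norm (opp x) = norm x.
Proof. exact (norm_opp x). Qed.

Lemma vnorm_minus x y : norm (minus x y) <= norm x + norm y.
Proof. rewrite <- (vnorm_opp y); apply vnorm_plus. Qed.

Lemma vnorm_sym x y : norm (minus x y) = norm (minus y x).
Proof. apply norm_minus_sym. Qed.

Lemma vnorm_self x : norm (minus x x) = 0.
Proof. replace (minus x x) with (zero : Y) by modeq Y; apply vnorm0. Qed.

Lemma vnorm_decomp x y z : x = plus y z -> norm x <= norm y + norm z.
Proof. intros ->; apply vnorm_plus. Qed.

Lemma vnorm_eq0 x : norm x <= 0 -> x = zero.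
Proof. intros H; apply (norm_eq_zero x), Rle_antisym; [exact H | apply vnorm_ge0]. Qed.

Lemma minus_eq0 x y : minus x y = zero -> x = y.
Proof.
  intros H; replace x with (plus (minus x y) y) by modeq Y.
  rewrite H; modeq Y.
Qed.

Lemma vnorm_minus_eq0 x y : norm (minus x y) <= 0 -> x = y.
Proof. intros H; now apply minus_eq0, vnorm_eq0. Qed.

Lemma vnorm_rscal (r : R) x : norm (rscal r x) = Rabs r * norm x.
Proof. apply norm_rscal. Qed.

Lemma vnorm_rscal_pos (r : R) x : 0 <= r -> norm (rscal r x) = r * norm x.
Proof. intros H; rewrite vnorm_rscal, Rabs_pos_eq; auto. Qed.

Lemma filterlim_eps {T : Type} (F : (T -> Prop) -> Prop) {FF : Filter F} (f : T -> Y) l :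
  filterlim f F (locally l) <-> forall e, 0 < e -> F (fun t => norm (minus (f t) l) < e).
Proof.
  split.
  - intros H e He.
    exact (proj1 (filterlim_locally_ball_norm (U := Y) (F := F) f l) H (mkposreal e He)).
  - intros H; apply (proj2 (filterlim_locally_ball_norm (U := Y) (F := F) f l)).
    intros e; apply (H e (cond_pos e)).
Qed.

Lemma continuous_eps (f : R -> Y) t :
  continuous f t <->
  forall e, 0 < e -> exists d, 0 < d /\
    forall s, Rabs (s - t) < d -> norm (minus (f s) (f t)) < e.
Proof.
  split.
  - intros H e He; destruct (proj1 (filterlim_eps _ f (f t)) H e He) as [d Hd].
    exists d; split; [apply cond_pos |]; intros s Hs; apply Hd, Hs.
  - intros H; apply filterlim_eps; [apply locally_filter |]; intros e He.
    destruct (H e He) as [d [Hd1 Hd2]]; exists (mkposreal d Hd1); intros s Hs; apply Hd2, Hs.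
Qed.

Lemma uniformly_continuous_eps (f : R -> Y) (a b e : R) :
  (forall t, continuous f t) -> 0 < e -> exists d, 0 < d /\
    forall s t, a <= s <= b -> a <= t <= b -> Rabs (t - s) < d ->
      norm (minus (f t) (f s)) < e.
Proof.
  intros Hf He.
  destruct (unifcont_normed_1d (V := Y) f a b (fun t _ => Hf t) (mkposreal e He)) as [d Hd].
  exists d; split; [apply cond_pos |]; intros s t Hs Ht Hst.
  exact (Hd s t Hs Ht Hst).
Qed.

Lemma bounded_on_interval (f : R -> Y) (a b : R) :
  (forall t, continuous f t) -> exists K, 0 <= K /\ forall t, a <= t <= b -> norm (f t) <= K.
Proof.
  intros Hf; destruct (bounded_continuity (V := Y) f a b) as [K HK]; [intros; apply Hf |].
  exists (Rmax 0 K); split; [apply Rmax_l |]; intros t Ht.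
  apply Rle_trans with (2 := Rmax_r _ _), Rlt_le, HK, Ht.
Qed.

Lemma geometric_cauchy_limit (u : nat -> Y) (C q : R) :
  0 < q < 1 -> (forall n, norm (minus (u (S n)) (u n)) <= C * q ^ n) ->
  exists l, forall n, norm (minus (u n) l) <= C / (1 - q) * q ^ n.
Proof.
  intros Hq Hu.
  assert (Hp : forall n, 0 < q ^ n) by (intros; apply pow_lt; lra).
  assert (HC : 0 <= C).
  { generalize (Hu O) (vnorm_ge0 (minus (u 1%nat) (u O))); simpl; lra. }
  pose (D := C / (1 - q)).
  assert (HD : D * (1 - q) = C) by (unfold D; field; lra).
  assert (HD0 : 0 <= D) by (unfold D; apply Rdiv_le_0_compat; lra).
  assert (Hm : forall n m, norm (minus (u n) (u (n + m)%nat)) <= D * q ^ n).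
  { intros n m.
    (* The subtracted term makes the induction on [m] close; it is dropped afterwards. *)
    assert (H : norm (minus (u n) (u (n + m)%nat)) <= D * (q ^ n - q ^ (n + m))).
    { induction m as [| m IH].
      - rewrite Nat.add_0_r, vnorm_self; lra.
      - rewrite Nat.add_succ_r.
        apply Rle_trans with (1 := norm_minus_triangle (u (n + m)%nat) (u n) (u (S (n + m)))).
        rewrite (vnorm_sym (u (n + m)%nat)); generalize (Hu (n + m)%nat).
        rewrite <- HD; simpl; lra. }
    generalize (Hp (n + m)%nat); nra. }
  assert (Hsmall : forall e, 0 < e -> exists n, D * q ^ n < e).
  { intros e He.
    assert (He' : e / (D + 1) > 0) by (apply Rdiv_lt_0_compat; lra).
    destruct (pow_lt_1_zero q ltac:(rewrite Rabs_pos_eq; lra) _ He') as [n Hn].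
    exists n; specialize (Hn n (le_n n)); rewrite Rabs_pos_eq in Hn by (left; apply Hp).
    apply (proj2 (Rlt_div_r _ _ (D + 1) ltac:(lra))) in Hn.
    generalize (Hp n); nra. }
  pose (F := fun P : Y -> Prop => eventually (fun n => P (u n))).
  assert (PF : ProperFilter F).
  { exact (filtermap_proper_filter _ _ u eventually eventually_filter). }
  assert (CF : cauchy F).
  { intros e; destruct (Hsmall e (cond_pos e)) as [n Hn].
    exists (u n), n; intros m Hnm.
    apply (norm_compat1 (V := Y)); apply Rle_lt_trans with (2 := Hn).
    replace m with (n + (m - n))%nat by lia; rewrite vnorm_sym; apply Hm. }
  exists (lim F); intros n; apply le_epsilon; intros e He.
  assert (Hf : 0 < @norm_factor _ Y) by apply norm_factor_gt_0.
  destruct (complete_cauchy F PF CF (mkposreal _ (Rdiv_lt_0_compat _ _ He Hf))) as [m Hm'].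
  specialize (Hm' (n + m)%nat ltac:(lia)).
  apply (norm_compat2 (V := Y)) in Hm'; cbn [pos] in Hm'.
  replace (@norm_factor _ Y * (e / @norm_factor _ Y)) with e in Hm' by (field; lra).
  apply Rle_trans with (1 := norm_minus_triangle (u (n + m)%nat) _ _).
  generalize (Hm n m); intros H1; fold D.
  change (norm (minus (u (n + m)%nat) (lim F)) < e) in Hm'; lra.
Qed.

End NormCalculus.

Lemma at_right_eps (P : R -> Prop) :
  at_right 0 P <-> exists d, 0 < d /\ forall h, 0 < h < d -> P h.
Proof.
  split.
  - intros [d Hd]; exists d; split; [apply cond_pos |]; intros h Hh.
    apply Hd; [| apply Hh].
    change (Rabs (h - 0) < d); rewrite Rminus_0_r, Rabs_pos_eq; lra.
  - intros [d [Hd H]]; exists (mkposreal d Hd); intros h Hh Hh0; apply H.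
    change (Rabs (h - 0) < d) in Hh; rewrite Rminus_0_r, Rabs_pos_eq in Hh; lra.
Qed.

(** Real linearity is what the estimates and the integral use. Full linearity over [scalars k]
    returns where a definition demands it: for resolvents, solution semigroups and dichotomy
    projections. *)
Record rlinear {k : scalar_field} {Y Z : CompleteNormedModule (scalars k)} (L : Y -> Z) : Prop := {
  rlin_plus : forall x y, L (plus x y) = plus (L x) (L y);
  rlin_rscal : forall r x, L (rscal r x) = rscal r (L x);
  rlin_norm : exists C, 0 <= C /\ forall x, norm (L x) <= C * norm x
}.

Section RealLinear.

Context {k : scalar_field} {Y Z : CompleteNormedModule (scalars k)}.

Lemma is_linear_rlinear (L : Y -> Z) : is_linear L -> rlinear L.
Proof.
  intros [H1 H2 [C [HC H3]]]; split; [exact H1 | intros; apply H2 |].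
  exists C; split; [lra | exact H3].
Qed.

Variable L : Y -> Z.
Hypothesis HL : rlinear L.

Lemma rlin_zero : L zero = zero.
Proof.
  transitivity (L (rscal 0 zero)); [f_equal; modeq Y |].
  rewrite (rlin_rscal L HL); modeq Z.
Qed.

Lemma rlin_opp x : L (opp x) = opp (L x).
Proof.
  transitivity (L (rscal (-1) x)); [f_equal; modeq Y |].
  rewrite (rlin_rscal L HL); modeq Z.
Qed.

Lemma rlin_minus x y : L (minus x y) = minus (L x) (L y).
Proof. unfold minus; now rewrite (rlin_plus L HL), rlin_opp. Qed.

Lemma rlin_continuous (u : R -> Y) t : continuous u t -> continuous (fun s => L (u s)) t.
Proof.
  intros Hu; apply continuous_eps; intros e He.
  destruct (rlin_norm L HL) as [C [HC HLC]].
  assert (H : 0 < e / (C + 1)) by (apply Rdiv_lt_0_compat; lra).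
  destruct (proj1 (continuous_eps u t) Hu _ H) as [d [Hd1 Hd2]].
  exists d; split; [exact Hd1 |]; intros s Hs; rewrite <- rlin_minus.
  specialize (Hd2 s Hs); apply (proj2 (Rlt_div_r _ _ (C + 1) ltac:(lra))) in Hd2.
  generalize (HLC (minus (u s) (u t))) (vnorm_ge0 (minus (u s) (u t))); nra.
Qed.

End RealLinear.

(** * Integration *)

(** Coquelicot integrates functions with values in Banach spaces over R, so the
    scalars are restricted first. *)
Section Realify.

Context {k : scalar_field} (Y : CompleteNormedModule (scalars k)).

Definition real_ModuleSpace_mixin : ModuleSpace.mixin_of R_Ring Y.
Proof.
  apply (ModuleSpace.Mixin R_Ring Y (fun (r : R) (x : Y) => rscal r x)).
  - intros r s x; exact (rscal_assoc (Y := Y) r s x).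
  - intros x; exact (rscal_one (Y := Y) x).
  - intros r x y; exact (rscal_distr_l (Y := Y) r x y).
  - intros r s x; exact (rscal_distr_r (Y := Y) r s x).
Defined.

Definition real_NormedModuleAux : NormedModuleAux R_AbsRing :=
  NormedModuleAux.Pack R_AbsRing Y
    (NormedModuleAux.Class R_AbsRing Y
       (ModuleSpace.Class R_Ring Y (AbelianGroup.class Y) real_ModuleSpace_mixin)
       (UniformSpace.class Y)) Y.

Definition real_NormedModule_mixin : NormedModule.mixin_of R_AbsRing real_NormedModuleAux.
Proof.
  apply (NormedModule.Mixin R_AbsRing real_NormedModuleAux
           (fun x : Y => norm x) (@norm_factor _ Y)).
  - exact (@norm_triangle _ Y).
  - intros r x; change (norm (rscal r (x : Y)) <= Rabs r * norm (x : Y)).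
    rewrite vnorm_rscal; apply Rle_refl.
  - exact (@norm_compat1 _ Y).
  - exact (@norm_compat2 _ Y).
  - exact (@norm_eq_zero _ Y).
Defined.

Definition realify : CompleteNormedModule R_AbsRing :=
  CompleteNormedModule.Pack R_AbsRing Y
    (CompleteNormedModule.Class R_AbsRing Y
       (NormedModule.Class R_AbsRing Y
          (NormedModuleAux.class R_AbsRing real_NormedModuleAux) real_NormedModule_mixin)
       (CompleteNormedModule.mixin _ _ (CompleteNormedModule.class _ Y))) Y.

End Realify.

Section Integral.

Context {k : scalar_field} {Y : CompleteNormedModule (scalars k)}.

Definition integral (f : R -> Y) (a b : R) : Y := RInt (V := realify Y) f a b.

Lemma is_integral (f : R -> Y) a b :
  (forall t, continuous f t) -> is_RInt (V := realify Y) f a b (integral f a b).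
Proof.
  intros Hf; apply (RInt_correct (V := realify Y)).
  apply (ex_RInt_continuous (V := realify Y)); intros z _; exact (Hf z).
Qed.

Lemma integral_minus (f g : R -> Y) a b :
  (forall t, continuous f t) -> (forall t, continuous g t) ->
  integral (fun t => minus (f t) (g t)) a b = minus (integral f a b) (integral g a b).
Proof.
  intros Hf Hg.
  exact (RInt_minus (V := realify Y) f g a b
    (ex_intro _ _ (is_integral f a b Hf)) (ex_intro _ _ (is_integral g a b Hg))).
Qed.

Lemma integral_plus (f g : R -> Y) a b :
  (forall t, continuous f t) -> (forall t, continuous g t) ->
  integral (fun t => plus (f t) (g t)) a b = plus (integral f a b) (integral g a b).
Proof.
  intros Hf Hg.
  exact (RInt_plus (V := realify Y) f g a b
    (ex_intro _ _ (is_integral f a b Hf)) (ex_intro _ _ (is_integral g a b Hg))).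
Qed.

Lemma integral_Chasles (f : R -> Y) a b c :
  (forall t, continuous f t) ->
  plus (integral f a b) (integral f b c) = integral f a c.
Proof.
  intros Hf.
  exact (RInt_Chasles (V := realify Y) f a b c
    (ex_intro _ _ (is_integral f a b Hf)) (ex_intro _ _ (is_integral f b c Hf))).
Qed.

Lemma integral_point (f : R -> Y) a : integral f a a = zero.
Proof. exact (RInt_point (V := realify Y) a f). Qed.

Lemma integral_const (c : Y) a b : integral (fun _ => c) a b = rscal (b - a) c.
Proof. exact (RInt_const (V := realify Y) a b c). Qed.

Lemma integral_ext (f g : R -> Y) a b :
  a <= b -> (forall t, a <= t <= b -> f t = g t) -> integral f a b = integral g a b.
Proof.
  intros Hab H; apply (RInt_ext (V := realify Y)).
  rewrite Rmin_left, Rmax_right by exact Hab; intros t Ht; apply H; lra.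
Qed.

Lemma integral_shift (f : R -> Y) a b c :
  (forall t, continuous f t) ->
  integral (fun t => f (t + c)) a b = integral f (a + c) (b + c).
Proof.
  intros Hf; apply (is_RInt_unique (V := realify Y)).
  pose proof (is_RInt_comp_lin (V := realify Y) f 1 c a b (integral f (a + c) (b + c))) as H.
  rewrite !Rmult_1_l in H; specialize (H (is_integral f _ _ Hf)).
  revert H; apply (is_RInt_ext (V := realify Y)); intros t _.
  rewrite Rmult_1_l; exact (scal_one (f (t + c) : realify Y)).
Qed.

Lemma integral_norm (f : R -> Y) (g : R -> R) a b G :
  (forall t, continuous f t) -> a <= b ->
  (forall t, a <= t <= b -> norm (f t) <= g t) -> is_RInt g a b G ->
  norm (integral f a b) <= G.
Proof.
  intros Hf Hab H HG.
  exact (norm_RInt_le (V := realify Y) f g a b _ G Hab H (is_integral f a b Hf) HG).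
Qed.

Lemma integral_norm_const (f : R -> Y) a b C :
  (forall t, continuous f t) -> a <= b ->
  (forall t, a <= t <= b -> norm (f t) <= C) -> norm (integral f a b) <= (b - a) * C.
Proof.
  intros Hf Hab H.
  exact (norm_RInt_le_const (V := realify Y) f a b _ C Hab H (is_integral f a b Hf)).
Qed.

Lemma integral_norm_near (f : R -> Y) a b c e :
  (forall t, continuous f t) -> a <= b ->
  (forall t, a <= t <= b -> norm (minus (f t) c) <= e) ->
  norm (minus (integral f a b) (rscal (b - a) c)) <= (b - a) * e.
Proof.
  intros Hf Hab H.
  assert (Hc : forall t, continuous (fun _ : R => c) t) by (intros; apply continuous_const).
  rewrite <- (integral_const c a b), <- integral_minus by assumption.
  apply integral_norm_const; try assumption.
  intros t; apply (continuous_minus (K := scalars k) (V := Y) f (fun _ => c) t); auto.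
Qed.

End Integral.

(** [L] commutes with Riemann sums by additivity and real homogeneity, and boundedness carries this
    to the limit. *)
Lemma integral_rlinear {k : scalar_field} {Y Z : CompleteNormedModule (scalars k)}
  (L : Y -> Z) (f : R -> Y) a b :
  rlinear L -> (forall t, continuous f t) ->
  integral (fun t => L (f t)) a b = L (integral f a b).
Proof.
  intros HL Hf; apply (is_RInt_unique (V := realify Z)).
  pose proof (is_integral f a b Hf) as H; unfold is_RInt in *.
  assert (HLS : forall ptd, Riemann_sum (V := realify Z) (fun t => L (f t)) ptd =
                            L (Riemann_sum (V := realify Y) f ptd)).
  { intros ptd; apply (SF_cons_ind (fun ptd =>
      Riemann_sum (V := realify Z) (fun t => L (f t)) ptd =
      L (Riemann_sum (V := realify Y) f ptd))).
    - intros x; symmetry; exact (rlin_zero L HL).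
    - intros h s IH.
      rewrite (Riemann_sum_cons (V := realify Z)), (Riemann_sum_cons (V := realify Y)), IH.
      symmetry; refine (eq_trans (rlin_plus L HL _ _) _).
      exact (f_equal (fun z : Z => plus z _) (rlin_rscal L HL _ _)). }
  apply (filterlim_ext (fun ptd => L (scal (V := realify Y) (sign (b - a))
           (Riemann_sum (V := realify Y) f ptd)))).
  { intros ptd; rewrite HLS; apply (rlin_rscal L HL). }
  apply (filterlim_comp _ _ _ _ L _ _ _ H).
  apply filterlim_eps; [apply locally_filter |]; intros e He.
  destruct (rlin_norm L HL) as [C [HC HLC]].
  assert (H0 : 0 < e / (C + 1)) by (apply Rdiv_lt_0_compat; lra).
  assert (HY : filterlim (fun y : Y => y) (locally (integral f a b)) (locally (integral f a b))) by apply filterlim_id.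
  generalize (proj1 (filterlim_eps _ (fun y : Y => y) _) HY _ H0).
  apply filter_imp; intros y Hy; rewrite <- (rlin_minus L HL).
  apply (proj2 (Rlt_div_r _ _ (C + 1) ltac:(lra))) in Hy.
  generalize (HLC (minus y (integral f a b))) (vnorm_ge0 (minus y (integral f a b))); nra.
Qed.

Lemma is_RInt_exp_scaled (c a b : R) :
  c <> 0 -> is_RInt (fun t => exp (c * t)) a b ((exp (c * b) - exp (c * a)) / c).
Proof.
  intros Hc.
  replace ((exp (c * b) - exp (c * a)) / c)
    with (minus (exp (c * b) / c) (exp (c * a) / c))
    by (unfold minus, plus, opp; simpl; field; exact Hc).
  apply (is_RInt_derive (fun t => exp (c * t) / c)).
  - intros t _; auto_derive; [exact I | field; exact Hc].
  - intros t _; apply (ex_derive_continuous (fun t => exp (c * t))); auto_derive; exact I.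
Qed.

(** * Contractions in weighted sup norms *)

Section Contraction.

Context {k : scalar_field} {Y : CompleteNormedModule (scalars k)} {S : Type}.
Variable E : S -> R.

(** [C] bounds the distance of [u] and [v] in the sup norm weighted by [/ E]. This distance may be
    infinite, so comparing two fixed points always starts from some finite bound. *)
Definition wclose (C : R) (u v : S -> Y) : Prop :=
  forall s, norm (minus (u s) (v s)) <= C * E s.

(** For the delay equation [Q] is continuity, without which histories have no meaning; in the other
    applications it is trivial. *)
Definition half_lipschitz (Q : (S -> Y) -> Prop) (Phi : (S -> Y) -> S -> Y) : Prop :=
  forall u v C, Q u -> Q v -> wclose C u v -> wclose (C / 2) (Phi u) (Phi v).

Hypothesis E_pos : forall s, 0 < E s.
Variable Q : (S -> Y) -> Prop.

(** A bound [D] on the distance of [u = Phi u] and [v = Psi v] improves to [D / 2 + d]; iterating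
    from any finite [C] leaves [2 * d]. With [d = 0] this is uniqueness; with [d > 0] it later
    measures how delay solutions depend on the coefficients. *)
Lemma close_fixpoints (Phi Psi : (S -> Y) -> S -> Y) u v C d :
  half_lipschitz Q Phi -> Q u -> Q v ->
  (forall s, u s = Phi u s) -> (forall s, v s = Psi v s) ->
  wclose C u v -> 0 <= d -> wclose d (Phi v) (Psi v) -> wclose (2 * d) u v.
Proof.
  intros HPhi Qu Qv Hu Hv HC Hd Hclose.
  assert (H : forall n, wclose (2 * d + Rabs C * (/ 2) ^ n) u v).
  { induction n as [| n IH]; intros s.
    - apply Rle_trans with (1 := HC s), Rmult_le_compat_r; [left; apply E_pos |].
      simpl; generalize (Rle_abs C); lra.
    - apply HPhi in IH; [| exact Qu | exact Qv].
      rewrite (Hu s), (Hv s).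
      apply Rle_trans with (1 := norm_minus_triangle (Phi v s) _ _).
      apply Rle_trans with (1 := Rplus_le_compat _ _ _ _ (IH s) (Hclose s)).
      simpl; generalize (E_pos s); intros; right; field. }
  intros s; apply le_epsilon; intros e He.
  assert (He' : e / (Rabs C * E s + 1) > 0).
  { apply Rdiv_lt_0_compat; [lra |].
    generalize (Rmult_le_pos _ _ (Rabs_pos C) (Rlt_le _ _ (E_pos s))); lra. }
  destruct (pow_lt_1_zero (/ 2) ltac:(rewrite Rabs_pos_eq; lra) _ He') as [n Hn].
  specialize (Hn n (le_n n)).
  assert (Hp : 0 < (/ 2) ^ n) by (apply pow_lt; lra).
  rewrite Rabs_pos_eq in Hn by lra.
  pose proof (Rmult_le_pos _ _ (Rabs_pos C) (Rlt_le _ _ (E_pos s))) as HCE.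
  apply (proj2 (Rlt_div_r _ _ (Rabs C * E s + 1) ltac:(lra))) in Hn.
  generalize (H n s); nra.
Qed.

Lemma unique_fixpoint (Phi : (S -> Y) -> S -> Y) u v C :
  half_lipschitz Q Phi -> Q u -> Q v ->
  (forall s, u s = Phi u s) -> (forall s, v s = Phi v s) ->
  wclose C u v -> forall s, u s = v s.
Proof.
  intros HPhi Qu Qv Hu Hv HC s; apply vnorm_minus_eq0.
  replace 0 with (2 * 0 * E s) by ring.
  apply (close_fixpoints Phi Phi u v C 0); auto; [lra |].
  intros t; rewrite vnorm_self; lra.
Qed.

(** Picard iteration from [zero]. The limit is taken pointwise in [s], and the geometric rate makes
    it a limit in the weighted norm; [Q] has to be closed under such limits. The final bound is what
    turns the choice of the weight into growth or decay of the solution. *)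
Lemma exists_fixpoint (Phi : (S -> Y) -> S -> Y) C :
  half_lipschitz Q Phi -> Q (fun _ => zero) -> (forall u, Q u -> Q (Phi u)) ->
  (forall u v D, (forall n, Q (u n)) -> (forall n, wclose (D * (/ 2) ^ n) (u n) v) -> Q v) ->
  (forall s, norm (Phi (fun _ => zero) s) <= C * E s) ->
  exists u, Q u /\ (forall s, u s = Phi u s) /\ forall s, norm (u s) <= 2 * C * E s.
Proof.
  intros HPhi Q0 QPhi Qlim HC.
  pose (u := fix u n := match n with O => fun _ : S => (zero : Y) | Datatypes.S n => Phi (u n) end).
  assert (Qu : forall n, Q (u n)) by (induction n; simpl; auto).
  assert (Hu : forall n, wclose (C * (/ 2) ^ n) (u (Datatypes.S n)) (u n)).
  { induction n as [| n IH].
    - intros s; rewrite pow_O, Rmult_1_r; apply Rle_trans with (2 := HC s).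
      right; f_equal; simpl; modeq Y.
    - apply HPhi in IH; try apply Qu; intros s; specialize (IH s).
      replace (C * (/ 2) ^ Datatypes.S n) with (C * (/ 2) ^ n / 2) by (simpl; field).
      exact IH. }
  assert (Hl : forall s, exists l, forall n, norm (minus (u n s) l) <= 2 * (C * E s) * (/ 2) ^ n).
  { intros s; destruct (geometric_cauchy_limit (fun n => u n s) (C * E s) (/ 2)) as [l Hl'].
    - lra.
    - intros n; apply Rle_trans with (1 := Hu n s); right; ring.
    - exists l; intros n; apply Rle_trans with (1 := Hl' n); right; field. }
  pose (v := fun s => epsilon (inhabits (zero : Y))
    (fun l => forall n, norm (minus (u n s) l) <= 2 * (C * E s) * (/ 2) ^ n)).
  assert (Hv : forall n, wclose (2 * C * (/ 2) ^ n) (u n) v).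
  { intros n s.
    apply Rle_trans with (1 := epsilon_spec (inhabits (zero : Y)) _ (Hl s) n); right; ring. }
  assert (Qv : Q v) by (apply (Qlim u v (2 * C)); assumption).
  exists v; split; [exact Qv | split].
  - intros s; apply vnorm_minus_eq0, le_epsilon; intros e He.
    assert (HCE : 0 <= C * E s) by (apply Rle_trans with (2 := HC s), vnorm_ge0).
    assert (He' : e / (2 * (C * E s) + 1) > 0) by (apply Rdiv_lt_0_compat; lra).
    destruct (pow_lt_1_zero (/ 2) ltac:(rewrite Rabs_pos_eq; lra) _ He') as [n Hn].
    specialize (Hn n (le_n n)).
    assert (Hp : 0 < (/ 2) ^ n) by (apply pow_lt; lra).
    rewrite Rabs_pos_eq in Hn by lra.
    apply (proj2 (Rlt_div_r _ _ (2 * (C * E s) + 1) ltac:(lra))) in Hn.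
    apply Rle_trans with (1 := norm_minus_triangle (u (Datatypes.S n) s) _ _).
    rewrite vnorm_sym.
    pose proof (Hv (Datatypes.S n) s) as H1.
    pose proof (HPhi _ _ _ (Qu n) Qv (Hv n) s) as H2.
    simpl in H1 |- *; nra.
  - intros s; pose proof (Hv O s) as H; rewrite vnorm_sym, pow_O, Rmult_1_r in H.
    apply Rle_trans with (2 := H); right; f_equal; simpl; modeq Y.
Qed.

End Contraction.

(** The set of [t] up to which the estimate with slack [e] holds is closed by
    continuity and can be continued to the right by the bound on the right derivative. *)
Lemma right_mean_value {k : scalar_field} {Y : CompleteNormedModule (scalars k)}
  (f : R -> Y) (a b C : R) :
  a <= b -> (forall t, continuous f t) ->
  (forall t e, a <= t < b -> 0 < e -> exists d, 0 < d /\
     forall h, 0 < h < d -> norm (minus (f (t + h)) (f t)) <= (C + e) * h) ->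
  norm (minus (f b) (f a)) <= C * (b - a).
Proof.
  intros Hab Hf Hd.
  assert (H : forall e, 0 < e -> norm (minus (f b) (f a)) <= (C + e) * (b - a)).
  { intros e He.
    pose (G := fun t => a <= t <= b /\
      forall s, a <= s <= t -> norm (minus (f s) (f a)) <= (C + e) * (s - a)).
    assert (Ga : G a).
    { split; [lra |]; intros s Hs; replace s with a by lra; rewrite vnorm_self; lra. }
    destruct (completeness G) as [c [Hc1 Hc2]].
    { exists b; intros t [Ht _]; lra. }
    { now exists a. }
    assert (Hac : a <= c) by now apply Hc1.
    assert (Hcb : c <= b) by (apply Hc2; intros t [Ht _]; lra).
    assert (Hlt : forall s, a <= s < c -> norm (minus (f s) (f a)) <= (C + e) * (s - a)).
    { intros s Hs.
      destruct (classic (exists t, G t /\ s < t)) as [[t [[Ht1 Ht2] Hst]] | Hn].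
      - apply Ht2; lra.
      - exfalso; apply (Rlt_irrefl s), Rlt_le_trans with c; [lra |].
        apply Hc2; intros t Gt; destruct (Rle_lt_dec t s); [lra |].
        exfalso; apply Hn; now exists t. }
    assert (Hfc : norm (minus (f c) (f a)) <= (C + e) * (c - a)).
    { destruct (Rle_lt_dec c a) as [Hca | Hca].
      { replace c with a by lra; rewrite vnorm_self; lra. }
      apply le_epsilon; intros e' He'.
      assert (Hpos : 0 < e' / (2 * (Rabs (C + e) + 1))).
      { apply Rdiv_lt_0_compat; [lra |]; generalize (Rabs_pos (C + e)); lra. }
      destruct (proj1 (continuous_eps f c) (Hf c) (e' / 2)) as [d [Hd1 Hd2]]; [lra |].
      (* The variation of [f] between [s] and [c] and the term [(C + e) * (c - s)], whose sign is
         unknown, may cost [e' / 2] each. *)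
      pose (s := Rmax a (Rmax (c - d / 2) (c - e' / (2 * (Rabs (C + e) + 1))))).
      assert (Hs : a <= s < c /\ c - d / 2 <= s /\ c - e' / (2 * (Rabs (C + e) + 1)) <= s).
      { unfold s; repeat split.
        - apply Rmax_l.
        - repeat apply Rmax_lub_lt; lra.
        - apply Rle_trans with (2 := Rmax_r _ _), Rmax_l.
        - apply Rle_trans with (2 := Rmax_r _ _), Rmax_r. }
      destruct Hs as [Hs1 [Hs2 Hs3]].
      apply Rle_trans with (1 := norm_minus_triangle (f s) _ _).
      assert (H1 : norm (minus (f c) (f s)) < e' / 2).
      { rewrite vnorm_sym; apply Hd2; rewrite Rabs_left1; lra. }
      pose proof (Hlt s Hs1) as H2.
      assert (H3 : (c - s) * (Rabs (C + e) + 1) <= e' / 2).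
      { replace (e' / 2) with
          (e' / (2 * (Rabs (C + e) + 1)) * (Rabs (C + e) + 1))
          by (field; generalize (Rabs_pos (C + e)); lra).
        apply Rmult_le_compat_r; [generalize (Rabs_pos (C + e)) |]; lra. }
      generalize (Rle_abs (- (C + e))) (Rabs_Ropp (C + e)); intros; nra. }
    assert (Gc : G c).
    { split; [lra |]; intros s Hs; destruct (Req_dec s c) as [-> | Hsc]; [exact Hfc |].
      apply Hlt; lra. }
    destruct (Rle_lt_dec b c) as [Hbc | Hbc].
    { replace b with c by lra; exact Hfc. }
    exfalso; destruct (Hd c e) as [d [Hd1 Hd2]]; [lra | exact He |].
    pose (h := Rmin (d / 2) (b - c)).
    assert (Hh : 0 < h < d /\ h <= b - c).
    { unfold h; repeat split.
      - apply Rmin_glb_lt; lra.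
      - apply Rle_lt_trans with (1 := Rmin_l _ _); lra.
      - apply Rmin_r. }
    assert (Gh : G (c + h)).
    { split; [lra |]; intros s Hs.
      destruct (Rle_lt_dec s c) as [Hsc | Hsc]; [apply Gc; lra |].
      apply Rle_trans with (1 := norm_minus_triangle (f c) _ _).
      pose proof (Hd2 (s - c) ltac:(lra)) as H1.
      replace (c + (s - c)) with s in H1 by ring; lra. }
    generalize (Hc1 _ Gh); lra. }
  apply le_epsilon; intros e He.
  assert (He' : 0 < e / (b - a + 1)) by (apply Rdiv_lt_0_compat; lra).
  apply Rle_trans with (1 := H _ He'); rewrite Rmult_plus_distr_r.
  apply Rplus_le_compat_l.
  apply Rle_trans with (e / (b - a + 1) * (b - a + 1)); [| right; field; lra].
  apply Rmult_le_compat_l; lra.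
Qed.

(** * Strongly continuous semigroups *)

Section Limits.

Context {k : scalar_field} {Y Z : CompleteNormedModule (scalars k)}.
Context {T : Type} (F : (T -> Prop) -> Prop) {FF : Filter F}.

Lemma vlim_plus (f g : T -> Y) l m :
  filterlim f F (locally l) -> filterlim g F (locally m) ->
  filterlim (fun t => plus (f t) (g t)) F (locally (plus l m)).
Proof.
  intros Hf Hg; exact (filterlim_comp_2 f g plus Hf Hg (filterlim_plus (V := Y) l m)).
Qed.

Lemma vlim_rscal (c : T -> R) (f : T -> Y) (c0 : R) l :
  filterlim c F (locally c0) -> filterlim f F (locally l) ->
  filterlim (fun t => rscal (c t) (f t)) F (locally (rscal c0 l)).
Proof.
  intros Hc Hf.
  exact (filterlim_comp_2 c f (fun r y => scal (V := realify Y) r y) Hc Hf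
           (filterlim_scal (V := realify Y) c0 l)).
Qed.

Lemma vlim_rlinear (L : Y -> Z) (f : T -> Y) l :
  rlinear L -> filterlim f F (locally l) ->
  filterlim (fun t => L (f t)) F (locally (L l)).
Proof.
  intros HL Hf; apply filterlim_eps; [exact FF |]; intros e He.
  destruct (rlin_norm L HL) as [C [HC HLC]].
  assert (H0 : 0 < e / (C + 1)) by (apply Rdiv_lt_0_compat; lra).
  generalize (proj1 (filterlim_eps F f l) Hf _ H0); apply filter_imp; intros t Ht.
  rewrite <- (rlin_minus L HL).
  apply (proj2 (Rlt_div_r _ _ (C + 1) ltac:(lra))) in Ht.
  generalize (HLC (minus (f t) l)) (vnorm_ge0 (minus (f t) l)); nra.
Qed.

Lemma vlim_opp (f : T -> Y) l :
  filterlim f F (locally l) -> filterlim (fun t => opp (f t)) F (locally (opp l)).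
Proof. intros Hf; exact (filterlim_comp _ _ _ f opp F _ _ Hf (filterlim_opp (V := Y) l)). Qed.

Lemma vlim_minus (f g : T -> Y) l m :
  filterlim f F (locally l) -> filterlim g F (locally m) ->
  filterlim (fun t => minus (f t) (g t)) F (locally (minus l m)).
Proof. intros Hf Hg; apply vlim_plus; [exact Hf | now apply vlim_opp]. Qed.

End Limits.

Lemma rlim_eps (f : R -> R) (l : R) :
  filterlim f (at_right 0) (locally l) <->
  forall e, 0 < e -> exists d, 0 < d /\ forall h, 0 < h < d -> Rabs (f h - l) < e.
Proof.
  split.
  - intros H e He; apply at_right_eps.
    exact (proj1 (filterlim_locally f l) H (mkposreal e He)).
  - intros H; apply filterlim_locally; intros e; apply at_right_eps, (H e (cond_pos e)).
Qed.

Lemma exp_quotient_limit (c : R) :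
  filterlim (fun h => (exp (c * h) - 1) / h) (at_right 0) (locally c).
Proof.
  apply rlim_eps; intros e He.
  assert (H : derivable_pt_lim (fun h => exp (c * h)) 0 c).
  { apply is_derive_Reals; auto_derive; [exact I |]; rewrite Rmult_0_r, exp_0; ring. }
  destruct (H e He) as [d Hd]; exists d; split; [apply cond_pos |]; intros h Hh.
  specialize (Hd h ltac:(lra) ltac:(rewrite Rabs_pos_eq; lra)).
  rewrite Rmult_0_r, exp_0, Rplus_0_l in Hd; exact Hd.
Qed.

Lemma exp_right_limit (c : R) :
  filterlim (fun h => exp (c * h)) (at_right 0) (locally 1).
Proof.
  apply (filterlim_filter_le_1 (F := locally 0) (G := at_right 0)).
  - intros P [d Hd]; exists d; intros y Hy _; now apply Hd.
  - replace 1 with (exp (c * 0)) by (rewrite Rmult_0_r; apply exp_0).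
    apply (ex_derive_continuous (fun h => exp (c * h)) 0); auto_derive; exact I.
Qed.

(** * Uniform boundedness *)

Section UniformBoundedness.

Context {k : scalar_field} {Y Z : CompleteNormedModule (scalars k)}.

(** [c] is the operator norm of [L]; being positive it exceeds [2 / 3 * c], so some vector of the
    unit ball beats the latter. *)
Lemma nearly_attained_bound (L : Y -> Z) c0 :
  rlinear L -> 0 <= c0 -> ~ (forall x, norm (L x) <= c0 * norm x) ->
  exists c, c0 < c /\ (forall x, norm (L x) <= c * norm x) /\
    exists x, 2 / 3 * c * norm x < norm (L x).
Proof.
  intros HL Hc0 Hn; destruct (rlin_norm L HL) as [C [HC HLC]].
  destruct (completeness (fun r => exists x, norm x <= 1 /\ r = norm (L x))) as [c [Hc1 Hc2]].
  { exists C; intros r [x [Hx ->]]; apply Rle_trans with (1 := HLC x); nra. }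
  { exists (norm (L zero)), zero; split; [| reflexivity].
    apply Rle_trans with 0; [right; exact vnorm0 | lra]. }
  assert (H : forall x, norm (L x) <= c * norm x).
  { intros x; destruct (Rle_lt_or_eq_dec _ _ (vnorm_ge0 x)) as [Hx | Hx].
    - assert (Hl : norm (L (rscal (/ norm x) x)) <= c).
      { apply Hc1; exists (rscal (/ norm x) x); split; [| reflexivity].
        rewrite vnorm_rscal_pos by (left; apply Rinv_0_lt_compat, Hx).
        right; field; lra. }
      rewrite (rlin_rscal L HL), vnorm_rscal_pos in Hl by (left; apply Rinv_0_lt_compat, Hx).
      apply (Rmult_le_compat_l (norm x)) in Hl; [| lra].
      rewrite <- Rmult_assoc, Rinv_r in Hl by lra; lra.
    - generalize (HLC x); rewrite <- Hx, !Rmult_0_r; auto. }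
  assert (Hcc : c0 < c).
  { destruct (Rlt_le_dec c0 c) as [Hl | Hl]; [exact Hl |]; exfalso; apply Hn; intros x.
    apply Rle_trans with (1 := H x), Rmult_le_compat_r; [apply vnorm_ge0 | exact Hl]. }
  exists c; split; [exact Hcc | split; [exact H |]].
  apply NNPP; intros Hx.
  assert (c <= 2 / 3 * c).
  { apply Hc2; intros r [x [Hx1 ->]].
    apply Rnot_lt_le; intros Hlt; apply Hx; exists x.
    apply Rle_lt_trans with (2 := Hlt).
    rewrite <- (Rmult_1_r (2 / 3 * c)) at 2; apply Rmult_le_compat_l; lra. }
  lra.
Qed.

(** Sokal's gliding hump: [x_(n+1)] is one of [x_n + v], [x_n - v] with
    [|v| = 4^-n] and [|L_n v|] nearly maximal. *)
Lemma uniform_boundedness (L : nat -> Y -> Z) :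
  (forall n, rlinear (L n)) ->
  (forall x, exists K N, forall n, (N <= n)%nat -> norm (L n x) <= K) ->
  exists n, forall x, norm (L n x) <= 8 ^ n * norm x.
Proof.
  intros HL Hb; apply NNPP; intros Hn.
  assert (Hp4 : forall n, 0 < (/ 4) ^ n) by (intros; apply pow_lt; lra).
  assert (Hc : forall n, exists c, 8 ^ n < c /\ (forall x, norm (L n x) <= c * norm x) /\
    exists x, 2 / 3 * c * norm x < norm (L n x)).
  { intros n; apply nearly_attained_bound; [apply HL | apply pow_le; lra |].
    intros H; apply Hn; now exists n. }
  (* Later increments sum to at most [(/ 4) ^ n / 3] and can remove at most half of
     [2 / 3 * c * (/ 4) ^ n], so the limit still feels the hump of index [n]. *)
  assert (Hstep : forall n x, exists x' : Y, norm (minus x' x) <= (/ 4) ^ n /\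
    forall y, norm (minus x' y) <= (/ 4) ^ n / 3 -> (/ 4) ^ n * 8 ^ n <= 3 * norm (L n y)).
  { intros n x; destruct (Hc n) as [c [Hc1 [Hc2 [w Hw]]]].
    assert (H8 : 0 < 8 ^ n) by (apply pow_lt; lra).
    assert (Hwn : 0 < norm w).
    { apply Rnot_le_lt; intros Hl; generalize (Hc2 w) (vnorm_ge0 w); nra. }
    pose (r := (/ 4) ^ n / norm w).
    assert (Hr : 0 < r) by (apply Rdiv_lt_0_compat; auto).
    assert (Hrw : r * norm w = (/ 4) ^ n) by (unfold r; field; lra).
    pose (v := rscal r w).
    assert (Hv : norm v = (/ 4) ^ n).
    { unfold v; rewrite vnorm_rscal_pos; lra. }
    assert (HLv : 2 / 3 * c * (/ 4) ^ n < norm (L n v)).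
    { unfold v; rewrite (rlin_rscal _ (HL n)), vnorm_rscal_pos by lra.
      rewrite <- Hrw; nra. }
    assert (Hx' : exists x', norm (minus x' x) <= (/ 4) ^ n /\
                   2 / 3 * c * (/ 4) ^ n <= norm (L n x')).
    (* As [L (x + v) - L (x - v) = 2 L v], one of the two points has an image at least as long as
       [L v]. *)
    { assert (H : 2 * norm (L n v) <= norm (L n (plus x v)) + norm (L n (minus x v))).
      { rewrite <- vnorm_rscal_pos, <- (rlin_rscal _ (HL n)) by lra.
        replace (rscal 2 v) with (minus (plus x v) (minus x v)) by modeq Y.
        rewrite (rlin_minus _ (HL n)); apply vnorm_minus. }
      destruct (Rle_lt_dec (norm (L n (plus x v))) (norm (L n v))) as [Hl | Hl].
      - exists (minus x v); split; [| lra].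
        rewrite vnorm_sym; replace (minus x (minus x v)) with v by modeq Y; lra.
      - exists (plus x v); split; [| lra].
        replace (minus (plus x v) x) with v by modeq Y; lra. }
    destruct Hx' as [x' [H1 H2]]; exists x'; split; [exact H1 |]; intros y Hy.
    assert (H3 : norm (L n x') <= norm (L n (minus x' y)) + norm (L n y)).
    { apply vnorm_decomp; rewrite (rlin_minus _ (HL n)); modeq Z. }
    assert (H4 : norm (L n (minus x' y)) <= c * ((/ 4) ^ n / 3)).
    { apply Rle_trans with (1 := Hc2 _), Rmult_le_compat_l; lra. }
    generalize (Hp4 n); nra. }
  pose (next := fun n x => epsilon (inhabits x) (fun x' : Y => norm (minus x' x) <= (/ 4) ^ n /\
    forall y, norm (minus x' y) <= (/ 4) ^ n / 3 -> (/ 4) ^ n * 8 ^ n <= 3 * norm (L n y))).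
  pose (u := fix u n := match n with O => (zero : Y) | S n => next n (u n) end).
  assert (Hu : forall n, norm (minus (u (S n)) (u n)) <= (/ 4) ^ n /\
    forall y, norm (minus (u (S n)) y) <= (/ 4) ^ n / 3 -> (/ 4) ^ n * 8 ^ n <= 3 * norm (L n y)).
  { intros n; exact (epsilon_spec (inhabits (u n)) _ (Hstep n (u n))). }
  destruct (geometric_cauchy_limit u 1 (/ 4)) as [l Hl]; [lra | |].
  { intros n; rewrite Rmult_1_l; apply Hu. }
  destruct (Hb l) as [K [N HK]].
  destruct (Pow_x_infinity 2 ltac:(rewrite Rabs_pos_eq; lra) (3 * K + 1)) as [m Hm].
  pose (n := max m N).
  specialize (Hm n ltac:(lia)); specialize (HK n ltac:(lia)).
  rewrite Rabs_pos_eq in Hm by (apply pow_le; lra).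
  assert (H : (/ 4) ^ n * 8 ^ n <= 3 * norm (L n l)).
  { apply Hu; apply Rle_trans with (1 := Hl (S n)); simpl; right; field. }
  rewrite <- Rpow_mult_distr in H; replace (/ 4 * 8) with 2 in H by field; lra.
Qed.

End UniformBoundedness.

(** * Orbits, generators and uniqueness of the generated semigroup *)

Section Semigroup.

Context {k : scalar_field} {Y : CompleteNormedModule (scalars k)}.
Variable T : R -> Y -> Y.
Hypothesis HT : C0_semigroup T.

Lemma semigroup_rlinear t : 0 <= t -> rlinear (T t).
Proof. intros Ht; now apply is_linear_rlinear, (C0_bounded T HT). Qed.

Lemma semigroup_right_continuous x e :
  0 < e -> exists d, 0 < d /\ forall h, 0 <= h < d -> norm (minus (T h x) x) < e.
Proof.
  intros He; pose proof (proj1 (filterlim_eps (Y := Y) _ _ _) (C0_cont T HT x) e He) as H.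
  apply at_right_eps in H; destruct H as [d [Hd1 Hd2]]; exists d; split; [exact Hd1 |].
  intros h [[Hh | <-] Hhd]; [now apply Hd2 |].
  rewrite (C0_zero T HT), vnorm_self; exact He.
Qed.

(** Otherwise there are times [s n <= / (INR n + 1)] for which [8 ^ n] does not bound [T (s n)],
    whereas strong continuity at 0 keeps [T (s n) x] bounded for large [n] at each [x]; this
    contradicts [uniform_boundedness]. *)
Lemma semigroup_bound_near_0 :
  exists d K, 0 < d /\ 1 <= K /\ forall t x, 0 <= t <= d -> norm (T t x) <= K * norm x.
Proof.
  apply NNPP; intros Hn.
  assert (H : forall n : nat, exists t, 0 <= t <= / (INR n + 1) /\
            ~ forall x, norm (T t x) <= 8 ^ n * norm x).
  { intros n; apply NNPP; intros H; apply Hn; exists (/ (INR n + 1)), (8 ^ n).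
    repeat split.
    - apply Rinv_0_lt_compat; generalize (pos_INR n); lra.
    - apply pow_R1_Rle; lra.
    - intros t x Ht; apply NNPP; intros Hx; apply H; exists t; split; [exact Ht |].
      intros Hall; now apply Hx. }
  pose (s := fun n : nat => epsilon (inhabits 0) (fun t => 0 <= t <= / (INR n + 1) /\
            ~ forall x, norm (T t x) <= 8 ^ n * norm x)).
  assert (Hs : forall n : nat, 0 <= s n <= / (INR n + 1) /\
            ~ forall x, norm (T (s n) x) <= 8 ^ n * norm x).
  { intros n; exact (epsilon_spec (inhabits 0) _ (H n)). }
  destruct (uniform_boundedness (fun n => T (s n))) as [n Hb].
  - intros n; apply semigroup_rlinear, Hs.
  - intros x; destruct (semigroup_right_continuous x 1 Rlt_0_1) as [d [Hd1 Hd2]].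
    destruct (archimed_cor1 d Hd1) as [N [HN1 HN2]].
    exists (1 + norm x), N; intros n HNn.
    assert (Hsn : s n < d).
    { apply Rle_lt_trans with (1 := proj2 (proj1 (Hs n))), Rle_lt_trans with (2 := HN1).
      apply Rinv_le_contravar; [apply lt_0_INR, HN2 |].
      generalize (le_INR _ _ HNn); lra. }
    apply Rle_trans with (norm (minus (T (s n) x) x) + norm x).
    + apply vnorm_decomp; modeq Y.
    + specialize (Hd2 (s n) (conj (proj1 (proj1 (Hs n))) Hsn)); lra.
  - exact (proj2 (Hs n) Hb).
Qed.

Lemma semigroup_locally_bounded b :
  exists K, 0 <= K /\ forall t x, 0 <= t <= b -> norm (T t x) <= K * norm x.
Proof.
  destruct semigroup_bound_near_0 as [d [K [Hd [HK H]]]].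
  assert (Hn : forall n t x, 0 <= t <= INR n * d -> norm (T t x) <= K ^ n * norm x).
  { induction n as [| n IH]; intros t x Ht.
    - simpl in *; replace t with 0 by lra; rewrite (C0_zero T HT); lra.
    - rewrite S_INR in Ht; simpl pow.
      destruct (Rle_lt_dec t d) as [Htd | Htd].
      + apply Rle_trans with (1 := H t x ltac:(lra)), Rmult_le_compat_r; [apply vnorm_ge0 |].
        rewrite <- (Rmult_1_r K) at 1; apply Rmult_le_compat_l; [lra | now apply pow_R1_Rle].
      + replace t with (d + (t - d)) by ring; rewrite (C0_plus T HT) by lra.
        apply Rle_trans with (1 := H d _ ltac:(lra)); rewrite Rmult_assoc.
        apply Rmult_le_compat_l; [lra |]; apply IH; lra. }
  destruct (INR_unbounded (b / d)) as [n Hn'].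
  exists (K ^ n); split; [apply pow_le; lra |].
  intros t x Ht; apply Hn; split; [lra |].
  apply Rle_trans with b; [lra |].
  replace b with (b / d * d) by (field; lra); apply Rmult_le_compat_r; lra.
Qed.

Lemma Rmax_0_lipschitz s t : Rabs (Rmax 0 s - Rmax 0 t) <= Rabs (s - t).
Proof.
  unfold Rmax; destruct (Rle_dec 0 s), (Rle_dec 0 t); unfold Rabs;
    repeat destruct (Rcase_abs _); lra.
Qed.

(** Orbits are extended to negative times by [Rmax 0] so as to be continuous on
    the whole line. *)
Lemma orbit_continuous x t : continuous (fun t => T (Rmax 0 t) x) t.
Proof.
  apply (continuous_eps (Y := Y)); intros e He.
  destruct (semigroup_locally_bounded (Rmax 0 t + 1)) as [K [HK H]].
  assert (H0 : 0 < e / (K + 1)) by (apply Rdiv_lt_0_compat; lra).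
  destruct (semigroup_right_continuous x _ H0) as [d [Hd1 Hd2]].
  exists (Rmin d 1); split; [apply Rmin_glb_lt; lra |]; intros s Hs.
  pose proof (Rmin_l d 1) as Hm1; pose proof (Rmin_r d 1) as Hm2.
  pose proof (Rmax_0_lipschitz s t) as Hl.
  pose proof (Rmax_l 0 s) as Hs0; pose proof (Rmax_l 0 t) as Ht0.
  assert (Hgen : forall a b, 0 <= a -> a <= b -> a <= Rmax 0 t + 1 -> b - a < d ->
                 norm (minus (T b x) (T a x)) < e).
  { intros a b Ha Hab Hat Hba.
    replace b with (a + (b - a)) by ring; rewrite (C0_plus T HT) by lra.
    rewrite <- (rlin_minus _ (semigroup_rlinear a Ha)).
    specialize (Hd2 (b - a) ltac:(lra)).
    apply (proj2 (Rlt_div_r _ _ (K + 1) ltac:(lra))) in Hd2.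
    generalize (H a (minus (T (b - a) x) x) ltac:(lra))
      (vnorm_ge0 (minus (T (b - a) x) x)); nra. }
  destruct (Rle_lt_dec (Rmax 0 t) (Rmax 0 s)) as [Hts | Hts].
  - rewrite Rabs_pos_eq in Hl by lra; apply Hgen; lra.
  - rewrite Rabs_left in Hl by lra; rewrite vnorm_sym; apply Hgen; lra.
Qed.

(** Strong continuity in time combines with continuity of [F] through the local bound on [T]. The
    time [u s] is [t - s] in the uniqueness proof and [s] in convolutions. *)
Lemma semigroup_jointly_continuous (u : R -> R) (F : R -> Y) t :
  (forall s, Rabs (u s - u t) <= Rabs (s - t)) -> continuous F t ->
  continuous (fun s => T (Rmax 0 (u s)) (F s)) t.
Proof.
  intros Hu HF; apply (continuous_eps (Y := Y)); intros e He.
  destruct (semigroup_locally_bounded (Rmax 0 (u t) + 1)) as [K [HK H]].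
  assert (H0 : 0 < e / 2 / (K + 1)) by (apply Rdiv_lt_0_compat; lra).
  destruct (proj1 (continuous_eps (Y := Y) _ _) HF _ H0) as [d1 [Hd1 Hd1']].
  destruct (proj1 (continuous_eps (Y := Y) _ _) (orbit_continuous (F t) (u t)) (e / 2)) as
    [d2 [Hd2 Hd2']]; [lra |].
  exists (Rmin d1 (Rmin d2 1)); split; [repeat apply Rmin_glb_lt; lra |]; intros s Hs.
  pose proof (Rmin_l d1 (Rmin d2 1)) as Hm1; pose proof (Rmin_r d1 (Rmin d2 1)) as Hm2.
  pose proof (Rmin_l d2 1) as Hm3; pose proof (Rmin_r d2 1) as Hm4.
  specialize (Hd1' s ltac:(lra)); specialize (Hu s); specialize (Hd2' (u s) ltac:(lra)).
  apply Rle_lt_trans with (1 := norm_minus_triangle (T (Rmax 0 (u s)) (F t)) _ _).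
  rewrite <- (rlin_minus _ (semigroup_rlinear (Rmax 0 (u s)) (Rmax_l _ _))).
  assert (Hb : 0 <= Rmax 0 (u s) <= Rmax 0 (u t) + 1).
  { split; [apply Rmax_l |]; pose proof (Rmax_0_lipschitz (u s) (u t)).
    pose proof (Rle_abs (Rmax 0 (u s) - Rmax 0 (u t))); lra. }
  pose proof (H _ (minus (F s) (F t)) Hb) as H1.
  apply (proj2 (Rlt_div_r _ _ (K + 1) ltac:(lra))) in Hd1'.
  generalize (vnorm_ge0 (minus (F s) (F t))); nra.
Qed.

Variable A : operator Y.
Hypothesis HA : is_generator A T.

Lemma generator_plus x x' y y' : A x y -> A x' y' -> A (plus x x') (plus y y').
Proof.
  intros H1 H2; apply HA in H1; apply HA in H2; apply HA.
  generalize (vlim_plus _ _ _ _ _ H1 H2); apply filterlim_ext_loc.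
  apply at_right_eps; exists 1; split; [lra |]; intros h Hh.
  rewrite (rlin_plus _ (semigroup_rlinear h ltac:(lra))); modeq Y.
Qed.

Lemma generator_scal (c : scalars k) x y : A x y -> A (scal c x) (scal c y).
Proof.
  intros H; apply HA in H; apply HA.
  generalize (filterlim_comp _ _ _ _ (scal c) _ _ _ H (filterlim_scal_r (V := Y) c y)).
  apply filterlim_ext_loc, at_right_eps; exists 1; split; [lra |]; intros h Hh.
  rewrite (scal_rscal (Y := Y)), (linear_scal _ (C0_bounded T HT h ltac:(lra))).
  f_equal; exact (scal_minus_distr_l (V := Y) c (T h x) x).
Qed.

Lemma generator_rscal (r : R) x y : A x y -> A (rscal r x) (rscal r y).
Proof. apply generator_scal. Qed.

Lemma generator_minus x x' y y' : A x y -> A x' y' -> A (minus x x') (minus y y').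
Proof.
  intros H1 H2; replace (minus x x') with (plus x (rscal (-1) x')) by modeq Y.
  replace (minus y y') with (plus y (rscal (-1) y')) by modeq Y.
  apply generator_plus, generator_rscal; assumption.
Qed.

Lemma generator_semigroup t x y : 0 <= t -> A x y -> A (T t x) (T t y).
Proof.
  intros Ht H; apply HA in H; apply HA.
  generalize (vlim_rlinear _ (T t) _ _ (semigroup_rlinear t Ht) H).
  apply filterlim_ext_loc, at_right_eps; exists 1; split; [lra |]; intros h Hh.
  rewrite (rlin_rscal _ (semigroup_rlinear t Ht)), (rlin_minus _ (semigroup_rlinear t Ht)).
  rewrite <- !(C0_plus T HT) by lra; now rewrite (Rplus_comm t h).
Qed.

Lemma generator_increment x y e :
  A x y -> 0 < e -> exists d, 0 < d /\
    forall h, 0 < h < d -> norm (minus (minus (T h x) x) (rscal h y)) <= e * h.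
Proof.
  intros H He; apply HA in H.
  pose proof (proj1 (filterlim_eps (Y := Y) _ _ _) H e He) as H1.
  apply at_right_eps in H1; destruct H1 as [d [Hd1 Hd2]]; exists d; split; [exact Hd1 |].
  intros h Hh; specialize (Hd2 h Hh).
  vset (rscal h (minus (rscal (/ h) (minus (T h x) x)) y)).
  rewrite vnorm_rscal_pos, Rmult_comm by lra.
  apply Rmult_le_compat_r; [lra | left; exact Hd2].
Qed.

Lemma integral_right_derivative (f : R -> Y) c :
  (forall t, continuous f t) ->
  filterlim (fun r => rscal (/ r) (integral f c (c + r))) (at_right 0) (locally (f c)).
Proof.
  intros Hf; apply (filterlim_eps (Y := Y)); [typeclasses eauto |]; intros e He; apply at_right_eps.
  destruct (proj1 (continuous_eps (Y := Y) f c) (Hf c) (e / 2)) as [d [Hd1 Hd2]]; [lra |].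
  exists d; split; [exact Hd1 |]; intros r Hr.
  assert (H : norm (minus (integral f c (c + r)) (rscal (c + r - c) (f c))) <= (c + r - c) * (e / 2)).
  { apply integral_norm_near; [exact Hf | lra |]; intros t Ht.
    left; apply Hd2; rewrite Rabs_pos_eq; lra. }
  replace (c + r - c) with r in H by ring.
  vset (rscal (/ r) (minus (integral f c (c + r)) (rscal r (f c)))).
  assert (Hr' : 0 < / r) by (apply Rinv_0_lt_compat; lra).
  rewrite vnorm_rscal_pos by lra.
  apply Rle_lt_trans with (/ r * (r * (e / 2))); [apply Rmult_le_compat_l; lra |].
  replace (/ r * (r * (e / 2))) with (e / 2) by (field; lra); lra.
Qed.

(** The integrand of the Laplace transform that represents the resolvent; its integrals are taken
    over bounded intervals [[0, h]]. *)
Definition discounted_orbit (mu : R) (x : Y) (s : R) : Y :=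
  rscal (exp (- mu * s)) (T (Rmax 0 s) x).

Lemma discounted_orbit_continuous mu x s : continuous (discounted_orbit mu x) s.
Proof.
  unfold discounted_orbit; apply (vlim_rscal _ (fun s => exp (- mu * s))).
  - apply (ex_derive_continuous (fun s => exp (- mu * s))); auto_derive; exact I.
  - apply orbit_continuous.
Qed.

(** The conclusion reads [(mu - A) z = x - exp (- mu h) T h x]. It holds because [T r z] is
    [exp (mu r)] times the same integral over [[r, h + r]], so that only the two ends contribute to
    the derivative at [r = 0]. With [mu = 0] and small [h] it gives density of the domain, with a
    fixed larger [h] the surjectivity of [mu - A]. *)
Lemma generator_discounted_integral mu x h :
  0 <= h ->
  let z := integral (discounted_orbit mu x) 0 h in
  A z (minus (rscal mu z) (minus x (rscal (exp (- mu * h)) (T h x)))).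
Proof.
  intros Hh z; set (f := discounted_orbit mu x).
  assert (Hf : forall s, continuous f s) by apply discounted_orbit_continuous.
  assert (HTz : forall r, 0 < r -> T r z = rscal (exp (mu * r))
    (plus z (minus (integral f h (h + r)) (integral f 0 (0 + r))))).
  { intros r Hr; unfold z; fold f.
    rewrite <- (integral_rlinear (T r) f 0 h (semigroup_rlinear r ltac:(lra)) Hf).
    transitivity (integral (fun s => rscal (exp (mu * r)) (f (s + r))) 0 h).
    { apply integral_ext; [exact Hh |]; intros s Hs; unfold f, discounted_orbit.
      rewrite (rlin_rscal _ (semigroup_rlinear r ltac:(lra))).
      rewrite !Rmax_right, <- (C0_plus T HT) by lra.
      rewrite (rscal_assoc (Y := Y)), <- exp_plus, (Rplus_comm r s).
      do 2 f_equal; ring. }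
    assert (HL : rlinear (fun y : Y => rscal (exp (mu * r)) y)).
    { split.
      - intros; modeq Y.
      - intros; modeq Y.
      - exists (exp (mu * r)); split; [left; apply exp_pos |]; intros y.
        rewrite vnorm_rscal_pos by (left; apply exp_pos); lra. }
    rewrite (integral_rlinear (fun y : Y => rscal (exp (mu * r)) y) (fun s => f (s + r)) 0 h HL).
    2: { intros t; apply (continuous_comp (fun s => s + r) f); [| apply Hf].
         apply (continuous_plus (fun s => s) (fun _ => r));
           [apply continuous_id | apply continuous_const]. }
    f_equal; rewrite (integral_shift f 0 h r Hf).
    pose proof (integral_Chasles f 0 h (h + r) Hf) as H1.
    pose proof (integral_Chasles f 0 (0 + r) (h + r) Hf) as H2.
    replace (plus (integral f 0 h) (minus (integral f h (h + r)) (integral f 0 (0 + r)))) with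
      (minus (plus (integral f 0 h) (integral f h (h + r))) (integral f 0 (0 + r))) by modeq Y.
    rewrite H1, <- H2; modeq Y. }
  apply HA.
  replace (minus (rscal mu z) (minus x (rscal (exp (- mu * h)) (T h x)))) with
    (plus (rscal mu z) (rscal 1 (minus (f h) (f 0)))).
  2: { unfold f, discounted_orbit; rewrite !Rmax_right by lra.
       rewrite (C0_zero T HT), Rmult_0_r, exp_0; modeq Y. }
  apply filterlim_ext_loc with (f := fun r => plus (rscal ((exp (mu * r) - 1) / r) z)
    (rscal (exp (mu * r)) (minus (rscal (/ r) (integral f h (h + r)))
       (rscal (/ r) (integral f 0 (0 + r)))))).
  - apply at_right_eps; exists 1; split; [lra |]; intros r Hr.
    rewrite (HTz r) by lra; modfield Y.
  - apply vlim_plus; [typeclasses eauto | |].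
    + apply vlim_rscal; [typeclasses eauto | apply exp_quotient_limit | apply filterlim_const].
    + apply vlim_rscal; [typeclasses eauto | apply exp_right_limit |].
      apply vlim_minus; [typeclasses eauto | |]; now apply integral_right_derivative.
Qed.

(** The mean of the orbit of [x] over a short interval is in the domain and close to [x]. *)
Lemma generator_dense x e : 0 < e -> exists y z, A y z /\ norm (minus y x) < e.
Proof.
  intros He.
  assert (Hf := discounted_orbit_continuous 0 x).
  pose proof (integral_right_derivative _ 0 Hf) as H.
  pose proof (proj1 (filterlim_eps (Y := Y) _ _ _) H e He) as H1.
  apply at_right_eps in H1; destruct H1 as [d [Hd1 Hd2]].
  specialize (Hd2 (d / 2) ltac:(lra)).
  eexists _, _; split.
  - apply (generator_rscal (/ (d / 2))), (generator_discounted_integral 0 x (d / 2)); lra.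
  - rewrite Rplus_0_l in Hd2.
    replace (discounted_orbit 0 x 0) with x in Hd2; [exact Hd2 |].
    unfold discounted_orbit; rewrite Rmax_right, (C0_zero T HT), Rmult_0_r, exp_0 by lra.
    modeq Y.
Qed.

(** Mean value inequality for [T s x - s y], whose right derivative at [s] is [T s y - y]. *)
Lemma orbit_increment x y h e :
  A x y -> 0 <= h -> (forall s, 0 <= s <= h -> norm (minus (T s y) y) <= e) ->
  norm (minus (minus (T h x) x) (rscal h y)) <= e * h.
Proof.
  intros HAx Hh He.
  pose (f := fun s => minus (T (Rmax 0 s) x) (rscal s y)).
  assert (H : norm (minus (f h) (f 0)) <= e * (h - 0)).
  { apply right_mean_value; [exact Hh | |].
    - intros t; unfold f; apply (vlim_minus (locally t) (fun s => T (Rmax 0 s) x));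
        [apply orbit_continuous |].
      apply (vlim_rscal (locally t) (fun s => s)); [apply filterlim_id | apply filterlim_const].
    - intros t e' Ht He'.
      destruct (generator_increment _ _ e' (generator_semigroup t x y (proj1 Ht) HAx) He')
        as [d [Hd1 Hd2]].
      exists d; split; [exact Hd1 |]; intros s Hs; specialize (Hd2 s Hs).
      unfold f; rewrite !Rmax_right by lra.
      rewrite (Rplus_comm t s), (C0_plus T HT) by lra.
      apply Rle_trans with (norm (minus (minus (T s (T t x)) (T t x)) (rscal s (T t y))) +
                            norm (rscal s (minus (T t y) y))).
      + apply vnorm_decomp; modeq Y.
      + rewrite vnorm_rscal_pos by lra; specialize (He t ltac:(lra)); nra. }
  unfold f in H; rewrite !Rmax_right, (C0_zero T HT), Rminus_0_r in H by lra.
  apply Rle_trans with (2 := H); right; f_equal; modeq Y.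
Qed.

End Semigroup.

(** For [y] in the domain, [T (t - s) (W s y)] has right derivative zero in [s], so its values at
    [0] and [t] agree; density does the rest. The dichotomy hypothesis provides some semigroup with
    the delay generator, and this lemma identifies it with the one constructed from mild
    solutions. *)
Lemma semigroup_unique {k : scalar_field} {Y : CompleteNormedModule (scalars k)}
  (A : operator Y) (T W : R -> Y -> Y) :
  generates A T -> generates A W -> forall t x, 0 <= t -> T t x = W t x.
Proof.
  intros [HT HAT] [HW HAW] t x Ht.
  assert (HD : forall y z, A y z -> T t y = W t y).
  { intros y z Hyz.
    pose (f := fun s => T (Rmax 0 (t - s)) (W (Rmax 0 s) y)).
    assert (H : norm (minus (f t) (f 0)) <= 0 * (t - 0)).
    { destruct (semigroup_locally_bounded T HT t) as [K [HK HTK]].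
      apply right_mean_value; [exact Ht | |].
      - intros s; apply (semigroup_jointly_continuous T HT (fun s => t - s)).
        + intros r; replace (t - r - (t - s)) with (- (r - s)) by ring; rewrite Rabs_Ropp; lra.
        + apply (orbit_continuous W HW).
      - intros s e Hs He; rewrite Rplus_0_l.
        assert (He' : 0 < e / (2 * K + 1)) by (apply Rdiv_lt_0_compat; lra).
        pose proof (generator_semigroup W HW A HAW s _ _ (proj1 Hs) Hyz) as Hs'.
        destruct (generator_increment T A HAT _ _ _ Hs' He') as [d1 [Hd1 Hd1']].
        destruct (generator_increment W A HAW _ _ _ Hs' He') as [d2 [Hd2 Hd2']].
        exists (Rmin (t - s) (Rmin d1 d2)); split; [repeat apply Rmin_glb_lt; lra |].
        intros h Hh.
        pose proof (Rmin_l (t - s) (Rmin d1 d2)); pose proof (Rmin_r (t - s) (Rmin d1 d2)).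
        pose proof (Rmin_l d1 d2); pose proof (Rmin_r d1 d2).
        specialize (Hd1' h ltac:(lra)); specialize (Hd2' h ltac:(lra)).
        unfold f; rewrite !Rmax_right by lra.
        rewrite (Rplus_comm s h), (C0_plus W HW) by lra.
        replace (t - s) with (t - (h + s) + h) by ring; rewrite (C0_plus T HT) by lra.
        rewrite <- (rlin_minus _ (semigroup_rlinear T HT (t - (h + s)) ltac:(lra))).
        set (y' := W s y) in *; set (z' := W s z) in *.
        assert (H' : norm (minus (W h y') (T h y')) <= 2 * (e / (2 * K + 1)) * h).
        { apply Rle_trans with (norm (minus (minus (W h y') y') (rscal h z')) +
                                norm (opp (minus (minus (T h y') y') (rscal h z')))).
          - apply vnorm_decomp; modeq Y.
          - rewrite vnorm_opp; lra. }
        apply Rle_trans with (1 := HTK (t - (h + s)) (minus (W h y') (T h y')) ltac:(lra)).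
        apply Rle_trans with (K * (2 * (e / (2 * K + 1)) * h));
          [apply Rmult_le_compat_l; lra |].
        assert (Heq : e / (2 * K + 1) * (2 * K + 1) = e) by (field; lra).
        nra. }
    rewrite Rmult_0_l in H; apply vnorm_minus_eq0 in H; unfold f in H.
    rewrite Rminus_diag, Rminus_0_r, !Rmax_right in H by lra.
    rewrite (C0_zero T HT), (C0_zero W HW) in H; now symmetry. }
  destruct (semigroup_locally_bounded T HT t) as [K [HK HTK]].
  destruct (semigroup_locally_bounded W HW t) as [K' [HK' HWK]].
  apply vnorm_minus_eq0, le_epsilon; intros e He.
  assert (He' : 0 < e / (K + K' + 1)) by (apply Rdiv_lt_0_compat; lra).
  destruct (generator_dense T HT A HAT x _ He') as [y [z [Hyz Hy]]].
  apply Rle_trans with (norm (T t (minus x y)) + norm (W t (minus y x))).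
  - apply vnorm_decomp; rewrite (rlin_minus _ (semigroup_rlinear T HT t Ht)).
    rewrite (rlin_minus _ (semigroup_rlinear W HW t Ht)), (HD y z Hyz); modeq Y.
  - generalize (HTK t (minus x y) ltac:(lra)) (HWK t (minus y x) ltac:(lra)).
    rewrite (vnorm_sym x y); intros.
    apply (proj2 (Rlt_div_r _ _ (K + K' + 1) ltac:(lra))) in Hy.
    generalize (vnorm_ge0 (minus y x)); nra.
Qed.

(** * Resolvents and the exponential formula *)

Lemma exp_INR_mult (n : nat) (c : R) : exp (INR n * c) = exp c ^ n.
Proof.
  induction n as [| n IH]; [simpl; rewrite Rmult_0_l; apply exp_0 |].
  rewrite S_INR, Rmult_plus_distr_r, exp_plus, IH, Rmult_1_l; simpl; ring.
Qed.

Lemma exp_le (a b : R) : a <= b -> exp a <= exp b.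
Proof. intros [H | ->]; [left; now apply exp_increasing | right; reflexivity]. Qed.

Lemma exp_le_inv_1_minus (x : R) : x < 1 -> exp x <= / (1 - x).
Proof.
  intros Hx; rewrite <- (Rinv_inv (exp x)), <- exp_Ropp.
  apply Rinv_le_contravar; [lra |]; generalize (exp_ineq1_le (- x)); lra.
Qed.

Lemma inv_1_minus_le_exp (x : R) : 0 <= x <= / 2 -> / (1 - x) <= exp (2 * x).
Proof.
  intros Hx; apply Rle_trans with (1 + 2 * x); [| apply exp_ineq1_le].
  apply (Rmult_le_reg_r (1 - x)); [lra |]; rewrite Rinv_l by lra; nra.
Qed.

Definition growth {k : scalar_field} {Y : CompleteNormedModule (scalars k)}
  (T : R -> Y -> Y) (M w : R) : Prop :=
  forall t x, 0 <= t -> norm (T t x) <= M * exp (w * t) * norm x.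

Section Resolvent.

Context {k : scalar_field} {Y : CompleteNormedModule (scalars k)}.
Variables (A : operator Y) (T : R -> Y -> Y) (M w : R).
Implicit Types x y z : Y.
Hypotheses (HT : C0_semigroup T) (HA : is_generator A T).
Hypotheses (HM : 1 <= M) (Hw : 0 <= w) (Hgrowth : growth T M w).

(** The least such [K] is the equivalent norm [sup exp (- w t) |T t x|], for which
    [T t] has norm at most [exp (w t)]. *)
Definition orbit_bound (K : R) (x : Y) : Prop :=
  forall t, 0 <= t -> norm (T t x) <= K * exp (w * t).

Lemma orbit_bound_growth x C : norm x <= C -> orbit_bound (M * C) x.
Proof.
  intros Hx t Ht; apply Rle_trans with (1 := Hgrowth t x Ht).
  replace (M * C * exp (w * t)) with (M * exp (w * t) * C) by ring.
  apply Rmult_le_compat_l; [| exact Hx].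
  apply Rmult_le_pos; [lra | left; apply exp_pos].
Qed.

Lemma orbit_bound_semigroup K x s :
  0 <= s -> orbit_bound K x -> orbit_bound (K * exp (w * s)) (T s x).
Proof.
  intros Hs HK t Ht; rewrite <- (C0_plus T HT) by assumption.
  apply Rle_trans with (1 := HK (t + s) ltac:(lra)); right.
  rewrite Rmult_plus_distr_l, exp_plus; ring.
Qed.

Lemma orbit_bound_norm K x : orbit_bound K x -> norm x <= K.
Proof.
  intros H; specialize (H 0 (Rle_refl 0)).
  rewrite (C0_zero T HT), Rmult_0_r, exp_0 in H; lra.
Qed.

Lemma orbit_bound_decomp K L x y z :
  z = plus x y -> orbit_bound K x -> orbit_bound L y -> orbit_bound (K + L) z.
Proof.
  intros -> Hx Hy t Ht; rewrite (rlin_plus _ (semigroup_rlinear T HT t Ht)).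
  apply Rle_trans with (1 := vnorm_plus _ _); rewrite Rmult_plus_distr_r.
  apply Rplus_le_compat; auto.
Qed.

Lemma orbit_bound_rscal K r x : 0 <= r -> orbit_bound K x -> orbit_bound (r * K) (rscal r x).
Proof.
  intros Hr Hx t Ht; rewrite (rlin_rscal _ (semigroup_rlinear T HT t Ht)).
  rewrite vnorm_rscal_pos, Rmult_assoc by exact Hr.
  apply Rmult_le_compat_l; auto.
Qed.

Lemma orbit_bound_le K L x : K <= L -> orbit_bound K x -> orbit_bound L x.
Proof.
  intros HKL Hx t Ht; apply Rle_trans with (1 := Hx t Ht).
  apply Rmult_le_compat_r; [left; apply exp_pos | exact HKL].
Qed.

(** Solve [u = x + exp (- mu h) T h u] by contraction; then the discounted integral of the orbit of
    [u] over [[0, h]] is mapped by [mu - A] to [x]. *)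
Lemma resolvent_surjective mu x : w < mu -> exists y, A y (minus (rscal mu y) x).
Proof.
  intros Hmu.
  (* The exponent becomes [(w - mu) * h = - 2 * M], and [M * exp (- 2 M) <= / 2]. *)
  pose (h := 2 * M / (mu - w)).
  assert (Hh : 0 <= h) by (apply Rdiv_le_0_compat; lra).
  assert (Hq : M * exp (w * h) * exp (- mu * h) <= / 2).
  { rewrite Rmult_assoc, <- exp_plus.
    replace (w * h + - mu * h) with (- (2 * M)) by (unfold h; field; lra).
    rewrite exp_Ropp; apply (Rmult_le_reg_r (exp (2 * M))); [apply exp_pos |].
    rewrite Rmult_assoc, Rinv_l by (generalize (exp_pos (2 * M)); lra).
    generalize (exp_ineq1_le (2 * M)); lra. }
  destruct (exists_fixpoint (S := unit) (Y := Y) (fun _ => 1) (fun _ => True)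
    (fun u _ => plus x (rscal (exp (- mu * h)) (T h (u tt))))
    (norm (plus x (rscal (exp (- mu * h)) (T h zero))))) as [u [_ [Hu _]]]; auto.
  - intros u v C _ _ Huv s; specialize (Huv tt); simpl in Huv |- *; rewrite Rmult_1_r in *.
    vset (rscal (exp (- mu * h)) (minus (T h (u tt)) (T h (v tt)))).
    rewrite <- (rlin_minus _ (semigroup_rlinear T HT h Hh)).
    rewrite vnorm_rscal_pos by (left; apply exp_pos).
    pose proof (Hgrowth h (minus (u tt) (v tt)) Hh) as H1.
    pose proof (vnorm_ge0 (minus (u tt) (v tt))) as H2.
    apply Rle_trans with (exp (- mu * h) * (M * exp (w * h) * norm (minus (u tt) (v tt)))).
    { apply Rmult_le_compat_l; [left; apply exp_pos | exact H1]. }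
    replace (exp (- mu * h) * (M * exp (w * h) * norm (minus (u tt) (v tt)))) with
      (M * exp (w * h) * exp (- mu * h) * norm (minus (u tt) (v tt))) by ring.
    nra.
  - intros; lra.
  - exists (integral (discounted_orbit T mu (u tt)) 0 h).
    pose proof (generator_discounted_integral T HT A HA mu (u tt) h Hh) as H.
    cbv zeta in H.
    replace (minus (u tt) (rscal (exp (- mu * h)) (T h (u tt)))) with x in H; [exact H |].
    rewrite (Hu tt) at 1; modeq Y.
Qed.

(** Let [G] be the equivalent norm of [y]. From [(1 + mu h) y = h (mu y - z) + T h y - (T h y - y -
    h z)] and [exp (w h) <= 1 + (w + 1) h] for small [h] follows [(1 + mu h) G <= h K + (1 + (w + 1)
    h) G + e h], hence [(mu - w - 1) G <= K + e]. That crude bound on the exponential is why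
    [mu - w - 1] replaces [mu - w]. *)
Lemma generator_dissipative mu y z K :
  w + 1 < mu -> A y z -> orbit_bound K (minus (rscal mu y) z) ->
  orbit_bound (K / (mu - w - 1)) y.
Proof.
  intros Hmu HAy HK.
  pose (E := fun r => exists t, 0 <= t /\ r = exp (- w * t) * norm (T t y)).
  assert (Hexp : forall t, exp (- w * t) * exp (w * t) = 1).
  { intros t; rewrite <- exp_plus; replace (- w * t + w * t) with 0 by ring; apply exp_0. }
  destruct (completeness E) as [G [HG1 HG2]].
  { exists (M * norm y); intros r [t [Ht ->]].
    apply Rle_trans with (exp (- w * t) * (M * exp (w * t) * norm y)).
    - apply Rmult_le_compat_l; [left; apply exp_pos | now apply Hgrowth].
    - right; transitivity (exp (- w * t) * exp (w * t) * (M * norm y)); [ring |].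
      rewrite Hexp; ring. }
  { exists (exp (- w * 0) * norm (T 0 y)), 0; split; [lra | reflexivity]. }
  assert (HGy : orbit_bound G y).
  { intros t Ht; rewrite <- (Rmult_1_l (norm (T t y))), <- (Hexp t).
    replace (exp (- w * t) * exp (w * t) * norm (T t y)) with
      (exp (- w * t) * norm (T t y) * exp (w * t)) by ring.
    apply Rmult_le_compat_r; [left; apply exp_pos |].
    apply HG1; exists t; split; [exact Ht | reflexivity]. }
  assert (HG0 : 0 <= G) by (apply Rle_trans with (2 := orbit_bound_norm G y HGy), vnorm_ge0).
  apply (orbit_bound_le G); [| exact HGy].
  apply Rle_div_r; [lra |]; apply le_epsilon; intros e He.
  (* The increment is estimated in the original norm, and passing to the equivalent one costs a
     factor [M]. *)
  assert (He' : 0 < e / M) by (apply Rdiv_lt_0_compat; lra).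
  destruct (generator_increment T A HA y z _ HAy He') as [d1 [Hd1 Hd1']].
  destruct (proj1 (rlim_eps _ _) (exp_quotient_limit w) 1 Rlt_0_1) as [d2 [Hd2 Hd2']].
  pose (h := Rmin d1 d2 / 2).
  assert (Hh : 0 < h /\ h < d1 /\ h < d2).
  { assert (0 < Rmin d1 d2) by (apply Rmin_glb_lt; lra).
    pose proof (Rmin_l d1 d2); pose proof (Rmin_r d1 d2); unfold h; lra. }
  specialize (Hd1' h ltac:(lra)); specialize (Hd2' h ltac:(lra)).
  assert (Hewh : exp (w * h) <= 1 + (w + 1) * h).
  { apply Rabs_def2 in Hd2'; destruct Hd2' as [Hd2' _].
    assert (H : (exp (w * h) - 1) / h < w + 1) by lra.
    apply (proj1 (Rlt_div_l _ _ h ltac:(lra))) in H; lra. }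
  assert (Hmain : orbit_bound (h * K + G * exp (w * h) + e * h) (rscal (1 + mu * h) y)).
  { apply (orbit_bound_decomp (h * K + G * exp (w * h)) (e * h)
      (plus (rscal h (minus (rscal mu y) z)) (T h y))
      (opp (minus (minus (T h y) y) (rscal h z)))); [modeq Y | |].
    - apply (orbit_bound_decomp (h * K) (G * exp (w * h)) (rscal h (minus (rscal mu y) z)) (T h y));
        [reflexivity | |].
      + apply orbit_bound_rscal; [lra | exact HK].
      + apply orbit_bound_semigroup; [lra | exact HGy].
    - replace (e * h) with (M * (e / M * h)) by (field; lra).
      apply orbit_bound_growth.
      apply Rle_trans with (2 := Hd1'); right; apply vnorm_opp. }
  assert (HG' : G <= (h * K + G * exp (w * h) + e * h) / (1 + mu * h)).
  { assert (Hmuh : 0 < 1 + mu * h) by (assert (0 < mu * h) by (apply Rmult_lt_0_compat; lra); lra).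
    apply HG2; intros r [t [Ht ->]].
    apply (proj1 (Rle_div_r _ _ (1 + mu * h) Hmuh)); specialize (Hmain t Ht).
    rewrite (rlin_rscal _ (semigroup_rlinear T HT t Ht)), vnorm_rscal_pos in Hmain by lra.
    apply (Rmult_le_compat_l (exp (- w * t))) in Hmain; [| left; apply exp_pos].
    replace (exp (- w * t) * ((h * K + G * exp (w * h) + e * h) * exp (w * t))) with
      (exp (- w * t) * exp (w * t) * (h * K + G * exp (w * h) + e * h)) in Hmain by ring.
    rewrite Hexp in Hmain; lra. }
  assert (Hmuh : 0 < 1 + mu * h) by (assert (0 < mu * h) by (apply Rmult_lt_0_compat; lra); lra).
  apply (proj2 (Rle_div_r _ _ (1 + mu * h) Hmuh)) in HG'.
  apply (Rmult_le_reg_l h); [lra |]; nra.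
Qed.

(** [resolvent] is an [epsilon], so some bounded inverse has to be exhibited. Surjectivity selects
    preimages; dissipativity with [K = 0] makes them unique, and uniqueness makes the selection
    linear. *)
Lemma resolvent_spec mu : w + 1 < mu -> is_resolvent A mu (resolvent A mu).
Proof.
  intros Hmu; unfold resolvent; apply epsilon_spec.
  pose (Rm := fun x => epsilon (inhabits (zero : Y)) (fun y => A y (minus (rscal mu y) x))).
  assert (HR : forall x, A (Rm x) (minus (rscal mu (Rm x)) x)).
  { intros x; apply (epsilon_spec (inhabits (zero : Y)) (fun y => A y (minus (rscal mu y) x))).
    apply resolvent_surjective; lra. }
  assert (Hinv : forall x z, A x z -> Rm (minus (rscal mu x) z) = x).
  { intros x z Hxz; apply minus_eq0, vnorm_eq0.
    set (p := minus (rscal mu x) z).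
    pose proof (generator_minus T HT A HA _ _ _ _ (HR p) Hxz) as H.
    replace 0 with (0 / (mu - w - 1)) by (field; lra).
    apply orbit_bound_norm.
    apply (generator_dissipative mu _ _ 0 Hmu H).
    replace 0 with (M * 0) by ring; apply orbit_bound_growth.
    apply Rle_trans with (norm (zero : Y)); [| right; exact vnorm0].
    right; f_equal; unfold p; modeq Y. }
  exists Rm; split; [| split].
  - split.
    + intros x y; pose proof (generator_plus T HT A HA _ _ _ _ (HR x) (HR y)) as H.
      transitivity (Rm (minus (rscal mu (plus (Rm x) (Rm y)))
        (plus (minus (rscal mu (Rm x)) x) (minus (rscal mu (Rm y)) y)))); [| now apply Hinv].
      f_equal; modeq Y.
    + intros c x; pose proof (generator_scal T HT A HA c _ _ (HR x)) as H.
      rewrite <- (Hinv _ _ H) at 1; f_equal.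
      rewrite <- (scal_rscal (Y := Y)).
      rewrite <- (scal_minus_distr_l (V := Y)); f_equal; modeq Y.
    + exists (M / (mu - w - 1)); split; [apply Rdiv_lt_0_compat; lra |]; intros x.
      apply orbit_bound_norm.
      replace (M / (mu - w - 1) * norm x) with (M * norm x / (mu - w - 1)) by (field; lra).
      apply (generator_dissipative mu _ _ _ Hmu (HR x)).
      replace (minus (rscal mu (Rm x)) (minus (rscal mu (Rm x)) x)) with x by modeq Y.
      apply orbit_bound_growth, Rle_refl.
  - intros y; eexists; split; [apply HR |]; modeq Y.
  - exact Hinv.
Qed.

Lemma resolvent_generator mu x :
  w + 1 < mu -> A (resolvent A mu x) (minus (rscal mu (resolvent A mu x)) x).
Proof.
  intros Hmu; destruct (resolvent_spec mu Hmu) as [_ [H _]].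
  destruct (H x) as [z [Hz1 Hz2]].
  replace (minus (rscal mu (resolvent A mu x)) x) with z; [exact Hz1 |].
  rewrite <- Hz2 at 2; modeq Y.
Qed.

Lemma resolvent_left_inverse mu x z :
  w + 1 < mu -> A x z -> resolvent A mu (minus (rscal mu x) z) = x.
Proof. intros Hmu; apply (resolvent_spec mu Hmu). Qed.

Lemma resolvent_rlinear mu : w + 1 < mu -> rlinear (resolvent A mu).
Proof. intros Hmu; apply is_linear_rlinear, (resolvent_spec mu Hmu). Qed.

Lemma resolvent_orbit_bound mu x K :
  w + 1 < mu -> orbit_bound K x -> orbit_bound (K / (mu - w - 1)) (resolvent A mu x).
Proof.
  intros Hmu HK; apply (generator_dissipative mu _ _ _ Hmu (resolvent_generator mu x Hmu)).
  replace (minus (rscal mu (resolvent A mu x)) (minus (rscal mu (resolvent A mu x)) x))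
    with x by modeq Y; exact HK.
Qed.

Lemma resolvent_semigroup mu t x :
  w + 1 < mu -> 0 <= t -> resolvent A mu (T t x) = T t (resolvent A mu x).
Proof.
  intros Hmu Ht.
  pose proof (generator_semigroup T HT A HA t _ _ Ht (resolvent_generator mu x Hmu)) as H.
  rewrite <- (resolvent_left_inverse mu _ _ Hmu H); f_equal.
  rewrite (rlin_minus _ (semigroup_rlinear T HT t Ht)).
  rewrite (rlin_rscal _ (semigroup_rlinear T HT t Ht)); modeq Y.
Qed.

(** The backward Euler step of length [/ mu]. *)
Definition euler (mu : R) (x : Y) : Y := rscal mu (resolvent A mu x).

Lemma euler_rlinear mu : w + 1 < mu -> rlinear (euler mu).
Proof.
  intros Hmu; pose proof (resolvent_rlinear mu Hmu) as HR; unfold euler; split.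
  - intros; rewrite (rlin_plus _ HR); modeq Y.
  - intros; rewrite (rlin_rscal _ HR); modeq Y.
  - destruct (rlin_norm _ HR) as [C [HC H]]; exists (mu * C); split.
    + apply Rmult_le_pos; lra.
    + intros x; rewrite vnorm_rscal_pos, Rmult_assoc by lra.
      apply Rmult_le_compat_l; [lra | apply H].
Qed.

Lemma euler_semigroup mu t x :
  w + 1 < mu -> 0 <= t -> euler mu (T t x) = T t (euler mu x).
Proof.
  intros Hmu Ht; unfold euler; rewrite resolvent_semigroup by assumption.
  now rewrite (rlin_rscal _ (semigroup_rlinear T HT t Ht)).
Qed.

Lemma euler_generator mu x z :
  w + 1 < mu -> A x z -> minus (euler mu x) x = resolvent A mu z.
Proof.
  intros Hmu Hxz; pose proof (resolvent_left_inverse mu x z Hmu Hxz) as H.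
  rewrite (rlin_minus _ (resolvent_rlinear mu Hmu)) in H.
  rewrite (rlin_rscal _ (resolvent_rlinear mu Hmu)) in H.
  unfold euler; rewrite <- H at 2; modeq Y.
Qed.

(** This is [mu / (mu - w - 1)], the bound of one Euler step in the equivalent norm. *)
Definition euler_factor (mu : R) : R := / (1 - (w + 1) / mu).

Lemma euler_orbit_bound mu x K :
  w + 1 < mu -> orbit_bound K x -> orbit_bound (euler_factor mu * K) (euler mu x).
Proof.
  intros Hmu HK; unfold euler.
  replace (euler_factor mu * K) with (mu * (K / (mu - w - 1))).
  - apply orbit_bound_rscal; [lra |]; now apply resolvent_orbit_bound.
  - unfold euler_factor; field; lra.
Qed.

Lemma euler_factor_ge mu : w + 1 < mu -> exp (w / mu) <= euler_factor mu /\ 1 <= euler_factor mu.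
Proof.
  intros Hmu.
  assert (H1 : (w + 1) / mu < 1) by (apply (Rdiv_lt_1 (w + 1) mu); lra).
  assert (H2 : 0 <= (w + 1) / mu) by (apply Rdiv_le_0_compat; lra).
  assert (H : exp ((w + 1) / mu) <= euler_factor mu) by now apply exp_le_inv_1_minus.
  split.
  - apply Rle_trans with (2 := H), exp_le, Rmult_le_compat_r; [| lra].
    left; apply Rinv_0_lt_compat; lra.
  - generalize (exp_ineq1_le ((w + 1) / mu)); lra.
Qed.

(** Stability of the scheme: [1 / (1 - x) <= exp (2 * x)] for [x <= / 2], applied to
    [x = (w + 1) * t / n]; the third hypothesis is this restriction on [x]. *)
Lemma euler_factor_pow n t :
  0 < t -> (0 < n)%nat -> 2 * (w + 1) <= INR n / t ->
  euler_factor (INR n / t) ^ n <= exp (2 * (w + 1) * t).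
Proof.
  intros Ht Hn Hnt; assert (Hn' : 0 < INR n) by now apply lt_0_INR.
  replace (2 * (w + 1) * t) with (INR n * (2 * ((w + 1) / (INR n / t)))) by (field; lra).
  rewrite exp_INR_mult; apply pow_incr; split.
  - left; apply Rinv_0_lt_compat.
    assert ((w + 1) / (INR n / t) < 1) by (apply (Rdiv_lt_1 (w + 1) (INR n / t)); lra); lra.
  - apply inv_1_minus_le_exp; split; [apply Rdiv_le_0_compat; lra |].
    apply Rle_div_l; lra.
Qed.

Lemma euler_iter_orbit_bound mu n x K :
  w + 1 < mu -> orbit_bound K x -> orbit_bound (euler_factor mu ^ n * K) (Nat.iter n (euler mu) x).
Proof.
  intros Hmu HK; induction n as [| n IH]; simpl.
  - rewrite Rmult_1_l; exact HK.
  - rewrite Rmult_assoc; now apply euler_orbit_bound.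
Qed.

Lemma euler_iter_minus mu n x y :
  w + 1 < mu ->
  Nat.iter n (euler mu) (minus x y) = minus (Nat.iter n (euler mu) x) (Nat.iter n (euler mu) y).
Proof.
  intros Hmu; induction n as [| n IH]; simpl; [reflexivity |].
  rewrite IH; apply (rlin_minus _ (euler_rlinear mu Hmu)).
Qed.

(** On the domain the difference is [resolvent A mu z], of order [/ mu]; density extends the limit,
    since for large [mu] the Euler steps are bounded by [2 * M]. *)
Lemma euler_limit x e :
  0 < e -> exists a, forall mu, a <= mu -> norm (minus (euler mu x) x) < e.
Proof.
  intros He.
  assert (He' : 0 < e / (4 * M)) by (apply Rdiv_lt_0_compat; lra).
  destruct (generator_dense T HT A HA x _ He') as [y [z [Hyz Hy]]].
  apply (proj2 (Rlt_div_r _ _ (4 * M) ltac:(lra))) in Hy.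
  assert (Hz : 0 <= 4 * M * norm z / e).
  { apply Rdiv_le_0_compat; [| exact He].
    apply Rmult_le_pos; [lra | apply vnorm_ge0]. }
  exists (2 * (w + 1) + 1 + 4 * M * norm z / e); intros mu Hmu.
  assert (Hmu' : w + 1 < mu) by lra.
  apply Rle_lt_trans with (norm (opp (euler mu (minus y x))) +
    norm (plus (resolvent A mu z) (minus y x))).
  { apply vnorm_decomp; rewrite <- (euler_generator mu y z Hmu' Hyz).
    rewrite (rlin_minus _ (euler_rlinear mu Hmu')); modeq Y. }
  assert (H1 : norm (euler mu (minus y x)) <= 2 * (M * norm (minus y x))).
  { apply Rle_trans with (euler_factor mu * (M * norm (minus y x))).
    - apply orbit_bound_norm, euler_orbit_bound; [exact Hmu' |].
      apply orbit_bound_growth, Rle_refl.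
    - apply Rmult_le_compat_r; [apply Rmult_le_pos; [lra | apply vnorm_ge0] |].
      unfold euler_factor; replace 2 with (/ (1 - / 2)) by field.
      assert ((w + 1) / mu <= / 2) by (apply Rle_div_l; lra).
      apply Rinv_le_contravar; lra. }
  assert (H2 : norm (resolvent A mu z) <= e / 4).
  { apply Rle_trans with (M * norm z / (mu - w - 1)).
    - apply orbit_bound_norm, resolvent_orbit_bound; [exact Hmu' |].
      apply orbit_bound_growth, Rle_refl.
    - apply Rle_div_l; [lra |].
      apply Rle_trans with (e / 4 * (4 * M * norm z / e)); [right; field; lra |].
      apply Rmult_le_compat_l; lra. }
  assert (H3 : norm (minus y x) <= M * norm (minus y x)).
  { rewrite <- (Rmult_1_l (norm (minus y x))) at 1.
    apply Rmult_le_compat_r; [apply vnorm_ge0 | exact HM]. }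
  pose proof (vnorm_plus (resolvent A mu z) (minus y x)) as H4.
  pose proof (vnorm_opp (euler mu (minus y x))) as H5.
  apply Rle_lt_trans with (2 * (M * norm (minus y x)) + (e / 4 + norm (minus y x))); [| lra].
  apply Rplus_le_compat; [rewrite <- H5 in H1; exact H1 |].
  apply Rle_trans with (1 := H4); lra.
Qed.

(** With [E] for the Euler step and [s = n / mu], the induction uses [E ^ (n + 1) x - T (s + / mu) x
    = E (E ^ n x - T s x) + T s (E x - T (/ mu) x)]. As [E] commutes with [T], the one-step error
    enters at [x] alone and not along the orbit. *)
Lemma euler_error mu n x e :
  w + 1 < mu -> norm (minus (euler mu x) (T (/ mu) x)) <= e ->
  orbit_bound (INR n * (euler_factor mu ^ n * (M * e)))
    (minus (Nat.iter n (euler mu) x) (T (INR n * / mu) x)).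
Proof.
  intros Hmu He; destruct (euler_factor_ge mu Hmu) as [Hg1 Hg2].
  assert (Hmu0 : 0 < / mu) by (apply Rinv_0_lt_compat; lra).
  assert (He0 : 0 <= e) by (apply Rle_trans with (2 := He), vnorm_ge0).
  induction n as [| n IH].
  - simpl Nat.iter; simpl INR; rewrite !Rmult_0_l, (C0_zero T HT).
    replace (minus x x) with (rscal 0 x) by modeq Y.
    replace 0 with (0 * (M * norm x)) at 1 by ring.
    apply orbit_bound_rscal; [lra |]; apply orbit_bound_growth, Rle_refl.
  - rewrite S_INR.
    assert (Hs : 0 <= INR n * / mu) by (apply Rmult_le_pos; [apply pos_INR | lra]).
    apply (orbit_bound_le (euler_factor mu * (INR n * (euler_factor mu ^ n * (M * e))) +
                           M * e * exp (w * (INR n * / mu)))).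
    + assert (H : exp (w * (INR n * / mu)) <= euler_factor mu ^ S n).
      { replace (w * (INR n * / mu)) with (INR n * (w / mu)) by (field; lra).
        rewrite exp_INR_mult; apply Rle_trans with (euler_factor mu ^ n).
        - apply pow_incr; split; [left; apply exp_pos | exact Hg1].
        - apply Rle_pow; [exact Hg2 | lia]. }
      assert (H0 : 0 <= M * e) by (apply Rmult_le_pos; lra).
      apply (Rmult_le_compat_l (M * e)) in H; [| exact H0].
      simpl in H |- *; lra.
    + apply (orbit_bound_decomp _ _
        (euler mu (minus (Nat.iter n (euler mu) x) (T (INR n * / mu) x)))
        (T (INR n * / mu) (minus (euler mu x) (T (/ mu) x)))).
      * simpl Nat.iter; rewrite (rlin_minus _ (euler_rlinear mu Hmu)).
        rewrite (euler_semigroup mu) by assumption.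
        rewrite (rlin_minus _ (semigroup_rlinear T HT _ Hs)), <- (C0_plus T HT) by lra.
        replace (INR n * / mu + / mu) with ((INR n + 1) * / mu) by ring; modeq Y.
      * now apply euler_orbit_bound.
      * now apply orbit_bound_semigroup, orbit_bound_growth.
Qed.

(** On the domain one step errs by at most [2 * e' / mu], so the [n = mu * t] steps err by a
    constant times [e']. *)
Lemma exponential_formula_domain x z t e :
  A x z -> 0 < t -> 0 < e -> exists N, forall n, (N <= n)%nat ->
    norm (minus (Nat.iter n (euler (INR n / t)) x) (T t x)) <= e.
Proof.
  intros Hxz Ht He.
  pose (c := exp (2 * (w + 1) * t)).
  assert (Hc : 0 < c) by apply exp_pos.
  pose (e' := e / (2 * M * c * t)).
  assert (HMct : 0 < 2 * M * c * t) by (repeat apply Rmult_lt_0_compat; lra).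
  assert (He' : 0 < e') by now apply Rdiv_lt_0_compat.
  destruct (semigroup_right_continuous T HT z e' He') as [d [Hd Hd']].
  destruct (euler_limit z e' He') as [a Ha].
  destruct (INR_unbounded (t * (Rmax a (2 * (w + 1)) + 2 / d + 1))) as [N HN].
  exists N; intros n Hn; apply le_INR in Hn.
  assert (Hd2 : 0 < 2 / d) by (apply Rdiv_lt_0_compat; lra).
  pose proof (Rmax_l a (2 * (w + 1))) as Hm1; pose proof (Rmax_r a (2 * (w + 1))) as Hm2.
  assert (Hn0 : 0 < INR n).
  { apply Rlt_le_trans with (2 := Hn), Rlt_trans with (2 := HN).
    apply Rmult_lt_0_compat; lra. }
  set (mu := INR n / t).
  assert (Hmu : Rmax a (2 * (w + 1)) + 2 / d + 1 <= mu).
  { unfold mu; apply Rle_div_r; lra. }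
  assert (Hmu0 : 0 < / mu) by (apply Rinv_0_lt_compat; lra).
  assert (Hmud : / mu < d).
  { rewrite <- (Rinv_inv d); apply Rinv_0_lt_contravar; [now apply Rinv_0_lt_compat |].
    unfold Rdiv in *; generalize (Rinv_0_lt_compat d Hd); lra. }
  assert (Hmuw : w + 1 < mu) by lra.
  (* The Euler step and the exact flow both differ from [x + z / mu] by at most [e' / mu]. *)
  assert (Herr : norm (minus (euler mu x) (T (/ mu) x)) <= 2 * e' * / mu).
  { apply Rle_trans with (norm (rscal (/ mu) (minus (euler mu z) z)) +
      norm (opp (minus (minus (T (/ mu) x) x) (rscal (/ mu) z)))).
    - apply vnorm_decomp.
      replace (rscal (/ mu) (minus (euler mu z) z)) with
        (minus (resolvent A mu z) (rscal (/ mu) z)) by (unfold euler; modfield Y).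
      rewrite <- (euler_generator mu x z Hmuw Hxz); modeq Y.
    - rewrite vnorm_rscal_pos by lra.
      assert (H1 : norm (minus (euler mu z) z) < e') by (apply Ha; lra).
      assert (H2 : norm (minus (minus (T (/ mu) x) x) (rscal (/ mu) z)) <= e' * / mu).
      { apply (orbit_increment T HT A HA); [exact Hxz | lra |]; intros s Hs.
        left; apply Hd'; lra. }
      rewrite <- vnorm_opp in H2; apply (Rmult_lt_compat_l (/ mu)) in H1; [| exact Hmu0].
      apply Rle_trans with (/ mu * e' + e' * / mu); [| right; ring].
      apply Rplus_le_compat; [left; exact H1 | exact H2]. }
  assert (Hnmu : INR n * / mu = t) by (unfold mu; field; lra).
  pose proof (euler_error mu n x _ Hmuw Herr) as H.
  rewrite Hnmu in H; apply orbit_bound_norm in H.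
  apply Rle_trans with (1 := H).
  assert (Hg : euler_factor mu ^ n <= c).
  { apply euler_factor_pow; [exact Ht | apply INR_lt; simpl; lra | fold mu; lra]. }
  replace (INR n * (euler_factor mu ^ n * (M * (2 * e' * / mu)))) with
    (euler_factor mu ^ n * (2 * M * e' * (INR n * / mu))) by ring.
  rewrite Hnmu; apply Rle_trans with (c * (2 * M * e' * t)).
  - apply Rmult_le_compat_r; [| exact Hg].
    left; repeat (apply Rmult_lt_0_compat; [| lra]); lra.
  - right; unfold e'; field; lra.
Qed.

(** Density of the domain, with the bounds on the Euler powers and on [T t] that are uniform in
    [n]. *)
Lemma exponential_formula x t e :
  0 < t -> 0 < e -> exists N, forall n, (N <= n)%nat ->
    norm (minus (Nat.iter n (euler (INR n / t)) x) (T t x)) <= e.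
Proof.
  intros Ht He.
  pose (c := exp (2 * (w + 1) * t)).
  assert (Hc : 0 < c) by apply exp_pos.
  pose (c' := exp (w * t)).
  assert (Hc' : 0 < c') by apply exp_pos.
  assert (HMc : 0 < M * c) by (apply Rmult_lt_0_compat; lra).
  assert (HMc' : 0 < M * c') by (apply Rmult_lt_0_compat; lra).
  pose (e' := e / 2 / (M * c + M * c')).
  assert (He' : 0 < e') by (apply Rdiv_lt_0_compat; lra).
  destruct (generator_dense T HT A HA x _ He') as [y [z [Hyz Hy]]].
  destruct (exponential_formula_domain y z t (e / 2) Hyz Ht ltac:(lra)) as [N1 HN1].
  destruct (INR_unbounded (t * (2 * (w + 1)))) as [N2 HN2].
  exists (N1 + N2)%nat; intros n Hn.
  specialize (HN1 n ltac:(lia)).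
  assert (Hn2 : INR N2 <= INR n) by (apply le_INR; lia).
  assert (Hn0 : 0 < INR n).
  { apply Rlt_le_trans with (2 := Hn2), Rlt_trans with (2 := HN2).
    apply Rmult_lt_0_compat; lra. }
  set (mu := INR n / t) in *.
  assert (Hmu : 2 * (w + 1) < mu) by (unfold mu; apply (proj1 (Rlt_div_r _ _ t Ht)); lra).
  assert (Hmuw : w + 1 < mu) by lra.
  assert (Hg : euler_factor mu ^ n <= c).
  { apply euler_factor_pow; [exact Ht | apply INR_lt; simpl; lra | fold mu; lra]. }
  assert (H1 : norm (Nat.iter n (euler mu) (minus x y)) <= M * c * e').
  { apply Rle_trans with (euler_factor mu ^ n * (M * e')).
    - apply orbit_bound_norm, euler_iter_orbit_bound; [exact Hmuw |].
      apply orbit_bound_growth; rewrite vnorm_sym; lra.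
    - replace (M * c * e') with (c * (M * e')) by ring.
      apply Rmult_le_compat_r; [apply Rmult_le_pos; lra | exact Hg]. }
  assert (H2 : norm (T t (minus y x)) <= M * c' * e').
  { apply Rle_trans with (1 := Hgrowth t (minus y x) ltac:(lra)).
    apply Rmult_le_compat_l; unfold c' in *; lra. }
  apply Rle_trans with (norm (Nat.iter n (euler mu) (minus x y)) +
    norm (plus (minus (Nat.iter n (euler mu) y) (T t y)) (T t (minus y x)))).
  - apply vnorm_decomp; rewrite (euler_iter_minus mu) by exact Hmuw.
    rewrite (rlin_minus _ (semigroup_rlinear T HT t ltac:(lra))); modeq Y.
  - pose proof (vnorm_plus (minus (Nat.iter n (euler mu) y) (T t y)) (T t (minus y x))) as H3.
    assert (Heq : M * c * e' + M * c' * e' = e / 2) by (unfold e'; field; lra).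
    apply Rle_trans with (M * c * e' + (e / 2 + M * c' * e')); [| lra].
    apply Rplus_le_compat; [exact H1 |]; apply Rle_trans with (1 := H3).
    apply Rplus_le_compat; [exact HN1 | exact H2].
Qed.

End Resolvent.

(** The Yosida difference is [mu] times the difference of the Euler steps, so each step contributes
    [eta / mu = eta * t / n]. *)
Lemma semigroup_distance {k : scalar_field} {Y : CompleteNormedModule (scalars k)}
  (A0 A1 : operator Y) (T0 T1 : R -> Y -> Y) (M w eta a : R) :
  generates A0 T0 -> generates A1 T1 -> 1 <= M -> 0 <= w ->
  growth T0 M w -> growth T1 M w -> 0 <= eta ->
  (forall mu x, a <= mu -> norm (minus (yosida A0 mu x) (yosida A1 mu x)) <= eta * norm x) ->
  forall t x, 0 <= t ->
    norm (minus (T0 t x) (T1 t x)) <= eta * (M ^ 2 * (t * exp (2 * (w + 1) * t))) * norm x.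
Proof.
  intros [HT0 HA0] [HT1 HA1] HM Hw Hg0 Hg1 Heta Hy t x [Ht | <-].
  2: { rewrite (C0_zero T0 HT0), (C0_zero T1 HT1), vnorm_self; right; ring. }
  apply le_epsilon; intros e He.
  destruct (exponential_formula A0 T0 M w HT0 HA0 HM Hw Hg0 x t (e / 2) Ht ltac:(lra)) as [N0 HN0].
  destruct (exponential_formula A1 T1 M w HT1 HA1 HM Hw Hg1 x t (e / 2) Ht ltac:(lra)) as [N1 HN1].
  destruct (INR_unbounded (t * Rmax a (2 * (w + 1)))) as [N2 HN2].
  pose (n := (N0 + N1 + N2)%nat).
  specialize (HN0 n ltac:(lia)); specialize (HN1 n ltac:(lia)).
  assert (Hn2 : INR N2 <= INR n) by (apply le_INR; lia).
  pose proof (Rmax_l a (2 * (w + 1))) as Hm1; pose proof (Rmax_r a (2 * (w + 1))) as Hm2.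
  assert (Hn0 : 0 < INR n).
  { apply Rlt_le_trans with (2 := Hn2), Rlt_trans with (2 := HN2).
    apply Rmult_lt_0_compat; lra. }
  set (mu := INR n / t) in *.
  assert (Hmu : Rmax a (2 * (w + 1)) < mu) by (unfold mu; apply (proj1 (Rlt_div_r _ _ t Ht)); lra).
  assert (Hmuw : w + 1 < mu) by lra.
  destruct (euler_factor_ge w Hw mu Hmuw) as [_ Hg].
  assert (Hstep : forall y, norm (minus (euler A0 mu y) (euler A1 mu y)) <= eta / mu * norm y).
  { intros y; specialize (Hy mu y ltac:(lra)); unfold euler.
    unfold yosida in Hy.
    vset (rscal (/ mu) (minus
      (minus (rscal (mu ^ 2) (resolvent A0 mu y)) (rscal mu y))
      (minus (rscal (mu ^ 2) (resolvent A1 mu y)) (rscal mu y)))).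
    rewrite vnorm_rscal_pos by (left; apply Rinv_0_lt_compat; lra).
    replace (eta / mu * norm y) with (/ mu * (eta * norm y)) by (unfold Rdiv; ring).
    apply Rmult_le_compat_l; [left; apply Rinv_0_lt_compat; lra | exact Hy]. }
  (* Powers of the first step are controlled in the equivalent norm of [T0], powers of the second in
     that of [T1]. Each telescoping term enters both norms once, which gives [M ^ 2] for every
     [j]. *)
  assert (Hiter : forall j, orbit_bound T0 w
    (INR j * (euler_factor w mu ^ j * (M ^ 2 * (eta / mu) * norm x)))
    (minus (Nat.iter j (euler A0 mu) x) (Nat.iter j (euler A1 mu) x))).
  { induction j as [| j IH].
    - simpl Nat.iter; simpl INR; rewrite !Rmult_0_l.
      replace (minus x x) with (rscal 0 x) by modeq Y.
      replace 0 with (0 * (M * norm x)) at 1 by ring.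
      apply orbit_bound_rscal; [exact HT0 | lra |].
      apply orbit_bound_growth; [exact HM | exact Hg0 | apply Rle_refl].
    - rewrite S_INR.
      assert (Hemu : 0 <= eta / mu) by (apply Rdiv_le_0_compat; lra).
      apply (orbit_bound_le T0 w (euler_factor w mu *
          (INR j * (euler_factor w mu ^ j * (M ^ 2 * (eta / mu) * norm x))) +
        M * (eta / mu * (euler_factor w mu ^ j * (M * norm x))))).
      + assert (0 <= M ^ 2 * (eta / mu) * norm x).
        { apply Rmult_le_pos; [| apply vnorm_ge0].
          apply Rmult_le_pos; [apply pow_le; lra | exact Hemu]. }
        assert (euler_factor w mu ^ j <= euler_factor w mu ^ S j) by (apply Rle_pow; [exact Hg | lia]).
        apply Rle_trans with (INR j * (euler_factor w mu ^ S j * (M ^ 2 * (eta / mu) * norm x)) +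
          euler_factor w mu ^ j * (M ^ 2 * (eta / mu) * norm x)); [right; simpl; ring |].
        rewrite Rmult_plus_distr_r, Rmult_1_l.
        apply Rplus_le_compat_l, Rmult_le_compat_r; assumption.
      + apply (orbit_bound_decomp T0 w HT0 _ _
          (euler A0 mu (minus (Nat.iter j (euler A0 mu) x) (Nat.iter j (euler A1 mu) x)))
          (minus (euler A0 mu (Nat.iter j (euler A1 mu) x)) (euler A1 mu (Nat.iter j (euler A1 mu) x)))).
        * simpl Nat.iter.
          rewrite (rlin_minus _ (euler_rlinear A0 T0 M w HT0 HA0 HM Hw Hg0 mu Hmuw)); modeq Y.
        * exact (euler_orbit_bound A0 T0 M w HT0 HA0 HM Hw Hg0 mu _ _ Hmuw IH).
        * apply orbit_bound_growth; [exact HM | exact Hg0 |].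
          apply Rle_trans with (1 := Hstep _), Rmult_le_compat_l; [exact Hemu |].
          apply (orbit_bound_norm T1 w HT1).
          apply (euler_iter_orbit_bound A1 T1 M w HT1 HA1 HM Hw Hg1 mu _ _ _ Hmuw).
          apply orbit_bound_growth; [exact HM | exact Hg1 | apply Rle_refl]. }
  pose proof (orbit_bound_norm T0 w HT0 _ _ (Hiter n)) as H.
  assert (Hfac : euler_factor w mu ^ n <= exp (2 * (w + 1) * t)).
  { apply euler_factor_pow; [exact Hw | exact Ht | apply INR_lt; simpl; lra | fold mu; lra]. }
  assert (H' : INR n * (euler_factor w mu ^ n * (M ^ 2 * (eta / mu) * norm x)) <=
    eta * (M ^ 2 * (t * exp (2 * (w + 1) * t))) * norm x).
  { replace (INR n * (euler_factor w mu ^ n * (M ^ 2 * (eta / mu) * norm x))) with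
      (euler_factor w mu ^ n * (eta * (M ^ 2 * (INR n / mu)) * norm x)) by (field; lra).
    replace (INR n / mu) with t by (unfold mu; field; lra).
    replace (eta * (M ^ 2 * (t * exp (2 * (w + 1) * t))) * norm x) with
      (exp (2 * (w + 1) * t) * (eta * (M ^ 2 * t) * norm x)) by ring.
    apply Rmult_le_compat_r; [| exact Hfac].
    apply Rmult_le_pos; [| apply vnorm_ge0].
    apply Rmult_le_pos; [exact Heta |].
    apply Rmult_le_pos; [apply pow_le |]; lra. }
  apply Rle_trans with (1 := norm_minus_triangle (Nat.iter n (euler A0 mu) x) _ _).
  rewrite vnorm_sym in HN0.
  pose proof (norm_minus_triangle (Nat.iter n (euler A1 mu) x) (Nat.iter n (euler A0 mu) x) (T1 t x)).
  lra.
Qed.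

(** * The delay equation *)

Section Histories.

Context {k : scalar_field} {X : CompleteNormedModule (scalars k)}.
Implicit Types u v : R -> X.
Implicit Types f g : CI X.

Definition path u : Prop := forall t, continuous u t.

(** A junk value if [u] is not a path. *)
Definition hist u (t : R) : CI X :=
  epsilon (inhabits (CI_zero : CI X)) (fun f => forall theta, f theta = u (t + clamp theta)).

Lemma clamp_clamp t : clamp (clamp t) = clamp t.
Proof. apply clamp_id, clamp_in. Qed.

Lemma path_comp_lipschitz u (s : R -> R) :
  path u -> (forall r t, Rabs (s r - s t) <= Rabs (r - t)) -> path (fun t => u (s t)).
Proof.
  intros Hu Hs t; apply (continuous_eps (Y := X)); intros e He.
  destruct (proj1 (continuous_eps (Y := X) _ _) (Hu (s t)) e He) as [d [Hd1 Hd2]].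
  exists d; split; [exact Hd1 |]; intros r Hr; apply Hd2.
  apply Rle_lt_trans with (1 := Hs r t); exact Hr.
Qed.

Lemma hist_val u t theta : path u -> hist u t theta = u (t + clamp theta).
Proof.
  intros Hu; revert theta; unfold hist.
  apply (epsilon_spec (inhabits (CI_zero : CI X))
    (fun f => forall theta, f theta = u (t + clamp theta))).
  assert (Hc : path (fun theta => u (t + clamp theta))).
  { apply (path_comp_lipschitz u (fun theta => t + clamp theta) Hu); intros r s.
    replace (t + clamp r - (t + clamp s)) with (clamp r - clamp s) by ring; apply clamp_lipschitz. }
  exists (mkCI (fun theta => u (t + clamp theta)) Hc
    (fun theta => f_equal (fun r => u (t + r)) (clamp_clamp theta))).
  reflexivity.
Qed.

Lemma CI_norm_point f t : norm (f t) <= norm f.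
Proof. exact (CI_norm_ub f t). Qed.

Lemma CI_norm_bound f C : (forall t, -1 <= t <= 0 -> norm (f t) <= C) -> norm f <= C.
Proof. exact (CI_norm_le f C). Qed.

Lemma hist_norm u t C :
  path u -> (forall s, t - 1 <= s <= t -> norm (u s) <= C) -> norm (hist u t) <= C.
Proof.
  intros Hu H; apply CI_norm_bound; intros theta Htheta.
  rewrite hist_val by exact Hu; apply H; generalize (clamp_in theta); lra.
Qed.

Lemma hist_ext u v s t :
  path u -> path v -> (forall r, -1 <= r <= 0 -> u (s + r) = v (t + r)) -> hist u s = hist v t.
Proof.
  intros Hu Hv H; apply CI_ext; intros theta Htheta.
  rewrite !hist_val by assumption; apply H, clamp_in.
Qed.

Lemma path_minus u v : path u -> path v -> path (fun t => minus (u t) (v t)).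
Proof. intros Hu Hv t; exact (vlim_minus (Y := X) (locally t) u v _ _ (Hu t) (Hv t)). Qed.

Lemma path_plus u v : path u -> path v -> path (fun t => plus (u t) (v t)).
Proof. intros Hu Hv t; exact (vlim_plus (Y := X) (locally t) u v _ _ (Hu t) (Hv t)). Qed.

Lemma hist_minus u v t :
  path u -> path v -> hist (fun t => minus (u t) (v t)) t = minus (hist u t) (hist v t).
Proof.
  intros Hu Hv; apply CI_ext; intros theta _.
  rewrite (hist_val _ t theta (path_minus u v Hu Hv)).
  change (minus (u (t + clamp theta)) (v (t + clamp theta)) =
          minus (hist u t theta) (hist v t theta)).
  now rewrite !hist_val.
Qed.

Lemma hist_continuous u t : path u -> continuous (fun t => hist u t) t.
Proof.
  intros Hu; apply (continuous_eps (Y := CI_CompleteNormedModule (X := X))); intros e He.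
  destruct (uniformly_continuous_eps u (t - 2) (t + 1) (e / 2) Hu) as [d [Hd1 Hd2]]; [lra |].
  exists (Rmin d 1); split; [apply Rmin_glb_lt; lra |]; intros s Hs.
  pose proof (Rmin_l d 1); pose proof (Rmin_r d 1).
  apply Rle_lt_trans with (e / 2); [| lra].
  apply CI_norm_bound; intros theta Htheta.
  change (norm (minus (hist u s theta) (hist u t theta)) <= e / 2).
  rewrite !hist_val by exact Hu; left.
  pose proof (clamp_in theta); assert (Hs1 : Rabs (s - t) < 1) by lra.
  apply Rabs_def2 in Hs1; apply Hd2; [lra | lra |].
  replace (s + clamp theta - (t + clamp theta)) with (s - t) by ring; lra.
Qed.

Lemma rlinear_scal (c : scalars k) : rlinear (fun x : X => scal c x).
Proof.
  split.
  - intros x y; exact (scal_distr_l (V := X) c x y).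
  - intros r x; exact (scal_rscal (Y := X) c r x).
  - exists (abs c); split; [apply abs_ge_0 |]; intros x; exact (norm_scal (V := X) c x).
Qed.

End Histories.

(** In the norm weighted by [exp (lam * a)], convolution with a semigroup of growth [w] gains a
    factor [/ (lam - w)]; a large [lam] therefore makes it a contraction. *)
Lemma integral_norm_exp {k : scalar_field} {X : CompleteNormedModule (scalars k)}
  (g : R -> X) (C a w lam : R) :
  (forall t, continuous g t) -> 0 <= a -> 0 <= C -> w < lam ->
  (forall s, 0 <= s <= a -> norm (g s) <= C * exp (w * s) * exp (lam * (a - s))) ->
  norm (integral g 0 a) <= C / (lam - w) * exp (lam * a).
Proof.
  intros Hg Ha HC Hw H.
  pose proof (is_RInt_exp_scaled (w - lam) 0 a ltac:(lra)) as HI.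
  apply (is_RInt_scal (V := R_NormedModule) (fun s => exp ((w - lam) * s)) 0 a (C * exp (lam * a))) in HI.
  apply Rle_trans with (C * exp (lam * a) * ((exp ((w - lam) * a) - exp ((w - lam) * 0)) / (w - lam))).
  - refine (integral_norm g _ 0 a _ Hg Ha _ HI); intros s Hs.
    apply Rle_trans with (1 := H s Hs); right.
    change (C * exp (w * s) * exp (lam * (a - s)) = C * exp (lam * a) * exp ((w - lam) * s)).
    rewrite !Rmult_assoc, <- !exp_plus; do 2 f_equal; ring.
  - rewrite Rmult_0_r, exp_0.
    replace (C * exp (lam * a) * ((exp ((w - lam) * a) - 1) / (w - lam))) with
      (C / (lam - w) * exp (lam * a) * (1 - exp ((w - lam) * a))) by (field; lra).
    rewrite <- (Rmult_1_r (C / (lam - w) * exp (lam * a))) at 2.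
    apply Rmult_le_compat_l.
    + apply Rmult_le_pos; [apply Rdiv_le_0_compat; lra | left; apply exp_pos].
    + generalize (exp_pos ((w - lam) * a)); lra.
Qed.

(** * Convolution with a semigroup *)

Section Convolution.

Context {k : scalar_field} {X : CompleteNormedModule (scalars k)}.
Variable T : R -> X -> X.
Hypothesis HT : C0_semigroup T.
Implicit Types F : R -> X.

(** The integral of [T (a - s) (F s)] over [0, a], reflected so that only the
    argument of [F] depends on [a]. *)
Definition convolution F (a : R) : X :=
  integral (fun s => T (Rmax 0 s) (F (a - s))) 0 a.

Lemma convolution_integrand_continuous F a t :
  path F -> continuous (fun s => T (Rmax 0 s) (F (a - s))) t.
Proof.
  intros HF; apply (semigroup_jointly_continuous T HT (fun s => s) (fun s => F (a - s))).
  - intros s; apply Rle_refl.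
  - apply (path_comp_lipschitz F (fun s => a - s) HF); intros r s.
    replace (a - r - (a - s)) with (- (r - s)) by ring; rewrite Rabs_Ropp; apply Rle_refl.
Qed.

(** From [a] to [a'] the integrand on [[0, a]] changes through the argument of [F], by uniform
    continuity, and a bounded integrand is added on [[a, a']]. *)
Lemma convolution_continuous F : path F -> path (fun t => convolution F (Rmax 0 t)).
Proof.
  intros HF t; set (b := Rmax 0 t + 1).
  pose proof (Rmax_l 0 t) as Ht0.
  destruct (semigroup_locally_bounded T HT b) as [K [HK HTK]].
  destruct (bounded_on_interval F 0 b HF) as [L [HL HFL]].
  assert (Hmain : forall e, 0 < e -> exists d, 0 < d /\ forall a a',
    0 <= a <= a' -> a' <= b -> a' - a < d ->
    norm (minus (convolution F a') (convolution F a)) < e).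
  { intros e He.
    assert (He1 : 0 < e / 2 / (b * K + 1)).
    { apply Rdiv_lt_0_compat; [lra |]; generalize (Rmult_le_pos b K ltac:(unfold b; lra) HK); lra. }
    destruct (uniformly_continuous_eps F 0 b _ HF He1) as [d [Hd1 Hd2]].
    assert (HKL : 0 <= K * L) by (apply Rmult_le_pos; assumption).
    assert (He2 : 0 < e / 2 / (K * L + 1)) by (apply Rdiv_lt_0_compat; lra).
    exists (Rmin d (e / 2 / (K * L + 1))); split; [now apply Rmin_glb_lt |].
    intros a a' Ha Ha' Haa.
    pose proof (Rmin_l d (e / 2 / (K * L + 1))); pose proof (Rmin_r d (e / 2 / (K * L + 1))).
    assert (H1 : norm (integral (fun s => minus (T (Rmax 0 s) (F (a' - s))) (T (Rmax 0 s) (F (a - s)))) 0 a)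
                 <= (a - 0) * (K * (e / 2 / (b * K + 1)))).
    { apply integral_norm_const; [| lra |].
      - intros s; apply (path_minus (fun s => T (Rmax 0 s) (F (a' - s))) (fun s => T (Rmax 0 s) (F (a - s))));
          intros r; now apply convolution_integrand_continuous.
      - intros s Hs; rewrite <- (rlin_minus _ (semigroup_rlinear T HT _ (Rmax_l 0 s))).
        rewrite Rmax_right by lra; apply Rle_trans with (1 := HTK s _ ltac:(lra)).
        apply Rmult_le_compat_l; [exact HK |]; left; apply Hd2; [lra | lra |].
        replace (a' - s - (a - s)) with (a' - a) by ring; rewrite Rabs_pos_eq; lra. }
    assert (H2 : norm (integral (fun s => T (Rmax 0 s) (F (a' - s))) a a') <= (a' - a) * (K * L)).
    { apply integral_norm_const; [| lra |].
      - intros s; now apply convolution_integrand_continuous.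
      - intros s Hs; rewrite Rmax_right by lra; apply Rle_trans with (1 := HTK s _ ltac:(lra)).
        apply Rmult_le_compat_l; [exact HK |]; apply HFL; lra. }
    rewrite integral_minus in H1 by (intros; now apply convolution_integrand_continuous).
    apply Rle_lt_trans with ((a - 0) * (K * (e / 2 / (b * K + 1))) + (a' - a) * (K * L)).
    - apply Rle_trans with (2 := Rplus_le_compat _ _ _ _ H1 H2).
      apply vnorm_decomp; unfold convolution.
      rewrite <- (integral_Chasles (fun s => T (Rmax 0 s) (F (a' - s))) 0 a a')
        by (intros; now apply convolution_integrand_continuous).
      modeq X.
    - assert (HbK : 0 <= b * K) by (apply Rmult_le_pos; [unfold b; lra | exact HK]).
      assert (B1 : (a - 0) * (K * (e / 2 / (b * K + 1))) <= e / 2).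
      { replace (e / 2) with (e / 2 / (b * K + 1) * (b * K + 1)) at 2 by (field; lra).
        replace ((a - 0) * (K * (e / 2 / (b * K + 1)))) with
          (e / 2 / (b * K + 1) * (a * K)) by ring.
        apply Rmult_le_compat_l; [lra |].
        assert (a * K <= b * K) by (apply Rmult_le_compat_r; lra); lra. }
      assert (B2 : (a' - a) * (K * L) < e / 2).
      { replace (e / 2) with (e / 2 / (K * L + 1) * (K * L + 1)) by (field; lra).
        apply Rle_lt_trans with (e / 2 / (K * L + 1) * (K * L)).
        - apply Rmult_le_compat_r; lra.
        - apply Rmult_lt_compat_l; lra. }
      lra. }
  apply (continuous_eps (Y := X)); intros e He.
  destruct (Hmain e He) as [d [Hd1 Hd2]].
  exists (Rmin d 1); split; [apply Rmin_glb_lt; lra |]; intros s Hs.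
  pose proof (Rmin_l d 1); pose proof (Rmin_r d 1).
  pose proof (Rmax_0_lipschitz s t) as Hl; pose proof (Rmax_l 0 s) as Hs0.
  unfold b in *; destruct (Rle_lt_dec (Rmax 0 t) (Rmax 0 s)) as [Hts | Hts].
  - rewrite Rabs_pos_eq in Hl by lra; apply Hd2; lra.
  - rewrite Rabs_left in Hl by lra; rewrite vnorm_sym; apply Hd2; lra.
Qed.

(** The reflected integral is split at [r]: on [[0, r]] it sees [F] after time [a], and from the
    part on [[r, a + r]] a factor [T r] comes out. The semigroup law of the delay equation rests on
    this identity. *)
Lemma convolution_shift F a r :
  path F -> 0 <= a -> 0 <= r ->
  convolution F (a + r) = plus (convolution (fun s => F (a + s)) r) (T r (convolution F a)).
Proof.
  intros HF Ha Hr; unfold convolution.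
  rewrite <- (integral_Chasles _ 0 r (a + r)) by (intros; now apply convolution_integrand_continuous).
  f_equal.
  - apply integral_ext; [exact Hr |]; intros s Hs.
    now replace (a + r - s) with (a + (r - s)) by ring.
  - rewrite <- (integral_rlinear (T r)) by
      (try apply semigroup_rlinear; try (intros; now apply convolution_integrand_continuous); assumption).
    pose proof (integral_shift (fun s => T (Rmax 0 s) (F (a + r - s))) 0 a r
      (fun t => convolution_integrand_continuous F (a + r) t HF)) as H.
    rewrite Rplus_0_l in H; rewrite <- H.
    apply integral_ext; [exact Ha |]; intros s Hs.
    rewrite !Rmax_right, <- (C0_plus T HT), (Rplus_comm s r) by lra.
    now replace (a + r - (r + s)) with (a - s) by ring.
Qed.

Lemma convolution_increment F e :
  path F -> 0 < e -> exists d, 0 < d /\ forall h, 0 <= h < d ->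
    norm (minus (convolution F h) (rscal h (F 0))) <= e * h.
Proof.
  intros HF He.
  destruct (semigroup_locally_bounded T HT 1) as [K [HK HTK]].
  assert (He1 : 0 < e / 2 / (K + 1)) by (apply Rdiv_lt_0_compat; lra).
  destruct (proj1 (continuous_eps F 0) (HF 0) _ He1) as [d1 [Hd1 Hd1']].
  destruct (semigroup_right_continuous T HT (F 0) (e / 2)) as [d2 [Hd2 Hd2']]; [lra |].
  exists (Rmin 1 (Rmin d1 d2)); split; [repeat apply Rmin_glb_lt; lra |]; intros h Hh.
  pose proof (Rmin_l 1 (Rmin d1 d2)); pose proof (Rmin_r 1 (Rmin d1 d2)).
  pose proof (Rmin_l d1 d2); pose proof (Rmin_r d1 d2).
  replace (e * h) with ((h - 0) * e) by ring.
  replace (rscal h (F 0)) with (rscal (h - 0) (F 0)) by modeq X.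
  apply integral_norm_near; [intros; now apply convolution_integrand_continuous | lra |].
  intros s Hs; rewrite Rmax_right by lra.
  apply Rle_trans with (1 := norm_minus_triangle (T s (F 0)) _ _).
  rewrite <- (rlin_minus _ (semigroup_rlinear T HT s ltac:(lra))).
  specialize (Hd2' s ltac:(lra)).
  specialize (Hd1' (h - s) ltac:(rewrite Rminus_0_r, Rabs_pos_eq; lra)).
  pose proof (HTK s (minus (F (h - s)) (F 0)) ltac:(lra)) as H3.
  apply (proj2 (Rlt_div_r _ _ (K + 1) ltac:(lra))) in Hd1'.
  pose proof (vnorm_ge0 (minus (F (h - s)) (F 0))); nra.
Qed.

End Convolution.

(** * Mild solutions, the solution semigroup and its generator *)

Section DelayEquation.

Context {k : scalar_field} {X : CompleteNormedModule (scalars k)}.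
Variables (T : R -> X -> X) (B : CI X -> X) (M w b : R).
Hypotheses (HT : C0_semigroup T) (HM : 1 <= M) (Hw : 0 <= w) (Hgrowth : growth T M w).
Hypotheses (HB : is_linear B) (Hb : 0 <= b) (HBb : forall f, norm (B f) <= b * norm f).
Implicit Types u v : R -> X.
Implicit Types f g phi psi : CI X.

(** Chosen so that [M * b / (delay_rate - w)], the Lipschitz constant of [delay_map] in the weighted
    norm, is at most [/ 2]. *)
Definition delay_rate : R := w + 2 * M * b + 1.

Definition delay_weight (t : R) : R := exp (delay_rate * Rmax 0 t).

Lemma delay_rate_ge : w + 1 <= delay_rate.
Proof. unfold delay_rate; assert (0 <= M * b) by (apply Rmult_le_pos; lra); lra. Qed.

Lemma delay_weight_pos t : 0 < delay_weight t.
Proof. apply exp_pos. Qed.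

Lemma delay_weight_le s t : Rmax 0 s <= Rmax 0 t -> delay_weight s <= delay_weight t.
Proof. intros H; apply exp_le, Rmult_le_compat_l; [generalize delay_rate_ge; lra | exact H]. Qed.

Lemma delay_weight_ge1 t : 1 <= delay_weight t.
Proof.
  rewrite <- exp_0; apply exp_le, Rmult_le_pos; [generalize delay_rate_ge; lra | apply Rmax_l].
Qed.

Lemma B_rlinear : rlinear (Y := CI_CompleteNormedModule (X := X)) B.
Proof. apply (is_linear_rlinear (Y := CI_CompleteNormedModule (X := X))), HB. Qed.

Definition forcing u (t : R) : X := B (hist u t).

Lemma forcing_path u : path u -> path (forcing u).
Proof.
  intros Hu t; apply (rlin_continuous (Y := CI_CompleteNormedModule (X := X)) B B_rlinear).
  now apply hist_continuous.
Qed.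

(** A single formula for [phi t] at [t <= 0] and [T t (phi 0)] at [t >= 0], using that [phi] is
    extended by [phi 0] to the right; continuity across 0 is then immediate. *)
Definition free_motion phi (t : R) : X :=
  plus (phi t) (minus (T (Rmax 0 t) (phi 0)) (phi 0)).

(** The variation of constants formula: the continuous fixed points are the mild solutions with
    initial history [phi]. *)
Definition delay_map phi u (t : R) : X :=
  plus (free_motion phi t) (convolution T (forcing u) (Rmax 0 t)).

Lemma free_motion_neg phi t : t <= 0 -> free_motion phi t = phi t.
Proof.
  intros Ht; unfold free_motion; rewrite Rmax_left, (C0_zero T HT) by exact Ht; modeq X.
Qed.

Lemma CI_pos phi t : 0 <= t -> phi t = phi 0.
Proof.
  intros Ht; rewrite <- (CI_clamp phi t), <- (CI_clamp phi 0); f_equal.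
  unfold clamp; rewrite !Rmin_right by lra; reflexivity.
Qed.

Lemma free_motion_pos phi t : 0 <= t -> free_motion phi t = T t (phi 0).
Proof.
  intros Ht; unfold free_motion; rewrite Rmax_right, (CI_pos phi t) by exact Ht; modeq X.
Qed.

Lemma free_motion_path phi : path (free_motion phi).
Proof.
  apply (path_plus phi); [exact (CI_cont phi) |].
  apply (path_minus (fun t => T (Rmax 0 t) (phi 0)) (fun _ => phi 0)).
  - intros t; now apply orbit_continuous.
  - intros t; apply continuous_const.
Qed.

Lemma delay_map_path phi u : path u -> path (delay_map phi u).
Proof.
  intros Hu; apply path_plus; [apply free_motion_path |].
  now apply convolution_continuous, forcing_path.
Qed.

Lemma free_motion_norm phi t : norm (free_motion phi t) <= M * norm phi * delay_weight t.
Proof.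
  assert (Hphi : 0 <= norm phi) by exact (vnorm_ge0 (Y := CI_CompleteNormedModule (X := X)) phi).
  assert (HMphi : 0 <= M * norm phi) by (apply Rmult_le_pos; [lra | exact Hphi]).
  destruct (Rle_lt_dec t 0) as [Ht | Ht].
  - rewrite free_motion_neg by exact Ht; apply Rle_trans with (1 := CI_norm_point phi t).
    apply Rle_trans with (M * norm phi * 1).
    + rewrite Rmult_1_r; rewrite <- (Rmult_1_l (norm phi)) at 1.
      apply Rmult_le_compat_r; [exact Hphi | exact HM].
    + apply Rmult_le_compat_l; [exact HMphi | apply delay_weight_ge1].
  - rewrite free_motion_pos by lra; apply Rle_trans with (1 := Hgrowth t (phi 0) ltac:(lra)).
    apply Rle_trans with (M * exp (w * t) * norm phi).
    + apply Rmult_le_compat_l; [| apply CI_norm_point].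
      apply Rmult_le_pos; [lra | left; apply exp_pos].
    + replace (M * exp (w * t) * norm phi) with (M * norm phi * exp (w * t)) by ring.
      apply Rmult_le_compat_l; [exact HMphi |]; unfold delay_weight; rewrite Rmax_right by lra.
      apply exp_le, Rmult_le_compat_r; [lra | generalize delay_rate_ge; lra].
Qed.

Lemma hist_weight u C t :
  path u -> 0 <= C -> 0 <= t -> (forall s, norm (u s) <= C * delay_weight s) ->
  norm (hist u t) <= C * exp (delay_rate * t).
Proof.
  intros Hu HC Ht H; apply hist_norm; [exact Hu |]; intros s Hs.
  apply Rle_trans with (1 := H s), Rmult_le_compat_l; [exact HC |].
  replace (exp (delay_rate * t)) with (delay_weight t) by
    (unfold delay_weight; now rewrite Rmax_right).
  apply delay_weight_le, Rle_max_compat_l; lra.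
Qed.

Lemma close_ge0 C u v : wclose delay_weight C u v -> 0 <= C.
Proof.
  intros H; apply Rnot_lt_le; intros HC.
  generalize (H 0) (vnorm_ge0 (minus (u 0) (v 0))) (delay_weight_pos 0); nra.
Qed.

(** The weight is nondecreasing, so the history at time [t] is controlled by the weight at [t]
    itself; [integral_norm_exp] then gives the factor fixed by [delay_rate]. *)
Lemma delay_map_half_lipschitz phi : half_lipschitz delay_weight path (delay_map phi).
Proof.
  intros u v C Hu Hv Huv t; pose proof (close_ge0 C u v Huv) as HC.
  set (a := Rmax 0 t); assert (Ha : 0 <= a) by apply Rmax_l.
  pose (g s := minus (T (Rmax 0 s) (forcing u (a - s))) (T (Rmax 0 s) (forcing v (a - s)))).
  assert (Hg : path g).
  { apply (path_minus (fun s => T (Rmax 0 s) (forcing u (a - s)))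
      (fun s => T (Rmax 0 s) (forcing v (a - s))));
      intros s; apply convolution_integrand_continuous; auto using forcing_path. }
  pose proof delay_rate_ge as Hrate.
  assert (HI : norm (integral g 0 a) <= M * b * C / (delay_rate - w) * exp (delay_rate * a)).
  { apply integral_norm_exp; [exact Hg | exact Ha | | lra |].
    - apply Rmult_le_pos; [apply Rmult_le_pos |]; lra.
    - intros s Hs; unfold g.
      rewrite <- (rlin_minus _ (semigroup_rlinear T HT _ (Rmax_l 0 s))), Rmax_right by lra.
      apply Rle_trans with (1 := Hgrowth s _ (proj1 Hs)).
      assert (HBm : minus (forcing u (a - s)) (forcing v (a - s)) =
        B (hist (fun r => minus (u r) (v r)) (a - s))).
      { rewrite hist_minus by assumption; symmetry; apply (rlin_minus _ B_rlinear). }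
      rewrite HBm.
      apply Rle_trans with (M * exp (w * s) * (b * (C * exp (delay_rate * (a - s))))).
      + apply Rmult_le_compat_l; [apply Rmult_le_pos; [lra | left; apply exp_pos] |].
        apply Rle_trans with (1 := HBb _), Rmult_le_compat_l; [exact Hb |].
        apply hist_weight; [now apply path_minus | exact HC | lra | exact Huv].
      + right; ring. }
  assert (Hfac : M * b * C / (delay_rate - w) <= C / 2).
  { apply Rle_div_l; [lra |]; unfold delay_rate; nra. }
  apply Rle_trans with (M * b * C / (delay_rate - w) * exp (delay_rate * a)).
  - apply Rle_trans with (2 := HI); right; f_equal; unfold g.
    rewrite integral_minus by (intros s; apply convolution_integrand_continuous; auto using forcing_path).
    unfold delay_map, convolution; fold a; modeq X.
  - apply Rmult_le_compat_r; [left; apply exp_pos | exact Hfac].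
Qed.

(** The weight is bounded on every left half-line, so convergence in the weighted norm is uniform
    near each [t]. *)
Lemma path_limit (un : nat -> R -> X) v D :
  (forall n, path (un n)) -> (forall n, wclose delay_weight (D * (/ 2) ^ n) (un n) v) -> path v.
Proof.
  intros Hun Hv t; apply (continuous_eps (Y := X)); intros e He.
  set (E := delay_weight (Rmax 0 t + 1)).
  assert (HE : 0 < E) by apply delay_weight_pos.
  assert (HD : 0 <= D).
  { pose proof (close_ge0 _ _ _ (Hv O)) as H; simpl in H; lra. }
  assert (He' : e / 3 / (D * E + 1) > 0).
  { apply Rdiv_lt_0_compat; [lra |]; assert (0 <= D * E) by (apply Rmult_le_pos; lra); lra. }
  destruct (pow_lt_1_zero (/ 2) ltac:(rewrite Rabs_pos_eq; lra) _ He') as [n Hn].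
  specialize (Hn n (le_n n)).
  assert (Hp : 0 < (/ 2) ^ n) by (apply pow_lt; lra).
  rewrite Rabs_pos_eq in Hn by lra.
  assert (HDE : 0 <= D * E) by (apply Rmult_le_pos; lra).
  apply (proj2 (Rlt_div_r _ _ (D * E + 1) ltac:(lra))) in Hn.
  assert (Hclose : forall s, s <= Rmax 0 t + 1 -> norm (minus (un n s) (v s)) < e / 3).
  { intros s Hs; apply Rle_lt_trans with (1 := Hv n s).
    apply Rle_lt_trans with (D * (/ 2) ^ n * E); [| nra].
    apply Rmult_le_compat_l; [apply Rmult_le_pos; lra |].
    apply delay_weight_le, Rle_max_compat_l, Hs. }
  destruct (proj1 (continuous_eps (Y := X) _ _) (Hun n t) (e / 3)) as [d [Hd1 Hd2]]; [lra |].
  exists (Rmin d 1); split; [apply Rmin_glb_lt; lra |]; intros s Hs.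
  pose proof (Rmin_l d 1); pose proof (Rmin_r d 1); pose proof (Rmax_r 0 t).
  assert (Hs1 : Rabs (s - t) < 1) by lra; apply Rabs_def2 in Hs1.
  pose proof (Hclose s ltac:(lra)) as H3; pose proof (Hclose t ltac:(lra)) as H4.
  specialize (Hd2 s ltac:(lra)); rewrite vnorm_sym in H3.
  apply Rle_lt_trans with (1 := norm_minus_triangle (un n s) _ _).
  pose proof (norm_minus_triangle (un n t) (un n s) (v t)); lra.
Qed.

Lemma convolution_zero_forcing u t :
  path u -> (forall s, u s = zero) -> convolution T (forcing u) t = zero.
Proof.
  intros Hu Hz; unfold convolution.
  assert (Hh : forall s, forcing u s = zero).
  { intros s; unfold forcing.
    replace (hist u s) with (zero : CI X); [apply (rlin_zero _ B_rlinear) |].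
    apply CI_ext; intros theta _; rewrite hist_val, Hz by exact Hu; reflexivity. }
  transitivity (integral (fun _ : R => (zero : X)) 0 t).
  - f_equal; apply functional_extensionality; intros s; rewrite Hh.
    apply (rlin_zero _ (semigroup_rlinear T HT _ (Rmax_l 0 s))).
  - rewrite integral_const; modeq X.
Qed.

Lemma delay_solution_exists phi :
  exists u, path u /\ (forall t, u t = delay_map phi u t) /\
    forall t, norm (u t) <= 2 * (M * norm phi) * delay_weight t.
Proof.
  assert (H0 : path (fun _ => (zero : X))) by (intros t; apply continuous_const).
  apply exists_fixpoint.
  - apply delay_map_half_lipschitz.
  - exact H0.
  - apply delay_map_path.
  - apply path_limit.
  - intros t; unfold delay_map; rewrite convolution_zero_forcing by (intros; auto).
    apply Rle_trans with (2 := free_motion_norm phi t); right; f_equal; modeq X.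
Qed.

(** The growth bound is kept in the choice because uniqueness holds among functions at finite
    weighted distance. *)
Definition solution phi : R -> X :=
  epsilon (inhabits (fun _ => (zero : X)))
    (fun u => path u /\ (forall t, u t = delay_map phi u t) /\
       forall t, norm (u t) <= 2 * (M * norm phi) * delay_weight t).

Lemma solution_spec phi :
  path (solution phi) /\ (forall t, solution phi t = delay_map phi (solution phi) t) /\
  forall t, norm (solution phi t) <= 2 * (M * norm phi) * delay_weight t.
Proof. exact (epsilon_spec (inhabits (fun _ => (zero : X))) _ (delay_solution_exists phi)). Qed.

Lemma solution_path phi : path (solution phi).
Proof. apply solution_spec. Qed.

Lemma solution_unique phi u C :
  path u -> (forall t, u t = delay_map phi u t) -> (forall t, norm (u t) <= C * delay_weight t) ->
  forall t, u t = solution phi t.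
Proof.
  intros Hu Hfix HC; destruct (solution_spec phi) as [Hs1 [Hs2 Hs3]].
  apply (unique_fixpoint delay_weight delay_weight_pos path (delay_map phi) u (solution phi)
    (C + 2 * (M * norm phi))); auto using delay_map_half_lipschitz.
  intros t; apply Rle_trans with (1 := vnorm_minus _ _).
  rewrite Rmult_plus_distr_r; apply Rplus_le_compat; auto.
Qed.

Lemma solution_neg phi t : t <= 0 -> solution phi t = phi t.
Proof.
  intros Ht; destruct (solution_spec phi) as [_ [H _]]; rewrite H; unfold delay_map.
  rewrite free_motion_neg, Rmax_left by exact Ht; unfold convolution.
  rewrite integral_point; modeq X.
Qed.

Lemma solution_pos phi t :
  0 <= t -> solution phi t = plus (T t (phi 0)) (convolution T (forcing (solution phi)) t).
Proof.
  intros Ht; destruct (solution_spec phi) as [_ [H _]]; rewrite H at 1; unfold delay_map.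
  now rewrite free_motion_pos, Rmax_right.
Qed.

Lemma convolution_plus u v t :
  path u -> path v ->
  convolution T (forcing (fun s => plus (u s) (v s))) t =
  plus (convolution T (forcing u) t) (convolution T (forcing v) t).
Proof.
  intros Hu Hv; unfold convolution.
  rewrite <- integral_plus by (intros s; apply convolution_integrand_continuous; auto using forcing_path).
  f_equal; apply functional_extensionality; intros s.
  rewrite <- (rlin_plus _ (semigroup_rlinear T HT _ (Rmax_l 0 s))); f_equal.
  unfold forcing; rewrite <- (rlin_plus _ B_rlinear); f_equal.
  apply CI_ext; intros theta _.
  rewrite (hist_val _ _ _ (path_plus u v Hu Hv)).
  change (plus (u (t - s + clamp theta)) (v (t - s + clamp theta)) =
          plus (hist u (t - s) theta) (hist v (t - s) theta)).
  now rewrite !hist_val.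
Qed.

Lemma path_scal (c : scalars k) u : path u -> path (fun s => scal c (u s)).
Proof. intros Hu t; exact (rlin_continuous (Y := X) _ (rlinear_scal c) u t (Hu t)). Qed.

Lemma convolution_scal (c : scalars k) u t :
  path u ->
  convolution T (forcing (fun s => scal c (u s))) t = scal c (convolution T (forcing u) t).
Proof.
  intros Hu; unfold convolution.
  rewrite <- (integral_rlinear (fun x : X => scal c x)); [| apply rlinear_scal |].
  2: { intros s; apply convolution_integrand_continuous; auto using forcing_path. }
  f_equal; apply functional_extensionality; intros s.
  rewrite <- (linear_scal _ (C0_bounded T HT _ (Rmax_l 0 s))); f_equal.
  unfold forcing; rewrite <- (linear_scal _ HB); f_equal.
  apply CI_ext; intros theta _.
  rewrite (hist_val _ _ _ (path_scal c u Hu)).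
  change (scal c (u (t - s + clamp theta)) = scal c (hist u (t - s) theta)).
  now rewrite hist_val.
Qed.

(** By uniqueness: the sum is a fixed point for the summed initial history and has finite weighted
    size. *)
Lemma solution_plus phi psi t :
  solution (plus phi psi) t = plus (solution phi t) (solution psi t).
Proof.
  destruct (solution_spec phi) as [Hp1 [Hp2 Hp3]]; destruct (solution_spec psi) as [Hq1 [Hq2 Hq3]].
  symmetry; apply (solution_unique (plus phi psi) (fun t => plus (solution phi t) (solution psi t))
    (2 * (M * norm phi) + 2 * (M * norm psi))).
  - now apply path_plus.
  - intros s; rewrite (Hp2 s), (Hq2 s) at 1; unfold delay_map, free_motion.
    rewrite convolution_plus by assumption.
    change (CI_fun (plus phi psi) s) with (plus (phi s) (psi s)).
    change (CI_fun (plus phi psi) 0) with (plus (phi 0) (psi 0)).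
    rewrite (rlin_plus _ (semigroup_rlinear T HT _ (Rmax_l 0 s))); modeq X.
  - intros s; apply Rle_trans with (1 := vnorm_plus _ _).
    rewrite Rmult_plus_distr_r; apply Rplus_le_compat; auto.
Qed.

Lemma solution_scal (c : scalars k) phi t : solution (scal c phi) t = scal c (solution phi t).
Proof.
  destruct (solution_spec phi) as [Hp1 [Hp2 Hp3]].
  symmetry; apply (solution_unique (scal c phi) (fun t => scal c (solution phi t))
    (abs c * (2 * (M * norm phi)))).
  - now apply path_scal.
  - intros s; rewrite (Hp2 s) at 1; unfold delay_map, free_motion.
    rewrite convolution_scal by assumption.
    change (CI_fun (scal c phi) s) with (scal c (phi s)).
    change (CI_fun (scal c phi) 0) with (scal c (phi 0)).
    rewrite (linear_scal _ (C0_bounded T HT _ (Rmax_l 0 s))).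
    pose proof (rlinear_scal (X := X) c) as Hc.
    rewrite (rlin_plus _ Hc), (rlin_plus _ Hc), (rlin_minus _ Hc); reflexivity.
  - intros s; apply Rle_trans with (1 := norm_scal (V := X) c _); rewrite Rmult_assoc.
    apply Rmult_le_compat_l; [apply abs_ge_0 | apply Hp3].
Qed.

Definition delay_semigroup (t : R) phi : CI X := hist (solution phi) t.

(** The translated solution satisfies the integral equation with initial history
    [delay_semigroup t phi], by [convolution_shift]. The bound [-1 <= r] is the reach of the
    history. *)
Lemma solution_shift phi t r :
  0 <= t -> -1 <= r -> solution (delay_semigroup t phi) r = solution phi (t + r).
Proof.
  intros Ht Hr; destruct (solution_spec phi) as [Hp1 [Hp2 Hp3]].
  set (psi := delay_semigroup t phi); set (u := solution phi) in *.
  assert (Hlip : forall s s', Rabs (t + Rmax (-1) s - (t + Rmax (-1) s')) <= Rabs (s - s')).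
  { intros s s'; unfold Rmax; destruct (Rle_dec (-1) s), (Rle_dec (-1) s'); unfold Rabs;
      repeat destruct (Rcase_abs _); lra. }
  (* Frozen before [-1], to agree with the constant extension of elements of [CI X] to the left. *)
  pose (v s := u (t + Rmax (-1) s)).
  assert (Hv : path v) by exact (path_comp_lipschitz u (fun s => t + Rmax (-1) s) Hp1 Hlip).
  assert (Hpsi : forall s, psi s = u (t + clamp s)) by (intros; now apply hist_val).
  transitivity (v r); [symmetry | unfold v; now rewrite Rmax_right].
  apply (solution_unique psi v (2 * (M * norm phi) * exp (delay_rate * t))); [exact Hv | |].
  - intros s; unfold delay_map; destruct (Rle_lt_dec s 0) as [Hs | Hs].
    + rewrite free_motion_neg, Rmax_left, Hpsi by exact Hs; unfold convolution.
      rewrite integral_point; unfold v, clamp; rewrite (Rmin_left s 0) by exact Hs; modeq X.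
    + rewrite free_motion_pos, Hpsi, (Rmax_right 0 s) by lra.
      unfold v; rewrite Rmax_right, clamp_id, Rplus_0_r by lra; unfold u.
      rewrite (solution_pos phi (t + s)), (solution_pos phi t) by lra.
      rewrite (convolution_shift T HT) by (try lra; apply forcing_path, Hp1).
      rewrite (Rplus_comm t s), (C0_plus T HT) by lra.
      rewrite (rlin_plus _ (semigroup_rlinear T HT s ltac:(lra))).
      assert (Heq : convolution T (fun q => forcing u (t + q)) s = convolution T (forcing v) s).
      { unfold convolution; apply integral_ext; [lra |]; intros q Hq; f_equal.
        unfold forcing; f_equal; apply hist_ext; [exact Hp1 | exact Hv |]; intros q' Hq'.
        unfold v; rewrite Rmax_right by lra; f_equal; ring. }
      fold u; change (fun s0 : R => u (t + Rmax (-1) s0)) with v; rewrite Heq; modeq X.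
  - intros s; unfold v; apply Rle_trans with (1 := Hp3 _).
    assert (Hphi : 0 <= norm phi) by exact (vnorm_ge0 (Y := CI_CompleteNormedModule (X := X)) phi).
    rewrite (Rmult_assoc (2 * (M * norm phi)) (exp (delay_rate * t)) (delay_weight s)).
    apply Rmult_le_compat_l.
    + apply Rmult_le_pos; [lra |]; apply Rmult_le_pos; [lra | exact Hphi].
    + unfold delay_weight; rewrite <- exp_plus, <- Rmult_plus_distr_l.
      apply exp_le, Rmult_le_compat_l; [generalize delay_rate_ge; lra |].
      apply Rmax_lub; [generalize (Rmax_l 0 s); lra |].
      apply Rplus_le_compat_l, Rmax_lub; [generalize (Rmax_l 0 s); lra | apply Rmax_r].
Qed.

Lemma hist_solution_0 phi : hist (solution phi) 0 = phi.
Proof.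
  apply CI_ext; intros theta Htheta; rewrite hist_val by apply solution_path.
  rewrite clamp_id, Rplus_0_l by exact Htheta; apply solution_neg; lra.
Qed.

Lemma delay_semigroup_growth : growth delay_semigroup (2 * M) delay_rate.
Proof.
  intros t phi Ht; destruct (solution_spec phi) as [Hp1 [Hp2 Hp3]].
  replace (2 * M * exp (delay_rate * t) * norm phi) with
    (2 * (M * norm phi) * exp (delay_rate * t)) by ring.
  apply hist_weight; [exact Hp1 | | exact Ht | exact Hp3].
  apply Rmult_le_pos; [lra |]; apply Rmult_le_pos; [lra |].
  apply (vnorm_ge0 (Y := CI_CompleteNormedModule (X := X))).
Qed.

Lemma delay_semigroup_C0 : C0_semigroup delay_semigroup.
Proof.
  split.
  - intros t Ht; split.
    + intros phi psi; apply CI_ext; intros theta _; unfold delay_semigroup.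
      change (hist (solution (plus phi psi)) t theta =
        plus (hist (solution phi) t theta) (hist (solution psi) t theta)).
      rewrite !hist_val by apply solution_path; apply solution_plus.
    + intros c phi; apply CI_ext; intros theta _; unfold delay_semigroup.
      change (hist (solution (scal c phi)) t theta = scal c (hist (solution phi) t theta)).
      rewrite !hist_val by apply solution_path; apply solution_scal.
    + exists (2 * M * exp (delay_rate * t)); split.
      * apply Rmult_lt_0_compat; [lra | apply exp_pos].
      * intros phi; now apply delay_semigroup_growth.
  - intros phi; apply hist_solution_0.
  - intros s t phi Hs Ht; unfold delay_semigroup at 1 2.
    apply hist_ext; try apply solution_path; intros r Hr.
    rewrite solution_shift by lra; f_equal; ring.
  - intros phi; pose proof (hist_continuous (solution phi) 0 (solution_path phi)) as H.
    unfold continuous in H; rewrite hist_solution_0 in H.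
    apply (filterlim_filter_le_1 (F := locally 0) (G := at_right 0)); [| exact H].
    intros P [d Hd]; exists d; intros y Hy _; now apply Hd.
Qed.

(** Norm convergence in [CI X] read pointwise: an estimate uniform in [theta], multiplied out by
    [h]. *)
Lemma semigroup_increment_bound (S : R -> CI X -> CI X) f g :
  filterlim (fun h => rscal (/ h) (minus (S h f) f)) (at_right 0) (locally g) <->
  forall e, 0 < e -> exists d, 0 < d /\ forall h, 0 < h < d -> forall theta, -1 <= theta <= 0 ->
    norm (minus (minus (S h f theta) (f theta)) (rscal h (g theta))) <= e * h.
Proof.
  split.
  - intros H e He.
    pose proof (proj1 (filterlim_eps (Y := CI_CompleteNormedModule (X := X)) _ _ _) H e He) as H1.
    apply at_right_eps in H1; destruct H1 as [d [Hd1 Hd2]]; exists d; split; [exact Hd1 |].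
    intros h Hh theta Htheta; specialize (Hd2 h Hh).
    pose proof (CI_norm_point (minus (rscal (/ h) (minus (S h f) f)) g) theta) as H1.
    change (norm (minus (rscal (/ h) (minus (S h f theta) (f theta))) (g theta)) <=
            norm (minus (rscal (/ h) (minus (S h f) f)) g)) in H1.
    assert (H2 : norm (minus (rscal (/ h) (minus (S h f theta) (f theta))) (g theta)) <= e).
    { apply Rle_trans with (1 := H1); left; exact Hd2. }
    vset (rscal h (minus (rscal (/ h) (minus (S h f theta) (f theta))) (g theta))).
    rewrite vnorm_rscal_pos, Rmult_comm by lra.
    apply Rmult_le_compat_r; [lra | exact H2].
  - intros H; apply (filterlim_eps (Y := CI_CompleteNormedModule (X := X)));
      [typeclasses eauto |]; intros e He.
    destruct (H (e / 2) ltac:(lra)) as [d [Hd1 Hd2]].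
    apply at_right_eps; exists d; split; [exact Hd1 |]; intros h Hh.
    apply Rle_lt_trans with (e / 2); [| lra].
    apply CI_norm_bound; intros theta Htheta.
    change (norm (minus (rscal (/ h) (minus (S h f theta) (f theta))) (g theta)) <= e / 2).
    vset (rscal (/ h) (minus (minus (S h f theta) (f theta)) (rscal h (g theta)))).
    rewrite vnorm_rscal_pos by (left; apply Rinv_0_lt_compat; lra).
    apply Rle_trans with (/ h * (e / 2 * h)); [| right; field; lra].
    apply Rmult_le_compat_l; [left; apply Rinv_0_lt_compat; lra |]; now apply Hd2.
Qed.

Lemma is_CI_derive_eps f g :
  is_CI_derive f g <->
  forall t e, -1 <= t <= 0 -> 0 < e -> exists d, 0 < d /\ forall s, -1 <= s <= 0 -> s <> t -> Rabs (s - t) < d ->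
      norm (minus (diff_quot f t s) (g t)) < e.
Proof.
  split.
  - intros H t e Ht He.
    destruct (proj1 (filterlim_eps (Y := X) _ _ _) (H t Ht) e He) as [d Hd].
    exists d; split; [apply cond_pos |]; intros s Hs Hst Hsd; now apply Hd.
  - intros H t Ht; apply (filterlim_eps (Y := X)); [typeclasses eauto |]; intros e He.
    destruct (H t e Ht He) as [d [Hd1 Hd2]].
    exists (mkposreal d Hd1); intros s Hsd Hst Hs; now apply Hd2.
Qed.

Lemma CI_derive_left_limit f g :
  is_CI_derive f g -> filterlim (diff_quot f 0) (at_left 0) (locally (g 0)).
Proof.
  intros H; apply (filterlim_eps (Y := X)); [typeclasses eauto |]; intros e He.
  destruct (proj1 (is_CI_derive_eps f g) H 0 e ltac:(lra) He) as [d [Hd1 Hd2]].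
  exists (mkposreal (Rmin d 1) ltac:(apply Rmin_glb_lt; lra)); intros s Hsd Hs0.
  pose proof (Rmin_l d 1); pose proof (Rmin_r d 1).
  change (Rabs (s - 0) < Rmin d 1) in Hsd.
  assert (Hs1 : Rabs (s - 0) < 1) by lra; apply Rabs_def2 in Hs1.
  apply Hd2; lra.
Qed.

(** Uniformity in [theta] comes from the mean value inequality for [f s - s g theta] and the uniform
    continuity of [g]. *)
Lemma CI_derive_increment f g e :
  is_CI_derive f g -> 0 < e -> exists d, 0 < d /\ forall h theta, 0 <= h < d ->
    -1 <= theta -> theta + h <= 0 ->
    norm (minus (minus (f (theta + h)) (f theta)) (rscal h (g theta))) <= e * h.
Proof.
  intros Hfg He.
  destruct (uniformly_continuous_eps g (-1) 0 e (CI_cont g) He) as [d [Hd1 Hd2]].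
  exists d; split; [exact Hd1 |]; intros h theta Hh Ht1 Ht2.
  pose (u s := minus (f s) (rscal s (g theta))).
  assert (H : norm (minus (u (theta + h)) (u theta)) <= e * (theta + h - theta)).
  { apply right_mean_value; [lra | |].
    - apply path_minus; [exact (CI_cont f) |]; intros t.
      apply (vlim_rscal (locally t) (fun s => s)); [apply filterlim_id | apply filterlim_const].
    - intros t e' Ht He'.
      destruct (proj1 (is_CI_derive_eps f g) Hfg t e' ltac:(lra) He') as [d' [Hd1' Hd2']].
      exists (Rmin d' (theta + h - t)); split; [apply Rmin_glb_lt; lra |]; intros r Hr.
      pose proof (Rmin_l d' (theta + h - t)); pose proof (Rmin_r d' (theta + h - t)).
      specialize (Hd2' (t + r) ltac:(lra) ltac:(lra)).
      replace (t + r - t) with r in Hd2' by ring.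
      specialize (Hd2' ltac:(rewrite Rabs_pos_eq; lra)); unfold diff_quot in Hd2'.
      replace (t + r - t) with r in Hd2' by ring.
      assert (Hg : norm (minus (g t) (g theta)) < e).
      { apply Hd2; try lra; rewrite Rabs_pos_eq; lra. }
      apply Rle_trans with
        (norm (rscal r (minus (rscal (/ r) (minus (f (t + r)) (f t))) (g t))) +
         norm (rscal r (minus (g t) (g theta)))).
      + apply vnorm_decomp; unfold u; modfield X.
      + rewrite !vnorm_rscal_pos, <- Rmult_plus_distr_l, Rmult_comm by lra.
        apply Rmult_le_compat_r; [lra |].
        rewrite Rplus_comm; apply Rplus_le_compat; left; [exact Hg | exact Hd2']. }
  replace (theta + h - theta) with h in H by ring.
  apply Rle_trans with (2 := H); right; f_equal; unfold u; modeq X.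
Qed.

Lemma forcing_solution_0 f : forcing (solution f) 0 = B f.
Proof. unfold forcing; now rewrite hist_solution_0. Qed.

Lemma delay_semigroup_point f h theta :
  -1 <= theta <= 0 -> delay_semigroup h f theta = solution f (h + theta).
Proof.
  intros Ht; unfold delay_semigroup; rewrite hist_val by apply solution_path.
  now rewrite clamp_id.
Qed.

Variable A : operator X.
Hypothesis HA : is_generator A T.

(** For [h + theta <= 0] the semigroup is a translation, which accounts for [g = f']; beyond 0 it
    follows the mild solution, which accounts for the boundary condition at 0. *)
Lemma delay_generator_spec f g :
  delay_generator A B f g <->
  filterlim (fun h => rscal (/ h) (minus (delay_semigroup h f) f)) (at_right 0) (locally g).
Proof.
  rewrite semigroup_increment_bound; split.
  - intros [Hfg [y [HAy Hlim]]] e He.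
    (* The two clauses of the delay generator give the left derivative of [f] at 0 two expressions,
       which must agree. *)
    assert (Hg0 : g 0 = plus y (B f)).
    { apply (filterlim_locally_unique (F := at_left 0) (diff_quot f 0));
        [now apply CI_derive_left_limit | exact Hlim]. }
    destruct (CI_derive_increment f g (e / 4) Hfg ltac:(lra)) as [d1 [Hd1 Hd1']].
    destruct (generator_increment T A HA (f 0) y (e / 4) HAy ltac:(lra)) as [d2 [Hd2 Hd2']].
    destruct (convolution_increment T HT _ (e / 4) (forcing_path _ (solution_path f)) ltac:(lra))
      as [d3 [Hd3 Hd3']].
    destruct (uniformly_continuous_eps g (-1) 0 (e / 4) (CI_cont g) ltac:(lra)) as [d4 [Hd4 Hd4']].
    pose (d := Rmin (Rmin d1 d2) (Rmin d3 d4)).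
    assert (Hd : 0 < d /\ d <= d1 /\ d <= d2 /\ d <= d3 /\ d <= d4).
    { pose proof (Rmin_l (Rmin d1 d2) (Rmin d3 d4)); pose proof (Rmin_r (Rmin d1 d2) (Rmin d3 d4)).
      pose proof (Rmin_l d1 d2); pose proof (Rmin_r d1 d2).
      pose proof (Rmin_l d3 d4); pose proof (Rmin_r d3 d4).
      split; [unfold d; repeat apply Rmin_glb_lt; lra | unfold d; lra]. }
    exists d; split; [lra |]; intros h Hh theta Htheta.
    rewrite delay_semigroup_point by exact Htheta.
    destruct (Rle_lt_dec (h + theta) 0) as [Hs | Hs].
    + rewrite solution_neg, (Rplus_comm h theta) by exact Hs.
      apply Rle_trans with (e / 4 * h); [apply Hd1'; lra | apply Rmult_le_compat_r; lra].
    (* The increment splits at 0: a time [- theta] is spent on the history and a time [r] on the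
       mild solution, whose derivative [y + B f = g 0] is within [e / 4] of [g theta]. *)
    + set (r := h + theta) in *; assert (Hrd : r = h + theta) by reflexivity; clearbody r.
      specialize (Hd1' (- theta) theta ltac:(lra) ltac:(lra) ltac:(lra)).
      specialize (Hd2' r ltac:(lra)); specialize (Hd3' r ltac:(lra)).
      specialize (Hd4' theta 0 ltac:(lra) ltac:(lra) ltac:(rewrite Rabs_pos_eq; lra)).
      rewrite Rplus_opp_r in Hd1'; rewrite forcing_solution_0 in Hd3'.
      rewrite solution_pos by lra; rewrite Hg0 in Hd4'.
      assert (Hr : 0 <= r <= h) by lra.
      set (c := convolution T (forcing (solution f)) r) in *.
      apply Rle_trans with
        (norm (minus (minus (T r (f 0)) (f 0)) (rscal r y)) +
         norm (plus (minus c (rscal r (B f)))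
           (plus (minus (minus (f 0) (f theta)) (rscal (- theta) (g theta)))
              (rscal r (minus (plus y (B f)) (g theta)))))).
      { apply vnorm_decomp.
        replace h with (r - theta) by (rewrite Hrd; ring); modeq X. }
      assert (H1 : norm (rscal r (minus (plus y (B f)) (g theta))) <= r * (e / 4)).
      { rewrite vnorm_rscal_pos by lra; apply Rmult_le_compat_l; lra. }
      pose proof (vnorm_plus (minus (minus (f 0) (f theta)) (rscal (- theta) (g theta)))
        (rscal r (minus (plus y (B f)) (g theta)))) as H2.
      pose proof (vnorm_plus (minus c (rscal r (B f)))
        (plus (minus (minus (f 0) (f theta)) (rscal (- theta) (g theta)))
              (rscal r (minus (plus y (B f)) (g theta))))) as H3.
      apply Rle_trans with (e / 4 * r + (e / 4 * r + (e / 4 * - theta + r * (e / 4)))).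
      * apply Rplus_le_compat; [exact Hd2' |]; apply Rle_trans with (1 := H3).
        apply Rplus_le_compat; [exact Hd3' |]; apply Rle_trans with (1 := H2).
        apply Rplus_le_compat; [exact Hd1' | exact H1].
      * assert (Hth : - theta <= h) by lra.
        assert (e / 4 * r <= e / 4 * h) by (apply Rmult_le_compat_l; lra).
        assert (e / 4 * - theta <= e / 4 * h) by (apply Rmult_le_compat_l; lra).
        lra.
  - intros H.
    (* Restricted to points that stay in [[-1, 0]], the assumption says that the right difference
       quotients of [f] converge to [g] uniformly. *)
    assert (Hinc : forall e, 0 < e -> exists d, 0 < d /\ forall h, 0 < h < d ->
      forall theta, -1 <= theta -> theta + h <= 0 ->
        norm (minus (rscal (/ h) (minus (f (theta + h)) (f theta))) (g theta)) <= e).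
    { intros e He; destruct (H e He) as [d [Hd1 Hd2]]; exists d; split; [exact Hd1 |].
      intros h Hh theta Ht1 Ht2; specialize (Hd2 h Hh theta ltac:(lra)).
      rewrite delay_semigroup_point, solution_neg, (Rplus_comm h theta) in Hd2 by lra.
      vset (rscal (/ h) (minus (minus (f (theta + h)) (f theta)) (rscal h (g theta)))).
      rewrite vnorm_rscal_pos by (left; apply Rinv_0_lt_compat; lra).
      apply Rle_trans with (/ h * (e * h)); [| right; field; lra].
      apply Rmult_le_compat_l; [left; apply Rinv_0_lt_compat; lra | exact Hd2]. }
    assert (Hfg : is_CI_derive f g).
    { apply is_CI_derive_eps; intros t e Ht He.
      destruct (Hinc (e / 3) ltac:(lra)) as [d1 [Hd1 Hd1']].
      destruct (uniformly_continuous_eps g (-1) 0 (e / 3) (CI_cont g) ltac:(lra)) as [d2 [Hd2 Hd2']].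
      exists (Rmin d1 d2); split; [now apply Rmin_glb_lt |]; intros s Hs Hst Hsd.
      pose proof (Rmin_l d1 d2); pose proof (Rmin_r d1 d2).
      unfold diff_quot; destruct (Rtotal_order s t) as [Hlt | [Heq | Hgt]]; [| contradiction |].
      (* A left quotient at [t] is a right quotient at [s]; the uniform estimate and the continuity
         of [g] move the base point. *)
      - rewrite Rabs_left in Hsd by lra.
        specialize (Hd1' (t - s) ltac:(lra) s ltac:(lra) ltac:(lra)).
        replace (s + (t - s)) with t in Hd1' by ring.
        specialize (Hd2' t s Ht Hs ltac:(rewrite Rabs_left; lra)).
        apply Rle_lt_trans with
          (norm (minus (rscal (/ (t - s)) (minus (f t) (f s))) (g s)) + norm (minus (g s) (g t))).
        + apply vnorm_decomp; replace (/ (s - t)) with (- / (t - s)) by (field; lra); modeq X.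
        + lra.
      - rewrite Rabs_pos_eq in Hsd by lra.
        specialize (Hd1' (s - t) ltac:(lra) t ltac:(lra) ltac:(lra)).
        replace (t + (s - t)) with s in Hd1' by ring.
        apply Rle_lt_trans with (1 := Hd1'); lra. }
    split; [exact Hfg |]; exists (minus (g 0) (B f)); split.
    (* At [theta = 0] the solution is [T h (f 0)] plus a convolution that grows like [h * B f];
       subtracting the latter isolates the generator of [T]. *)
    + apply HA; apply (filterlim_eps (Y := X)); [typeclasses eauto |]; intros e He.
      apply at_right_eps.
      destruct (H (e / 3) ltac:(lra)) as [d1 [Hd1 Hd1']].
      destruct (convolution_increment T HT _ (e / 3) (forcing_path _ (solution_path f)) ltac:(lra))
        as [d2 [Hd2 Hd2']].
      exists (Rmin d1 d2); split; [now apply Rmin_glb_lt |]; intros h Hh.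
      pose proof (Rmin_l d1 d2); pose proof (Rmin_r d1 d2).
      specialize (Hd1' h ltac:(lra) 0 ltac:(lra)); specialize (Hd2' h ltac:(lra)).
      rewrite delay_semigroup_point, Rplus_0_r, solution_pos in Hd1' by lra.
      rewrite forcing_solution_0 in Hd2'.
      set (c := convolution T (forcing (solution f)) h) in *.
      assert (Hinv : 0 < / h) by (apply Rinv_0_lt_compat; lra).
      vset (rscal (/ h) (plus (minus (minus (plus (T h (f 0)) c) (f 0)) (rscal h (g 0)))
        (opp (minus c (rscal h (B f)))))).
      rewrite vnorm_rscal_pos by lra.
      apply Rle_lt_trans with (/ h * (e / 3 * h + e / 3 * h)).
      * apply Rmult_le_compat_l; [lra |].
        rewrite <- vnorm_opp in Hd2'.
        apply Rle_trans with (1 := vnorm_plus _ _); now apply Rplus_le_compat.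
      * replace (/ h * (e / 3 * h + e / 3 * h)) with (e / 3 + e / 3) by (field; lra); lra.
    + match goal with |- filterlim _ _ (locally ?a) => replace a with (g 0) by modeq X end.
      now apply CI_derive_left_limit.
Qed.

Lemma delay_semigroup_generated : solution_semigroup A B delay_semigroup.
Proof. split; [exact delay_semigroup_C0 |]; intros f g; apply delay_generator_spec. Qed.

End DelayEquation.

(** * Dependence of the solution semigroup on the coefficients *)

Section Comparison.

Context {k : scalar_field} {X : CompleteNormedModule (scalars k)}.
Variables (T0 T1 : R -> X -> X) (B0 B1 : CI X -> X) (M w b eta : R).
Hypotheses (HT0 : C0_semigroup T0) (HT1 : C0_semigroup T1) (HM : 1 <= M) (Hw : 0 <= w)
  (Hg0 : growth T0 M w) (Hg1 : growth T1 M w).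
Hypotheses (HB0 : is_linear B0) (HB1 : is_linear B1) (Hb : 0 <= b)
  (HB0b : forall f, norm (B0 f) <= b * norm f) (HB1b : forall f, norm (B1 f) <= b * norm f).
Hypotheses (Heta : 0 <= eta)
  (HT01 : forall t x, 0 <= t -> norm (minus (T0 t x) (T1 t x)) <= eta * (M * exp (w * t)) * norm x)
  (HB01 : forall f, norm (minus (B0 f) (B1 f)) <= eta * norm f).
Implicit Types phi : CI X.

(** In parentheses, the distance of the two delay maps at a solution, per unit of [eta] and of
    [norm phi]: [M] from the free motions, the rest from the convolutions, where [2 * M] bounds the
    solution and [b + 1] collects the changes of [T] and of [B]. The outer 2 is that of
    [close_fixpoints]. *)
Definition comparison_constant : R := 2 * (M + 2 * M * M * (b + 1)).

(** The two solutions are fixed points of two maps, so it is enough to compare these maps at the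
    second solution. *)
Lemma delay_semigroup_distance t phi :
  0 <= t ->
  norm (minus (delay_semigroup T0 B0 M w b t phi) (delay_semigroup T1 B1 M w b t phi)) <=
  eta * comparison_constant * exp (delay_rate M w b * t) * norm phi.
Proof.
  intros Ht.
  set (E := delay_weight M w b); set (lam := delay_rate M w b).
  assert (Hphi : 0 <= norm phi) by exact (vnorm_ge0 (Y := CI_CompleteNormedModule (X := X)) phi).
  assert (HMphi : 0 <= M * norm phi) by (apply Rmult_le_pos; lra).
  assert (Hlam : w + 1 <= lam) by now apply delay_rate_ge.
  destruct (solution_spec T0 B0 M w b HT0 HM Hw Hg0 HB0 Hb HB0b phi) as [Hu1 [Hu2 Hu3]].
  destruct (solution_spec T1 B1 M w b HT1 HM Hw Hg1 HB1 Hb HB1b phi) as [Hv1 [Hv2 Hv3]].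
  set (u := solution T0 B0 M w b phi) in *; set (v := solution T1 B1 M w b phi) in *.
  assert (HE : forall s, 0 < E s) by (intros; apply delay_weight_pos).
  pose (delta := eta * (M + 2 * M * M * (b + 1)) * norm phi).
  assert (Hdelta : 0 <= delta).
  { repeat apply Rmult_le_pos; try lra.
    apply Rplus_le_le_0_compat; [lra |]; repeat apply Rmult_le_pos; lra. }
  assert (Hmaps : wclose E delta (delay_map T0 B0 phi v) (delay_map T1 B1 phi v)).
  { intros s; set (a := Rmax 0 s); assert (Ha : 0 <= a) by apply Rmax_l.
    assert (HF0 : path (forcing B0 v)) by now apply forcing_path.
    assert (HF1 : path (forcing B1 v)) by now apply forcing_path.
    assert (Hfree : norm (minus (T0 a (phi 0)) (T1 a (phi 0))) <= eta * M * norm phi * exp (lam * a)).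
    { apply Rle_trans with (1 := HT01 a (phi 0) Ha).
      apply Rle_trans with (eta * (M * exp (lam * a)) * norm phi); [| right; ring].
      apply Rmult_le_compat; [| apply vnorm_ge0 | | apply CI_norm_point].
      - repeat apply Rmult_le_pos; try lra; left; apply exp_pos.
      - apply Rmult_le_compat_l; [exact Heta |]; apply Rmult_le_compat_l; [lra |].
        apply exp_le, Rmult_le_compat_r; lra. }
    pose (g r := minus (T0 (Rmax 0 r) (forcing B0 v (a - r))) (T1 (Rmax 0 r) (forcing B1 v (a - r)))).
    assert (Hg : path g).
    { apply (path_minus (fun r => T0 (Rmax 0 r) (forcing B0 v (a - r)))
        (fun r => T1 (Rmax 0 r) (forcing B1 v (a - r)))); intros r;
        now apply convolution_integrand_continuous. }
    assert (HC : 0 <= eta * M * (b + 1) * (2 * (M * norm phi))).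
    { repeat apply Rmult_le_pos; lra. }
    assert (HI : norm (integral g 0 a) <=
      eta * M * (b + 1) * (2 * (M * norm phi)) / (lam - w) * exp (lam * a)).
    { apply integral_norm_exp; [exact Hg | exact Ha | exact HC | lra |]; intros r Hr; unfold g.
      rewrite Rmax_right by lra; set (x0 := forcing B0 v (a - r)); set (x1 := forcing B1 v (a - r)).
      assert (Hh : norm (hist v (a - r)) <= 2 * (M * norm phi) * exp (lam * (a - r))).
      { apply (hist_weight M w b HM Hw Hb); [exact Hv1 | lra | lra | exact Hv3]. }
      assert (Hexp : 0 <= M * exp (w * r)) by (apply Rmult_le_pos; [lra | left; apply exp_pos]).
      (* The semigroups are compared at the same forcing, then the forcings under the same
         semigroup. *)
      apply Rle_trans with (norm (minus (T0 r x0) (T1 r x0)) + norm (T1 r (minus x0 x1))).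
      { apply vnorm_decomp; rewrite (rlin_minus _ (semigroup_rlinear T1 HT1 r ltac:(lra))); modeq X. }
      apply Rle_trans with (eta * (M * exp (w * r)) * (b * norm (hist v (a - r))) +
        M * exp (w * r) * (eta * norm (hist v (a - r)))).
      - apply Rplus_le_compat.
        + apply Rle_trans with (1 := HT01 r x0 (proj1 Hr)).
          apply Rmult_le_compat_l; [apply Rmult_le_pos; assumption | apply HB0b].
        + apply Rle_trans with (1 := Hg1 r _ (proj1 Hr)).
          apply Rmult_le_compat_l; [exact Hexp | apply HB01].
      - apply Rle_trans with (eta * (M * exp (w * r)) * (b + 1) * norm (hist v (a - r))); [right; ring |].
        apply Rle_trans with
          (eta * (M * exp (w * r)) * (b + 1) * (2 * (M * norm phi) * exp (lam * (a - r))));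
          [| right; ring].
        apply Rmult_le_compat_l; [| exact Hh].
        repeat apply Rmult_le_pos; try lra; left; apply exp_pos. }
    assert (HI' : norm (integral g 0 a) <= eta * M * (b + 1) * (2 * (M * norm phi)) * exp (lam * a)).
    { apply Rle_trans with (1 := HI), Rmult_le_compat_r; [left; apply exp_pos |].
      apply Rle_div_l; [lra |]; rewrite <- (Rmult_1_r (eta * M * (b + 1) * (2 * (M * norm phi)))) at 1.
      apply Rmult_le_compat_l; lra. }
    apply Rle_trans with (eta * M * norm phi * exp (lam * a) +
      eta * M * (b + 1) * (2 * (M * norm phi)) * exp (lam * a)).
    - apply Rle_trans with (2 := Rplus_le_compat _ _ _ _ Hfree HI'); apply vnorm_decomp.
      unfold g; rewrite integral_minus by (intros r; now apply convolution_integrand_continuous).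
      unfold delay_map, free_motion, convolution; fold a; modeq X.
    - right; unfold delta, E, delay_weight; fold a lam; ring. }
  assert (Hclose : wclose E (2 * delta) u v).
  { apply (close_fixpoints E HE path (delay_map T0 B0 phi) (delay_map T1 B1 phi) u v
      (2 * (M * norm phi) + 2 * (M * norm phi))); try assumption.
    - now apply delay_map_half_lipschitz.
    - intros s; apply Rle_trans with (1 := vnorm_minus _ _).
      rewrite Rmult_plus_distr_r; apply Rplus_le_compat; auto. }
  unfold delay_semigroup; fold u v.
  replace (eta * comparison_constant * exp (lam * t) * norm phi) with
    (2 * delta * exp (lam * t)) by (unfold delta, comparison_constant; ring).
  rewrite <- hist_minus by assumption.
  apply (hist_weight M w b HM Hw Hb); [now apply path_minus | lra | exact Ht | exact Hclose].
Qed.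

End Comparison.

(** * Persistence of exponential dichotomies *)

Section PerturbedDifferenceEquation.

Context {k : scalar_field} {Y : CompleteNormedModule (scalars k)}.
Variables (P W S V : Y -> Y) (p c eps : R).
Implicit Types x y z : Y.
Implicit Types u v f : Z -> Y.

Hypotheses (HP : rlinear P) (HW : rlinear W) (HV : rlinear V).
Hypotheses (P_idem : forall x, P (P x) = P x) (PW : forall x, W (P x) = P (W x)).
Hypotheses (PS : forall x, P x = zero -> P (S x) = zero)
  (SW : forall x, P x = zero -> S (W x) = x) (WS : forall x, P x = zero -> W (S x) = x).
Hypotheses (P_norm : forall x, norm (P x) <= p * norm x)
  (WP_norm : forall x, norm (W (P x)) <= c * norm x)
  (SQ_norm : forall x, norm (S (minus x (P x))) <= c * norm x)
  (VW_norm : forall x, norm (minus (V x) (W x)) <= eps * norm x).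
Hypotheses (p_ge0 : 0 <= p) (c_bound : 0 <= c <= / 16)
  (eps_bound : 0 <= eps <= 1) (p_eps_bound : p * eps <= / 16).

Definition difference_solution f u : Prop :=
  forall n, u (n + 1)%Z = plus (V (u n)) (f (n + 1)%Z).

(** Bounded solutions of [u (n + 1) = V (u n) + f (n + 1)] are the fixed points of
    this map: the stable part is computed forwards and the unstable part backwards. *)
Definition difference_map f u (n : Z) : Y :=
  plus (plus (W (P (u (n - 1)%Z)))
         (P (plus (minus (V (u (n - 1)%Z)) (W (u (n - 1)%Z))) (f n))))
    (let y := minus (minus (u (n + 1)%Z) (minus (V (u n)) (W (u n)))) (f (n + 1)%Z) in
     S (minus y (P y))).

Lemma kernel_complement x : P (minus x (P x)) = zero.
Proof. rewrite (rlin_minus P HP), P_idem; modeq Y. Qed.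

(** [S] is known only as an inverse of [W] on the kernel of [P]; its additivity there is inherited
    from [W]. *)
Lemma unstable_inverse_minus x y :
  S (minus (minus x y) (P (minus x y))) = minus (S (minus x (P x))) (S (minus y (P y))).
Proof.
  set (x' := minus x (P x)); set (y' := minus y (P y)).
  assert (Hx : P x' = zero) by apply kernel_complement.
  assert (Hy : P y' = zero) by apply kernel_complement.
  rewrite <- (SW (minus (S x') (S y'))).
  - f_equal; rewrite (rlin_minus W HW), (WS x' Hx), (WS y' Hy), (rlin_minus P HP).
    unfold x', y'; modeq Y.
  - rewrite (rlin_minus P HP), (PS x' Hx), (PS y' Hy); modeq Y.
Qed.

(** With [g n = V (u n) - W (u n) + f (n + 1)] the equation is [u (n + 1) = W (u n) + g n]. Its [P]
    part determines [P (u n)] from time [n - 1]; the complementary part, inverted by [S], determines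
    the rest of [u n] from time [n + 1]. *)
Lemma difference_map_fixpoint f u :
  (forall n, u n = difference_map f u n) <-> difference_solution f u.
Proof.
  pose (g n := plus (minus (V (u n)) (W (u n))) (f (n + 1)%Z)).
  assert (Hmap : forall n, difference_map f u n =
    plus (plus (W (P (u (n - 1)%Z))) (P (g (n - 1)%Z)))
      (S (minus (minus (u (n + 1)%Z) (g n)) (P (minus (u (n + 1)%Z) (g n)))))).
  { intros n; unfold difference_map, g; rewrite Z.sub_add; cbv zeta.
    replace (minus (minus (u (n + 1)%Z) (minus (V (u n)) (W (u n)))) (f (n + 1)%Z)) with
      (minus (u (n + 1)%Z) (plus (minus (V (u n)) (W (u n))) (f (n + 1)%Z))) by modeq Y.
    reflexivity. }
  split.
  - intros Hu.
    assert (HPu : forall n, P (u n) = plus (W (P (u (n - 1)%Z))) (P (g (n - 1)%Z))).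
    { intros n; rewrite (Hu n) at 1; rewrite Hmap, !(rlin_plus P HP).
      rewrite PS by apply kernel_complement.
      rewrite <- PW, !P_idem; modeq Y. }
    intros n; pose proof (Hu n) as Hn; rewrite Hmap, <- HPu in Hn.
    pose proof (HPu (n + 1)%Z) as Hn1; rewrite Z.add_simpl_r in Hn1.
    set (y := minus (u (n + 1)%Z) (g n)) in *.
    assert (HQ : W (minus (u n) (P (u n))) = minus y (P y)).
    { replace (minus (u n) (P (u n))) with (S (minus y (P y))).
      - apply WS, kernel_complement.
      - rewrite Hn at 1; modeq Y. }
    rewrite (rlin_minus W HW) in HQ.
    assert (Hy : P y = W (P (u n))).
    { unfold y; rewrite (rlin_minus P HP), Hn1; modeq Y. }
    rewrite Hy in HQ.
    assert (HWu : W (u n) = y).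
    { replace (W (u n)) with (plus (minus (W (u n)) (W (P (u n)))) (W (P (u n)))) by modeq Y.
      rewrite HQ; modeq Y. }
    transitivity (plus y (g n)); [unfold y; modeq Y |].
    rewrite <- HWu; unfold g; modeq Y.
  - intros Hu n; rewrite Hmap.
    assert (Hg : forall n, minus (u (n + 1)%Z) (g n) = W (u n)).
    { intros m; unfold g; rewrite (Hu m); modeq Y. }
    rewrite Hg, <- PW, <- (rlin_minus W HW), SW by apply kernel_complement.
    rewrite PW, <- (rlin_plus P HP).
    replace (plus (W (u (n - 1)%Z)) (g (n - 1)%Z)) with (u n); [modeq Y |].
    rewrite <- Hg, Z.sub_add; modeq Y.
Qed.

(** Weights that at most double between neighbours cover both uses: the constant weight for
    uniqueness among bounded sequences, and [decay]. The three terms contribute [2 / 16], [2 / 16]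
    and [3 / 16], in total [7 / 16]. *)
Lemma difference_map_half_lipschitz (E : Z -> R) f :
  (forall n, 0 < E n) -> (forall n, E (n - 1)%Z <= 2 * E n) -> (forall n, E (n + 1)%Z <= 2 * E n) ->
  half_lipschitz E (fun _ => True) (difference_map f).
Proof.
  intros E_pos E_l E_r u v C _ _ Huv n.
  pose (d m := minus (u m) (v m)).
  assert (Hd : forall m, norm (d m) <= C * E m) by exact Huv.
  assert (HC : 0 <= C).
  { apply Rnot_lt_le; intros HC; generalize (Hd 0%Z) (vnorm_ge0 (d 0%Z)) (E_pos 0%Z); nra. }
  pose (y := minus (d (n + 1)%Z) (minus (V (d n)) (W (d n)))).
  assert (Hy : norm y <= C * E (n + 1)%Z + eps * (C * E n)).
  { unfold y; apply Rle_trans with (1 := vnorm_minus _ _).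
    apply Rplus_le_compat; [apply Hd |]; apply Rle_trans with (1 := VW_norm _).
    apply Rmult_le_compat_l; [lra | apply Hd]. }
  assert (H1 : norm (W (P (d (n - 1)%Z))) <= c * (C * E (n - 1)%Z)).
  { apply Rle_trans with (1 := WP_norm _), Rmult_le_compat_l; [lra | apply Hd]. }
  assert (H2 : norm (P (minus (V (d (n - 1)%Z)) (W (d (n - 1)%Z)))) <= p * (eps * (C * E (n - 1)%Z))).
  { apply Rle_trans with (1 := P_norm _), Rmult_le_compat_l; [lra |].
    apply Rle_trans with (1 := VW_norm _), Rmult_le_compat_l; [lra | apply Hd]. }
  assert (H3 : norm (S (minus y (P y))) <= c * (C * E (n + 1)%Z + eps * (C * E n))).
  { apply Rle_trans with (1 := SQ_norm y), Rmult_le_compat_l; lra. }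
  apply Rle_trans with (norm (W (P (d (n - 1)%Z))) +
    norm (plus (P (minus (V (d (n - 1)%Z)) (W (d (n - 1)%Z)))) (S (minus y (P y))))).
  { apply vnorm_decomp.
    assert (Hyy : y = minus
      (minus (minus (u (n + 1)%Z) (minus (V (u n)) (W (u n)))) (f (n + 1)%Z))
      (minus (minus (v (n + 1)%Z) (minus (V (v n)) (W (v n)))) (f (n + 1)%Z))).
    { unfold y, d; rewrite (rlin_minus V HV), (rlin_minus W HW); modeq Y. }
    rewrite Hyy, unstable_inverse_minus; unfold difference_map, d; cbv zeta.
    rewrite (rlin_minus V HV), (rlin_minus W HW), !(rlin_plus P HP), !(rlin_minus P HP).
    rewrite (rlin_minus W HW); modeq Y. }
  apply Rle_trans with (1 := Rplus_le_compat _ _ _ _ H1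
    (Rle_trans _ _ _ (vnorm_plus _ _) (Rplus_le_compat _ _ _ _ H2 H3))).
  assert (HCE : 0 <= C * E n) by (apply Rmult_le_pos; [exact HC | left; apply E_pos]).
  assert (Hl : C * E (n - 1)%Z <= 2 * (C * E n)) by (generalize (E_l n); nra).
  assert (Hr : C * E (n + 1)%Z <= 2 * (C * E n)) by (generalize (E_r n); nra).
  assert (Hl0 : 0 <= C * E (n - 1)%Z) by (apply Rmult_le_pos; [exact HC | left; apply E_pos]).
  assert (Hr0 : 0 <= C * E (n + 1)%Z) by (apply Rmult_le_pos; [exact HC | left; apply E_pos]).
  assert (B1 : c * (C * E (n - 1)%Z) <= / 16 * (2 * (C * E n))) by (apply Rmult_le_compat; lra).
  assert (B2 : p * eps * (C * E (n - 1)%Z) <= / 16 * (2 * (C * E n))).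
  { apply Rmult_le_compat; try lra; apply Rmult_le_pos; lra. }
  assert (B3 : eps * (C * E n) <= 1 * (C * E n)) by (apply Rmult_le_compat_r; lra).
  assert (B4 : 0 <= eps * (C * E n)) by (apply Rmult_le_pos; lra).
  assert (B5 : c * (C * E (n + 1)%Z + eps * (C * E n)) <= / 16 * (3 * (C * E n))).
  { apply Rmult_le_compat; lra. }
  rewrite <- Rmult_assoc; lra.
Qed.

Lemma difference_solution_unique f u v C :
  difference_solution f u -> difference_solution f v ->
  (forall n, norm (u n) <= C) -> (forall n, norm (v n) <= C) -> forall n, u n = v n.
Proof.
  intros Hu Hv HCu HCv.
  apply (unique_fixpoint (fun _ => 1) (fun _ => Rlt_0_1) (fun _ => True) (difference_map f) u v (2 * C)).
  - apply difference_map_half_lipschitz; intros; lra.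
  - exact I.
  - exact I.
  - now apply difference_map_fixpoint.
  - now apply difference_map_fixpoint.
  - intros n; apply Rle_trans with (1 := vnorm_minus _ _).
    generalize (HCu n) (HCv n); lra.
Qed.

Definition impulse y (n : Z) : Y := if Z.eqb n 0 then y else zero.

Definition decay (n : Z) : R := (/ 2) ^ Z.abs_nat n.

Lemma decay_pos n : 0 < decay n.
Proof. apply pow_lt; lra. Qed.

Lemma decay_step n m : (Z.abs_nat n <= Datatypes.S (Z.abs_nat m))%nat -> decay m <= 2 * decay n.
Proof.
  intros H; unfold decay.
  apply Rle_trans with (2 * (/ 2) ^ Datatypes.S (Z.abs_nat m)); [simpl; lra |].
  apply Rmult_le_compat_l; [lra |].
  replace (Datatypes.S (Z.abs_nat m)) with
    (Z.abs_nat n + (Datatypes.S (Z.abs_nat m) - Z.abs_nat n))%nat by lia.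
  rewrite pow_add; rewrite <- (Rmult_1_r ((/ 2) ^ Z.abs_nat n)) at 2.
  apply Rmult_le_compat_l; [apply pow_le; lra |].
  rewrite <- (pow1 (Datatypes.S (Z.abs_nat m) - Z.abs_nat n)); apply pow_incr; lra.
Qed.

(** Solving in the norm weighted by [decay] builds the exponential estimates into the solution. The
    first iterate can be nonzero only at [n = 0], through [P y], and at [n = -1], through the
    inverse on the unstable part. *)
Lemma impulse_response y :
  exists u, difference_solution (impulse y) u /\
    forall n, norm (u n) <= 2 * ((p + 1) * norm y) * decay n.
Proof.
  destruct (exists_fixpoint decay (fun _ => True) (difference_map (impulse y)) ((p + 1) * norm y))
    as [u [_ [Hu Hb]]]; auto.
  - apply difference_map_half_lipschitz; intros n; [apply decay_pos | |]; apply decay_step; lia.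
  - intros n; unfold difference_map; cbv zeta.
    rewrite (rlin_zero P HP), (rlin_zero W HW), (rlin_zero V HV).
    set (z := impulse y (n + 1)).
    assert (HPz : norm (P (impulse y n)) <= p * norm (impulse y n)) by apply P_norm.
    assert (HSz : norm (S (minus (opp z) (P (opp z)))) <= c * norm z).
    { apply Rle_trans with (1 := SQ_norm (opp z)); right; f_equal; apply vnorm_opp. }
    apply Rle_trans with (p * norm (impulse y n) + c * norm z).
    { apply Rle_trans with (norm (P (impulse y n)) + norm (S (minus (opp z) (P (opp z))))); [| lra].
      apply vnorm_decomp.
      match goal with |- context [S (minus ?a _)] => replace a with (opp z) by modeq Y end.
      match goal with |- plus (plus _ (P ?a)) _ = _ =>
        replace a with (impulse y n) by modeq Y end.
      modeq Y. }
    assert (Hn0 : norm (zero : Y) = 0) by exact vnorm0.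
    pose proof (vnorm_ge0 y) as Hy0.
    assert (Hpy : 0 <= p * norm y) by (apply Rmult_le_pos; lra).
    unfold z, impulse.
    destruct (Z.eqb_spec n 0) as [-> | Hn].
    + simpl Z.eqb; cbv iota; unfold decay; simpl; rewrite Hn0; lra.
    + destruct (Z.eqb_spec (n + 1) 0) as [Hn1 | Hn1].
      * replace n with (-1)%Z by lia; unfold decay; simpl; rewrite Hn0; nra.
      * rewrite Hn0; apply Rle_trans with 0; [lra |].
        apply Rmult_le_pos; [lra | left; apply decay_pos].
  - exists u; split; [now apply difference_map_fixpoint | exact Hb].
Qed.

End PerturbedDifferenceEquation.

(** * From impulse responses over the integers to a dichotomy *)

Section DiscreteToContinuous.

Context {k : scalar_field} {Y : CompleteNormedModule (scalars k)}.
Variables (U : R -> Y -> Y) (tau K : R) (G : Y -> Z -> Y).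
Implicit Types x y z : Y.
Implicit Types u v : Z -> Y.

Hypotheses (HU : C0_semigroup U) (Htau : 0 < tau) (HK : 0 <= K).
Hypothesis G_solution : forall x, difference_solution (U tau) (impulse x) (G x).
Hypothesis G_norm : forall x n, norm (G x n) <= K * norm x * decay n.
Hypothesis G_unique : forall x u C, difference_solution (U tau) (impulse x) u ->
  (forall n, norm (u n) <= C) -> forall n, u n = G x n.

Lemma decay_le_1 n : decay n <= 1.
Proof. unfold decay; rewrite <- (pow1 (Z.abs_nat n)); apply pow_incr; lra. Qed.

Lemma response_bounded x n : norm (G x n) <= K * norm x.
Proof.
  apply Rle_trans with (1 := G_norm x n).
  rewrite <- (Rmult_1_r (K * norm x)) at 2.
  apply Rmult_le_compat_l; [apply Rmult_le_pos; [exact HK | apply vnorm_ge0] | apply decay_le_1].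
Qed.

(** [G] is an arbitrary choice of responses; its linearity comes from uniqueness. *)
Lemma response_plus x y n : G (plus x y) n = plus (G x n) (G y n).
Proof.
  symmetry; apply (G_unique (plus x y) (fun n => plus (G x n) (G y n)) (K * norm x + K * norm y)).
  - intros m; rewrite (rlin_plus _ (semigroup_rlinear U HU tau ltac:(lra))).
    rewrite (G_solution x m), (G_solution y m); unfold impulse.
    destruct (Z.eqb _ _); modeq Y.
  - intros m; apply Rle_trans with (1 := vnorm_plus _ _).
    apply Rplus_le_compat; apply response_bounded.
Qed.

Lemma response_scal (c : scalars k) x n : G (scal c x) n = scal c (G x n).
Proof.
  symmetry; apply (G_unique (scal c x) (fun n => scal c (G x n)) (abs c * (K * norm x))).
  - intros m; rewrite (linear_scal _ (C0_bounded U HU tau ltac:(lra))).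
    rewrite (G_solution x m); unfold impulse.
    destruct (Z.eqb _ _); rewrite (scal_distr_l (V := Y)); [reflexivity |].
    f_equal; exact (scal_zero_r (V := Y) c).
  - intros m; apply Rle_trans with (1 := norm_scal (V := Y) c _).
    apply Rmult_le_compat_l; [apply abs_ge_0 | apply response_bounded].
Qed.

Lemma response_opp x n : G (opp x) n = opp (G x n).
Proof.
  transitivity (G (scal (opp one) x) n); [f_equal; symmetry; exact (scal_opp_one (V := Y) x) |].
  rewrite response_scal; exact (scal_opp_one (V := Y) _).
Qed.

(** [U t] commutes with [U tau], so it maps the response to [x] to a bounded response to [U t x]. *)
Lemma response_semigroup t x n : 0 <= t -> G (U t x) n = U t (G x n).
Proof.
  intros Ht; pose proof (semigroup_rlinear U HU t Ht) as HUt.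
  destruct (rlin_norm _ HUt) as [C [HC HUC]].
  symmetry; apply (G_unique (U t x) (fun n => U t (G x n)) (C * (K * norm x))).
  - intros m; rewrite (G_solution x m), (rlin_plus _ HUt).
    rewrite <- !(C0_plus U HU) by lra; rewrite (Rplus_comm tau t).
    f_equal; unfold impulse; destruct (Z.eqb _ _); [reflexivity | apply (rlin_zero _ HUt)].
  - intros m; apply Rle_trans with (1 := HUC _), Rmult_le_compat_l; [exact HC |].
    apply response_bounded.
Qed.

(** Set to zero at negative times, [G x] becomes the bounded response to an impulse equal to its own
    value at 0. *)
Lemma response_idempotent x : G (G x 0%Z) 0%Z = G x 0%Z.
Proof.
  symmetry.
  refine (G_unique (G x 0%Z) (fun n => if Z.leb 0 n then G x n else zero) (K * norm x) _ _ 0%Z).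
  - intros m; unfold impulse.
    destruct (Z.leb_spec 0 (m + 1)), (Z.leb_spec 0 m); try lia.
    + rewrite (proj2 (Z.eqb_neq (m + 1) 0)), (G_solution x m) by lia.
      unfold impulse; rewrite (proj2 (Z.eqb_neq (m + 1) 0)) by lia; reflexivity.
    + replace (m + 1)%Z with 0%Z by lia; simpl.
      rewrite (rlin_zero _ (semigroup_rlinear U HU tau ltac:(lra))); modeq Y.
    + rewrite (proj2 (Z.eqb_neq (m + 1) 0)) by lia.
      rewrite (rlin_zero _ (semigroup_rlinear U HU tau ltac:(lra))); modeq Y.
  - intros m; destruct (Z.leb 0 m); [apply response_bounded |].
    apply Rle_trans with 0; [right; exact vnorm0 |].
    apply Rmult_le_pos; [exact HK | apply vnorm_ge0].
Qed.

(** The part of [G x] before time [- m], translated to end at 0, negated and continued by zero, is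
    the bounded response to the impulse [G x (- m)]; its value at 0 is zero. *)
Lemma response_backward_kernel x (m : Z) : (0 < m)%Z -> G (G x (- m)%Z) 0%Z = zero.
Proof.
  intros Hm; symmetry.
  refine (G_unique (G x (- m)%Z) (fun n => if Z.ltb n 0 then opp (G x (n - m)%Z) else zero)
    (K * norm x) _ _ 0%Z).
  - pose proof (semigroup_rlinear U HU tau ltac:(lra)) as HV.
    intros n; unfold impulse.
    destruct (Z.ltb_spec (n + 1) 0), (Z.ltb_spec n 0); try lia.
    + rewrite (proj2 (Z.eqb_neq (n + 1) 0)), (rlin_opp _ HV) by lia.
      replace (n + 1 - m)%Z with (n - m + 1)%Z by ring.
      rewrite (G_solution x (n - m)%Z); unfold impulse.
      rewrite (proj2 (Z.eqb_neq (n - m + 1) 0)) by lia; modeq Y.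
    + replace n with (- 1)%Z by lia; change (-1 + 1)%Z with 0%Z.
      rewrite Z.eqb_refl, (rlin_opp _ HV).
      pose proof (G_solution x (-1 - m)%Z) as H1; unfold impulse in H1.
      rewrite (proj2 (Z.eqb_neq (-1 - m + 1) 0)) in H1 by lia.
      replace (-1 - m + 1)%Z with (- m)%Z in H1 by ring.
      rewrite H1; modeq Y.
    + rewrite (proj2 (Z.eqb_neq (n + 1) 0)), (rlin_zero _ HV) by lia; modeq Y.
  - intros n; destruct (Z.ltb n 0).
    + rewrite vnorm_opp; apply response_bounded.
    + apply Rle_trans with 0; [right; exact vnorm0 |].
      apply Rmult_le_pos; [exact HK | apply vnorm_ge0].
Qed.

Lemma response_forward x (m : nat) : U (INR m * tau) (G x 0%Z) = G x (Z.of_nat m).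
Proof.
  induction m as [| m IH]; [simpl; now rewrite Rmult_0_l, (C0_zero U HU) |].
  rewrite S_INR; replace ((INR m + 1) * tau) with (tau + INR m * tau) by ring.
  assert (0 <= INR m * tau) by (apply Rmult_le_pos; [apply pos_INR | lra]).
  rewrite (C0_plus U HU), IH by lra.
  rewrite Nat2Z.inj_succ; unfold Z.succ; rewrite (G_solution x (Z.of_nat m)).
  unfold impulse; rewrite (proj2 (Z.eqb_neq (Z.of_nat m + 1) 0)) by lia; modeq Y.
Qed.

(** If the response vanishes at 0, the impulse [x] cancels the orbit arriving there, which therefore
    ends at [opp x]. This is the source of the sign in the inverse of [U t]. *)
Lemma response_backward x (m : nat) :
  G x 0%Z = zero -> (0 < m)%nat -> U (INR m * tau) (G x (- Z.of_nat m)%Z) = opp x.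
Proof.
  intros Hx Hm; induction m as [| m IH]; [lia |].
  assert (Hmt : 0 <= INR m * tau) by (apply Rmult_le_pos; [apply pos_INR | lra]).
  rewrite S_INR; replace ((INR m + 1) * tau) with (INR m * tau + tau) by ring.
  rewrite (C0_plus U HU) by lra.
  pose proof (G_solution x (- Z.of_nat (Datatypes.S m))%Z) as H1.
  replace (- Z.of_nat (Datatypes.S m) + 1)%Z with (- Z.of_nat m)%Z in H1 by lia.
  destruct m as [| m].
  - simpl INR; rewrite Rmult_0_l, (C0_zero U HU).
    simpl Z.of_nat in H1 |- *; simpl Z.opp in H1 |- *; rewrite Hx in H1.
    unfold impulse in H1; simpl Z.eqb in H1; cbv iota in H1.
    transitivity (minus (plus (U tau (G x (-1)%Z)) x) x); [modeq Y |].
    rewrite <- H1; modeq Y.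
  - unfold impulse in H1.
    rewrite (proj2 (Z.eqb_neq (- Z.of_nat (Datatypes.S m)) 0)) in H1 by lia.
    rewrite <- (IH ltac:(lia)), H1; f_equal; modeq Y.
Qed.

(** [up] rounds strictly upwards, so the number of steps is positive even for [t = 0], as
    [response_backward] requires. *)
Definition period (t : R) : nat := Z.to_nat (up (t / tau)).

Lemma period_spec t : 0 <= t ->
  (0 < period t)%nat /\ t <= INR (period t) * tau /\ (INR (period t) - 1) * tau <= t.
Proof.
  intros Ht; destruct (archimed (t / tau)) as [H1 H2].
  assert (H0 : 0 <= t / tau) by (apply Rdiv_le_0_compat; lra).
  assert (Hup : (0 < up (t / tau))%Z) by (apply lt_IZR; lra).
  assert (HI : INR (period t) = IZR (up (t / tau))).
  { unfold period; rewrite INR_IZR_INZ, Z2Nat.id by lia; reflexivity. }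
  rewrite HI; split; [unfold period; lia | split].
  - apply Rle_trans with (t / tau * tau); [right; field; lra |].
    apply Rmult_le_compat_r; lra.
  - apply Rle_trans with (t / tau * tau); [| right; field; lra].
    apply Rmult_le_compat_r; lra.
Qed.

Lemma half_pow_period t : 0 <= t -> (/ 2) ^ period t <= exp (- (ln 2 / tau) * t).
Proof.
  intros Ht; destruct (period_spec t Ht) as [_ [H _]].
  rewrite <- (exp_ln (/ 2)) at 1 by lra; rewrite <- exp_INR_mult; apply exp_le.
  rewrite ln_Rinv by lra.
  assert (Hln : 0 < ln 2 / tau).
  { apply Rdiv_lt_0_compat; [rewrite <- ln_1; apply ln_increasing; lra | exact Htau]. }
  replace (INR (period t) * - ln 2) with (- (ln 2 / tau) * (INR (period t) * tau)) by (field; lra).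
  nra.
Qed.

Lemma dichotomy_of_response : dichotomy U.
Proof.
  destruct (semigroup_locally_bounded U HU tau) as [L [HL HUL]].
  (* Go back [period t] whole steps along the response to [x], then forward by the remainder, which
     is at most [tau]. *)
  pose (S t x := opp (U (INR (period t) * tau - t) (G x (- Z.of_nat (period t))%Z))).
  assert (HLK : 0 <= L * K) by (apply Rmult_le_pos; lra).
  (* The rate is that of halving once per [tau]. The 2 pays for the incomplete step in the stable
     estimate, and the 1 ensures that the constant is at least 1. *)
  exists (fun x => G x 0%Z), S, (1 + 2 * (L * K)), (ln 2 / tau).
  split; [| split; [| split; [| split; [| split; [| split; [| split]]]]]].
  - split.
    + intros; apply response_plus.
    + intros; apply response_scal.
    + exists (K + 1); split; [lra |]; intros x.
      apply Rle_trans with (1 := response_bounded x 0).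
      apply Rmult_le_compat_r; [apply vnorm_ge0 | lra].
  - apply response_idempotent.
  - lra.
  - apply Rdiv_lt_0_compat; [rewrite <- ln_1; apply ln_increasing; lra | exact Htau].
  - intros t x Ht; symmetry; now apply response_semigroup.
  - intros t x Ht Hx; destruct (period_spec t Ht) as [Hm [Hm1 Hm2]].
    assert (Hr : 0 <= INR (period t) * tau - t) by lra.
    split; [| split; [| split]].
    + rewrite response_semigroup, Hx by exact Ht.
      apply (rlin_zero _ (semigroup_rlinear U HU t Ht)).
    + unfold S; rewrite response_opp, response_semigroup by exact Hr.
      rewrite response_backward_kernel by lia.
      rewrite (rlin_zero _ (semigroup_rlinear U HU _ Hr)); modeq Y.
    + unfold S; rewrite response_semigroup, <- (C0_plus U HU) by assumption.
      replace (INR (period t) * tau - t + t) with (INR (period t) * tau) by ring.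
      rewrite response_backward by assumption; modeq Y.
    + unfold S; rewrite (rlin_opp _ (semigroup_rlinear U HU t Ht)).
      rewrite <- (C0_plus U HU) by assumption.
      replace (t + (INR (period t) * tau - t)) with (INR (period t) * tau) by ring.
      rewrite response_backward by assumption; modeq Y.
  - intros t x Ht [y ->]; set (x := G y 0%Z).
    assert (Hx : G x 0%Z = x) by apply response_idempotent.
    destruct (period_spec t Ht) as [Hm [Hm1 Hm2]].
    (* Forward time is rounded down to [m = period t - 1] whole steps, whereas backward time is
       rounded up. *)
    destruct (period t) as [| m] eqn:Hper; [lia |].
    rewrite S_INR in Hm1, Hm2.
    assert (Hmt : 0 <= INR m * tau) by (apply Rmult_le_pos; [apply pos_INR | lra]).
    rewrite <- Hx at 1.
    replace t with (t - INR m * tau + INR m * tau) at 1 by ring.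
    rewrite (C0_plus U HU), response_forward by lra.
    pose proof (half_pow_period t Ht) as Hp; rewrite Hper in Hp; simpl in Hp.
    apply Rle_trans with (L * norm (G x (Z.of_nat m))); [apply HUL; lra |].
    apply Rle_trans with (L * (K * norm x * (/ 2) ^ m)).
    { apply Rmult_le_compat_l; [exact HL |]; apply Rle_trans with (1 := G_norm x _).
      right; unfold decay; now rewrite Zabs2Nat.id. }
    apply Rle_trans with (2 * (L * K) * exp (- (ln 2 / tau) * t) * norm x).
    + replace (L * (K * norm x * (/ 2) ^ m)) with (2 * (L * K) * (/ 2 * (/ 2) ^ m) * norm x) by field.
      apply Rmult_le_compat_r; [apply vnorm_ge0 |].
      apply Rmult_le_compat_l; lra.
    + apply Rmult_le_compat_r; [apply vnorm_ge0 |].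
      apply Rmult_le_compat_r; [left; apply exp_pos | lra].
  - intros t x Ht Hx; destruct (period_spec t Ht) as [Hm [Hm1 Hm2]].
    unfold S; rewrite vnorm_opp.
    pose proof (half_pow_period t Ht) as Hp.
    apply Rle_trans with (L * norm (G x (- Z.of_nat (period t))%Z)); [apply HUL; lra |].
    apply Rle_trans with (L * (K * norm x * (/ 2) ^ period t)).
    { apply Rmult_le_compat_l; [exact HL |]; apply Rle_trans with (1 := G_norm x _).
      right; unfold decay; f_equal; f_equal; lia. }
    replace (L * (K * norm x * (/ 2) ^ period t)) with (L * K * (/ 2) ^ period t * norm x) by ring.
    apply Rmult_le_compat_r; [apply vnorm_ge0 |].
    apply Rmult_le_compat; try lra; apply pow_le; lra.
Qed.

End DiscreteToContinuous.

(** [tau] and [eps] depend on the dichotomy of [W] alone, through [N], [beta] and a bound [p] of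
    [P]; the complementary projection is bounded by [1 + p]. *)
Lemma dichotomy_perturbation {k : scalar_field} {Y : CompleteNormedModule (scalars k)}
  (W : R -> Y -> Y) :
  C0_semigroup W -> dichotomy W ->
  exists tau eps, 0 < tau /\ 0 < eps /\
    forall U : R -> Y -> Y, C0_semigroup U ->
      (forall x, norm (minus (U tau x) (W tau x)) <= eps * norm x) -> dichotomy U.
Proof.
  intros HW [P [S [N [beta [HP [Pid [HN [Hbeta [HWP [Hker [Hst Hun]]]]]]]]]]].
  pose proof (is_linear_rlinear P HP) as HP'.
  destruct (rlin_norm P HP') as [p [Hp HPp]].
  (* With [q = N * (1 + p)] one has [beta * tau = 16 * q], hence [c = q * exp (- 16 q) <= q / (16 q)
     = / 16]. *)
  pose (tau := 16 * N * (1 + p) / beta).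
  assert (Htau : 0 < tau).
  { apply Rdiv_lt_0_compat; [| exact Hbeta]; repeat apply Rmult_lt_0_compat; lra. }
  pose (c := N * exp (- beta * tau) * (1 + p)).
  assert (HNp : 0 < N * (1 + p)) by (apply Rmult_lt_0_compat; lra).
  assert (Hc0 : 0 <= N * exp (- beta * tau)).
  { apply Rmult_le_pos; [lra | left; apply exp_pos]. }
  assert (Hc : 0 <= c <= / 16).
  { split; [apply Rmult_le_pos; lra |].
    unfold c; replace (- beta * tau) with (- (16 * (N * (1 + p)))) by (unfold tau; field; lra).
    replace (N * exp (- (16 * (N * (1 + p)))) * (1 + p)) with
      (N * (1 + p) * exp (- (16 * (N * (1 + p))))) by ring.
    rewrite exp_Ropp; set (q := N * (1 + p)) in *.
    pose proof (exp_ineq1_le (16 * q)) as He.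
    apply Rle_trans with (q * / (16 * q)); [| right; field; lra].
    apply Rmult_le_compat_l; [lra |]; apply Rinv_le_contravar; lra. }
  (* Gives both [eps <= 1] and [p * eps <= / 16], as the contraction estimate requires. *)
  pose (eps := / (16 * (1 + p))).
  assert (Heps : 0 < eps) by (apply Rinv_0_lt_compat; lra).
  assert (Heps1 : eps * (16 * (1 + p)) = 1) by (unfold eps; field; lra).
  exists tau, eps; split; [exact Htau | split; [exact Heps |]]; intros U HU Hclose.
  pose proof (semigroup_rlinear W HW tau ltac:(lra)) as HWt.
  pose proof (semigroup_rlinear U HU tau ltac:(lra)) as HUt.
  assert (HWPn : forall x, norm (W tau (P x)) <= c * norm x).
  { intros x; apply Rle_trans with (1 := Hst tau (P x) ltac:(lra) (ex_intro _ x eq_refl)).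
    replace (c * norm x) with (N * exp (- beta * tau) * ((1 + p) * norm x)) by (unfold c; ring).
    apply Rmult_le_compat_l; [exact Hc0 |].
    apply Rle_trans with (1 := HPp x), Rmult_le_compat_r; [apply vnorm_ge0 | lra]. }
  assert (HSQn : forall x, norm (S tau (minus x (P x))) <= c * norm x).
  { intros x; apply Rle_trans with (1 := Hun tau (minus x (P x)) ltac:(lra)
      (kernel_complement P HP' Pid x)).
    replace (c * norm x) with (N * exp (- beta * tau) * ((1 + p) * norm x)) by (unfold c; ring).
    apply Rmult_le_compat_l; [exact Hc0 |].
    apply Rle_trans with (1 := vnorm_minus _ _); generalize (HPp x); lra. }
  assert (Hep : 0 <= eps <= 1) by nra.
  assert (Hpe : p * eps <= / 16) by nra.
  assert (PW : forall x, W tau (P x) = P (W tau x)) by (intros; apply HWP; lra).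
  assert (HPS : forall x, P x = zero -> P (S tau x) = zero) by (intros; apply Hker; [lra | assumption]).
  assert (HSW : forall x, P x = zero -> S tau (W tau x) = x) by (intros; apply Hker; [lra | assumption]).
  assert (HWS : forall x, P x = zero -> W tau (S tau x) = x) by (intros; apply Hker; [lra | assumption]).
  pose proof (impulse_response P (W tau) (S tau) (U tau) p c eps HP' HWt HUt Pid PW HPS HSW HWS
    HPp HWPn HSQn Hclose Hp Hc Hep Hpe) as Hex.
  pose (G x := epsilon (inhabits (fun _ : Z => (zero : Y)))
    (fun u => difference_solution (U tau) (impulse x) u /\
      forall n, norm (u n) <= 2 * ((p + 1) * norm x) * decay n)).
  assert (HG : forall x, difference_solution (U tau) (impulse x) (G x) /\
      forall n, norm (G x n) <= 2 * ((p + 1) * norm x) * decay n).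
  { intros x; exact (epsilon_spec (inhabits (fun _ : Z => (zero : Y))) _ (Hex x)). }
  apply (dichotomy_of_response U tau (2 * (p + 1)) G HU Htau ltac:(lra)).
  - intros x; apply HG.
  - intros x n; apply Rle_trans with (1 := proj2 (HG x) n); right; ring.
  - intros x u C Hu HC.
    apply (difference_solution_unique P (W tau) (S tau) (U tau) p c eps HP' HWt HUt Pid PW HPS HSW HWS
      HPp HWPn HSQn Hclose Hp Hc Hep Hpe (impulse x) u (G x)
      (Rmax C (2 * ((p + 1) * norm x)))).
    + exact Hu.
    + apply HG.
    + intros n; apply Rle_trans with (1 := HC n), Rmax_l.
    + intros n; apply Rle_trans with (2 := Rmax_r _ _), Rle_trans with (1 := proj2 (HG x) n).
      rewrite <- (Rmult_1_r (2 * ((p + 1) * norm x))) at 2.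
      apply Rmult_le_compat_l; [| apply decay_le_1].
      apply Rmult_le_pos; [lra |]; apply Rmult_le_pos; [lra | apply vnorm_ge0].
Qed.

(** * Operator norms and the Yosida distance *)

Lemma opnorm_bound {k : scalar_field} {Y Z : CompleteNormedModule (scalars k)}
  (L : Y -> Z) (C : R) :
  rlinear L -> Rbar_le (opnorm L) C -> forall x, norm (L x) <= C * norm x.
Proof.
  intros HL HC x; destruct (Rle_lt_or_eq_dec _ _ (vnorm_ge0 x)) as [Hx | Hx].
  - assert (Hinv : 0 < / norm x) by now apply Rinv_0_lt_compat.
    assert (H : Rbar_le (norm (L (rscal (/ norm x) x))) C).
    { apply Rbar_le_trans with (2 := HC).
      apply (proj1 (Lub_Rbar_correct (fun r => exists x, norm x <= 1 /\ r = norm (L x)))).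
      exists (rscal (/ norm x) x); split; [| reflexivity].
      rewrite vnorm_rscal_pos by lra; right; field; lra. }
    simpl in H; rewrite (rlin_rscal L HL), vnorm_rscal_pos in H by lra.
    apply (Rmult_le_compat_l (norm x)) in H; [| lra].
    rewrite <- Rmult_assoc, Rinv_r in H by lra; lra.
  - destruct (rlin_norm L HL) as [D [_ HD]].
    generalize (HD x); rewrite <- Hx, !Rmult_0_r; auto.
Qed.

Lemma rlinear_minus {k : scalar_field} {Y Z : CompleteNormedModule (scalars k)} (L N : Y -> Z) :
  rlinear L -> rlinear N -> rlinear (fun x => minus (L x) (N x)).
Proof.
  intros HL HN; split.
  - intros x y; rewrite (rlin_plus L HL), (rlin_plus N HN); modeq Z.
  - intros r x; rewrite (rlin_rscal L HL), (rlin_rscal N HN); modeq Z.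
  - destruct (rlin_norm L HL) as [C [HC HLC]], (rlin_norm N HN) as [D [HD HND]].
    exists (C + D); split; [lra |]; intros x; apply Rle_trans with (1 := vnorm_minus _ _).
    generalize (HLC x) (HND x); lra.
Qed.

(** The infimum over [a] of the suprema over [mu >= a] lies below [eta], so one of these suprema
    does. *)
Lemma limsup_p_infty_lt (f : R -> Rbar) (eta : R) :
  Rbar_lt (limsup_p_infty f) eta -> exists a, forall mu, a <= mu -> Rbar_le (f mu) eta.
Proof.
  unfold limsup_p_infty, Rbar_glb; intros H.
  destruct (Rbar_ex_glb _) as [l [Hl0 Hl]]; simpl in H.
  apply NNPP; intros Hn; apply (Rbar_lt_not_le _ _ H), Hl; intros c [a Hc]; subst c.
  unfold Rbar_lub; destruct (Rbar_ex_lub _) as [c [Hc Hc0]]; simpl.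
  apply (Rbar_not_lt_le c eta); intros Hlt; apply Hn; exists a; intros mu Hmu.
  apply Rbar_le_trans with c; [| now apply Rbar_lt_le].
  apply Hc; now exists mu.
Qed.

(** The resolvent estimates assume [1 <= M] and [0 <= w]; enlarging the given constants achieves
    this. *)
Lemma growth_of_opnorm {k : scalar_field} {Y : CompleteNormedModule (scalars k)}
  (T : R -> Y -> Y) (M omega : R) :
  C0_semigroup T -> (forall t, 0 <= t -> Rbar_le (opnorm (T t)) (M * exp (omega * t))) ->
  growth T (Rmax M 1) (Rmax omega 0).
Proof.
  intros HT H t x Ht.
  apply Rle_trans with (M * exp (omega * t) * norm x).
  - apply (opnorm_bound (T t)); [now apply semigroup_rlinear | now apply H].
  - apply Rmult_le_compat_r; [apply vnorm_ge0 |].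
    apply Rle_trans with (Rmax M 1 * exp (omega * t)).
    + apply Rmult_le_compat_r; [left; apply exp_pos | apply Rmax_l].
    + apply Rmult_le_compat_l; [generalize (Rmax_r M 1); lra |].
      apply exp_le, Rmult_le_compat_r; [exact Ht | apply Rmax_l].
Qed.

(** The factor [t] is absorbed by [exp t], which brings the bound into the purely exponential form
    assumed when solution semigroups are compared. *)
Lemma yosida_dist_semigroup_distance {k : scalar_field} {Y : CompleteNormedModule (scalars k)}
  (A0 A1 : operator Y) (T0 T1 : R -> Y -> Y) (M w eta : R) :
  generates A0 T0 -> generates A1 T1 -> 1 <= M -> 0 <= w ->
  growth T0 M w -> growth T1 M w -> 0 <= eta -> Rbar_lt (yosida_dist A0 A1) eta ->
  forall t x, 0 <= t ->
    norm (minus (T0 t x) (T1 t x)) <= eta * (M ^ 2 * exp ((2 * w + 3) * t)) * norm x.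
Proof.
  intros HA0 HA1 HM Hw Hg0 Hg1 Heta Hd t x Ht.
  destruct (limsup_p_infty_lt _ _ Hd) as [a Ha].
  apply Rle_trans with (eta * (M ^ 2 * (t * exp (2 * (w + 1) * t))) * norm x).
  - apply (semigroup_distance A0 A1 T0 T1 M w eta (Rmax a (w + 2))); try assumption.
    intros mu y Hmu; pose proof (Rmax_l a (w + 2)); pose proof (Rmax_r a (w + 2)).
    apply (opnorm_bound (fun y => minus (yosida A0 mu y) (yosida A1 mu y))).
    + assert (Hyos : forall (A : operator Y) (T : R -> Y -> Y), generates A T -> growth T M w ->
        rlinear (yosida A mu)).
      { intros A T [HT HA] Hg.
        assert (HR : rlinear (resolvent A mu)).
        { apply (resolvent_rlinear A T M w HT HA HM Hw Hg mu); lra. }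
        unfold yosida; apply rlinear_minus; split.
        - intros; rewrite (rlin_plus _ HR); modeq Y.
        - intros; rewrite (rlin_rscal _ HR); modeq Y.
        - destruct (rlin_norm _ HR) as [C [HC HRC]]; exists (mu ^ 2 * C); split.
          + apply Rmult_le_pos; [apply pow2_ge_0 | exact HC].
          + intros z; rewrite vnorm_rscal_pos, Rmult_assoc by apply pow2_ge_0.
            apply Rmult_le_compat_l; [apply pow2_ge_0 | apply HRC].
        - intros; modeq Y.
        - intros; modeq Y.
        - exists (Rabs mu); split; [apply Rabs_pos |]; intros z; rewrite vnorm_rscal; lra. }
      apply rlinear_minus; [now apply (Hyos A0 T0) | now apply (Hyos A1 T1)].
    + apply Ha; lra.
  - apply Rmult_le_compat_r; [apply vnorm_ge0 |].
    apply Rmult_le_compat_l; [exact Heta |]; apply Rmult_le_compat_l; [apply pow2_ge_0 |].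
    replace ((2 * w + 3) * t) with (t + 2 * (w + 1) * t) by ring; rewrite exp_plus.
    apply Rmult_le_compat_r; [left; apply exp_pos |]; generalize (exp_ineq1_le t); lra.
Qed.

Theorem theorem4p7 (k : scalar_field) (X : CompleteNormedModule (scalars k))
  (M omega : R)
  (A0 : operator X) (T0 : R -> X -> X) (B0 : CI X -> X)
  (hA0 : generates A0 T0)
  (hT0 : forall t : R, 0 <= t -> Rbar_le (opnorm (T0 t)) (M * exp (omega * t)))
  (hB0 : is_linear B0)
  (hdich : delay_dichotomy A0 B0) :
  exists eta : R, 0 < eta /\
    forall (A1 : operator X) (T1 : R -> X -> X) (B1 : CI X -> X),
      generates A1 T1 ->
      (forall t : R, 0 <= t ->
         Rbar_le (opnorm (T1 t)) (M * exp (omega * t))) ->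
      is_linear B1 ->
      Rbar_lt (yosida_dist A0 A1) eta ->
      Rbar_lt (opnorm (fun f => minus (B0 f) (B1 f))) eta ->
      delay_dichotomy A1 B1.
Proof.
  destruct hdich as [W [HW HWd]].
  destruct (dichotomy_perturbation (Y := CI_CompleteNormedModule (X := X)) W (proj1 HW) HWd)
    as [tau [eps [Htau [Heps Hpert]]]].
  pose (M1 := Rmax M 1); pose (w1 := Rmax omega 0).
  assert (HM1 : 1 <= M1) by apply Rmax_r.
  assert (Hw1 : 0 <= w1) by apply Rmax_r.
  (* The constants of the semigroup difference; they dominate [M1] and [w1], so one pair serves for
     growth and for comparison. *)
  pose (M2 := M1 ^ 2); pose (w2 := 2 * w1 + 3).
  assert (HM2 : M1 <= M2) by (unfold M2; simpl; nra).
  assert (Hw2 : w1 <= w2) by (unfold w2; lra).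
  assert (Hgrow : forall T : R -> X -> X, growth T M1 w1 -> growth T M2 w2).
  { intros T HT t x Ht; apply Rle_trans with (1 := HT t x Ht).
    apply Rmult_le_compat_r; [apply vnorm_ge0 |].
    apply Rmult_le_compat; [lra | left; apply exp_pos | exact HM2 |].
    apply exp_le, Rmult_le_compat_r; assumption. }
  pose proof (is_linear_rlinear (Y := CI_CompleteNormedModule (X := X)) B0 hB0) as HB0.
  destruct (rlin_norm _ HB0) as [b0 [Hb0 HB0b]].
  (* As [eta <= 1], this bounds every admissible [B1] as well as [B0], so the delay rate does not
     depend on the perturbation. *)
  pose (b := b0 + 1).
  (* The time-[tau] maps of the two solution semigroups will differ by at most [eta * K] in norm. *)
  pose (K := comparison_constant M2 b * exp (delay_rate M2 w2 b * tau)).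
  assert (HK : 0 < K).
  { apply Rmult_lt_0_compat; [| apply exp_pos]; unfold comparison_constant, b.
    assert (0 <= 2 * M2 * M2 * (b0 + 1 + 1)) by (repeat apply Rmult_le_pos; lra); lra. }
  pose (eta := Rmin 1 (eps / K)).
  assert (Heta : 0 < eta) by (apply Rmin_glb_lt; [lra | now apply Rdiv_lt_0_compat]).
  assert (Heta1 : eta <= 1) by apply Rmin_l.
  assert (HetaK : eta * K <= eps).
  { apply Rle_trans with (eps / K * K); [| right; field; lra].
    apply Rmult_le_compat_r; [lra | apply Rmin_r]. }
  exists eta; split; [exact Heta |]; intros A1 T1 B1 hA1 hT1 hB1 hA hB.
  pose proof (is_linear_rlinear (Y := CI_CompleteNormedModule (X := X)) B1 hB1) as HB1.
  assert (HB01 : forall f, norm (minus (B0 f) (B1 f)) <= eta * norm f).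
  { apply (opnorm_bound (Y := CI_CompleteNormedModule (X := X))).
    - exact (rlinear_minus _ _ HB0 HB1).
    - now apply Rbar_lt_le. }
  assert (HB0b' : forall f, norm (B0 f) <= b * norm f).
  { intros f; apply Rle_trans with (1 := HB0b f), Rmult_le_compat_r; [| unfold b; lra].
    exact (vnorm_ge0 (Y := CI_CompleteNormedModule (X := X)) f). }
  assert (HB1b : forall f, norm (B1 f) <= b * norm f).
  { intros f; apply Rle_trans with (norm (B0 f) + norm (minus (B1 f) (B0 f))).
    - apply vnorm_decomp; modeq X.
    - rewrite vnorm_sym; unfold b; rewrite Rmult_plus_distr_r.
      apply Rplus_le_compat; [apply HB0b |]; apply Rle_trans with (1 := HB01 f).
      apply Rmult_le_compat_r; [| exact Heta1].
      exact (vnorm_ge0 (Y := CI_CompleteNormedModule (X := X)) f). }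
  assert (Hb : 0 <= b) by (unfold b; lra).
  assert (HM : 1 <= M2) by lra.
  assert (Hw : 0 <= w2) by lra.
  pose proof (growth_of_opnorm T0 M omega (proj1 hA0) hT0) as Hg0.
  pose proof (growth_of_opnorm T1 M omega (proj1 hA1) hT1) as Hg1.
  assert (HT01 : forall t x, 0 <= t ->
    norm (minus (T0 t x) (T1 t x)) <= eta * (M2 * exp (w2 * t)) * norm x).
  { apply (yosida_dist_semigroup_distance A0 A1 T0 T1 M1 w1 eta); try assumption; lra. }
  pose proof (Hgrow T0 Hg0) as Hg0'; pose proof (Hgrow T1 Hg1) as Hg1'.
  destruct hA0 as [HT0 HA0], hA1 as [HT1 HA1].
  pose proof (delay_semigroup_generated T0 B0 M2 w2 b HT0 HM Hw Hg0' hB0 Hb HB0b' A0 HA0) as HU0.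
  pose proof (delay_semigroup_generated T1 B1 M2 w2 b HT1 HM Hw Hg1' hB1 Hb HB1b A1 HA1) as HU1.
  exists (delay_semigroup T1 B1 M2 w2 b); split; [exact HU1 |].
  apply Hpert; [exact (proj1 HU1) |]; intros phi.
  (* [W] is known only through its generator; here it is replaced by the semigroup of mild
     solutions. *)
  rewrite (semigroup_unique (Y := CI_CompleteNormedModule (X := X)) _ _ _ HW HU0 tau phi) by lra.
  rewrite (vnorm_sym (Y := CI_CompleteNormedModule (X := X))).
  apply Rle_trans with (1 := delay_semigroup_distance T0 T1 B0 B1 M2 w2 b eta HT0 HT1 HM Hw Hg0' Hg1'
    hB0 hB1 Hb HB0b' HB1b ltac:(lra) HT01 HB01 tau phi ltac:(lra)).
  apply Rmult_le_compat_r; [exact (vnorm_ge0 (Y := CI_CompleteNormedModule (X := X)) phi) |].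
  rewrite Rmult_assoc; exact HetaK.
Qed.
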